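(* Let $(X,\mathcal{T})$ be a Markov tree with nonnegative components on an undirected tree $\mathcal{T}=(V,E)$, $X=(X_v)_{v\in V}$, and let $U\subset V$ be non-empty. Assume there exists a positive function $b$, regularly varying at infinity with index $\alpha>0$, such that $b(t)\,\mathbb{P}(X_u>t)\to c_u\in(0,\infty)$ as $t\to\infty$ for every $u\in U$. Write $E_U=\bigcup_{u\in U}E_u$ and assume: (i) for every $e=(a,b)\in E_U$ there exist a version of the conditional distribution of $X_b$ given $X_a$ and a probability measure $\mu_e$ on $[0,\infty)$ such that the law of $X_b/x_a$ conditionally on $X_a=x_a$ converges weakly to $\mu_e$ as $x_a\to\infty$; (ii) for every edge $e=(a,b)\in E_U$ for which there exist $u\in U$ with $e\in E_u$ and an edge $\bar e\in[u\rightsquigarrow a]$ with $\mu_{\bar e}(\{0\})>0$, we have $$\forall\eta>0,\qquad\lim_{\delta\downarrow0}\ \limsup_{x\to\infty}\ \sup_{\varepsilon\in[0,\delta]}\mathbb{P}(X_b/x>\eta\mid X_a=\varepsilon x)=0.$$ Let $(M_e)_{e\in E_U}$ be independent random variables such that $M_e$ has law $\mu_e$ for each $e\in E_U$. For $u\in U$ define $\Theta_u=(\Theta_{u,v})_{v\in V}$ by $\Theta_{u,u}=1$ and $\Theta_{u,v}=\prod_{e\in[u\rightsquigarrow v]}M_e$ for $v\in V\setminus\{u\}$. Then, as $t\to\infty$: (a) for every $u\in U$, $\mathcal{L}(X/X_u\mid X_u>t)\to\mathcal{L}(\Theta_u)$ weakly; (b) for every $u\in U$, $\mathcal{L}(X_u/t,\,X/X_u\mid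 X_u>t)\to\mathrm{Pa}(\alpha)\otimes\mathcal{L}(\Theta_u)$ weakly; (c) for every $u\in U$, $\mathcal{L}(X/t\mid X_u>t)\to\mathcal{L}(Y_u)$ weakly, where $Y_u=(Y_{u,v})_{v\in V}$ is equal in distribution to $Y_{u,u}\Theta_u$ with $Y_{u,u}\sim\mathrm{Pa}(\alpha)$ independent of $\Theta_u$; (d) there exists $\nu\in\mathcal{M}_{0,U}$ such that $b(t)\,\mathbb{P}(X/t\in\cdot)\to\nu$ in $\mathcal{M}_{0,U}$, and, for every $u\in U$, $b(t)\,\mathbb{P}(X/t\in\cdot)$ converges in $\mathcal{M}_{0,u}$ to the restriction of $\nu$ to $\mathbb{S}_{0,u}$. Moreover, for every $u\in U$, $\mathbb{P}(Y_u\in\cdot)=c_u^{-1}\,\nu(\cdot\cap\{x:x_u>1\})$, and for every Borel measurable $f:\mathbb{S}_{0,U}\to[0,\infty]$, $$\int_{\mathbb{S}_{0,U}}f(x)\,\mathbf 1\{x_u>0\}\,\mathrm d\nu(x)=c_u\,\mathbb{E}\left[\int_0^\infty f(z\Theta_u)\,\alpha z^{-\alpha-1}\,\mathrm dz\right].$$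
   Context: Graphs are finite, without self-loops; $V$ has at least two elements and $E\subset V\times V$. A graph is undirected if $(a,b)\in E$ implies $(b,a)\in E$. A path from $u$ to $v$ is a set of edges $\{e_1,\dots,e_n\}\subset E$ with $e_k=(u_{k-1},u_k)$ for distinct nodes $u_0=u,u_1,\dots,u_n=v$. An undirected tree is an undirected graph such that for any two distinct nodes $u,v$ there is a unique path from $u$ to $v$, denoted $[u\rightsquigarrow v]$ (a set of directed edges; $[u\rightsquigarrow u]=\emptyset$). For $u\in V$, $E_u\subset E$ denotes the set of edges directed away from $u$: for each pair of edges $(a,b),(b,a)\in E$, $E_u$ contains the one whose first node separates the second node from $u$ (or equals $u$). $(X,\mathcal{T})$ is a Markov tree if it has the global Markov property: whenever $A,B,S\subset V$ are disjoint and non-empty and every path between a node of $A$ and a node of $B$ passes through $S$, the vectors $X_A$ and $X_B$ are conditionally independent given $X_S$, where $X_W=(X_v)_{v\in W}$. The conditional probabilities in (ii) are computed with the versions of the conditional distributions from (i). $\mathcal{L}(Z\mid A)$ is the conditional law of $Z$ given the event $A$. A positive, measurable function $b$ on a neighbourhood of infinity is regularly varying with index $\tau$ if $b(\lambda t)/b(t)\to\lambda^\tau$ as $t\to\infty$ for all $\lambda>0$. $\mathrm{Pa}(\alpha)$ is the Pareto law on $[1,\infty)$: $\mathbb{P}(Z>z)=z^{-\alpha}$, $z\ge1$. $\otimes$ denotes product measure. Put $\mathbb{S}=[0,\infty)^V$, $x_U=(x_u)_{u\in U}$ and $\mathbb{S}_{0,U}=\{x\in\mathbb{S}:\max(x_U)>0\}$.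 $\mathcal{M}_{0,U}$ is the set of Borel measures $\nu$ on $\mathbb{S}_{0,U}$ such that $\nu(B)<\infty$ for every Borel set $B$ contained in $\{x\in\mathbb{S}:\max(x_U)\ge\varepsilon\}$ for some $\varepsilon>0$, equipped with the smallest topology making $\nu\mapsto\int f\,\mathrm d\nu$ continuous for all bounded continuous $f:\mathbb{S}_{0,U}\to\mathbb{R}$ for which there is $\varepsilon>0$ with $f(x)=0$ whenever $\max(x_U)\le\varepsilon$. The measures $b(t)\mathbb{P}(X/t\in\cdot)$ are understood as restricted to $\mathbb{S}_{0,U}$. For $U=\{u\}$ one writes $\mathbb{S}_{0,u}$, $\mathcal{M}_{0,u}$. *)

(* Defs.v *)
From HB Require Import structures.
From mathcomp Require Import all_boot all_order all_algebra.
From mathcomp Require Import all_classical all_reals all_analysis.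
From mathcomp Require Import measurable_realfun.

Set Implicit Arguments.
Unset Strict Implicit.
Unset Printing Implicit Defensive.
Import Order.TTheory GRing.Theory Num.Theory.
Import numFieldNormedType.Exports.

Section trees.
Variables (V : finType) (E : rel V).

(* [p] lists the nodes of the path after its starting point [u]. *)
Definition simple_path (u v : V) (p : seq V) : bool :=
  [&& path E u p, last u p == v & uniq (u :: p)].

Definition path_edges (u : V) (p : seq V) : {set V * V} :=
  [set e in zip (u :: p) p]%SET.

Definition is_path (u v : V) (W : {set V * V}) : Prop :=
  exists2 p, simple_path u v p & W = path_edges u p.

Definition undirected_tree : Prop :=
  [/\ irreflexive E, symmetric E &
      forall u v, u != v -> exists! W, is_path u v W].

(* In a tree this is the edge set of the unique path; it is empty if u = v,
   the only simple path from u to u being the one without edges. *)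
Definition tree_path (u v : V) : {set V * V} :=
  xget finset.set0 (is_path u v).

(* (a, b) is directed away from u iff a = u or a separates b from u. *)
Definition edges_from (u : V) : {set V * V} :=
  [set e | E e.1 e.2 &&
    `[< e.1 = u \/ forall p, simple_path u e.2 p -> e.1 \in u :: p >]]%SET.

Definition edges_from_set (U : {set V}) : {set V * V} :=
  (\bigcup_(u in U) edges_from u)%SET.

Definition separates (S A B : {set V}) : Prop :=
  forall a b p, a \in A -> b \in B -> simple_path a b p ->
    exists2 s, s \in S & s \in a :: p.

End trees.

Local Open Scope classical_set_scope.
Local Open Scope ring_scope.

(* No compatibility is required between the two structures; in the instances
   below the sigma-algebra is the Borel one (for products, by second
   countability). *)
#[short(type="topMeasurableType")]
HB.structure Definition TopMeasurable d := {T of Measurable d T & Topological T}.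

HB.instance Definition _ (R : realType) := Measurable.on R.

HB.instance Definition _ d1 d2 (T1 : topMeasurableType d1)
  (T2 : topMeasurableType d2) := Measurable.on (T1 * T2)%type.

(* R^V with the product topology and its Borel sigma-algebra *)
Definition rvec (V : finType) (R : realType) : Type := V -> R.

Section rvec_structure.
Variables (V : finType) (R : realType).

HB.instance Definition _ := Topological.copy (rvec V R) {ptws V -> R}.
HB.instance Definition _ := isPointed.Build (rvec V R) (fun=> 0).
HB.instance Definition _ :=
  Measurable.copy (rvec V R) (g_sigma_algebraType (@open {ptws V -> R})).
HB.instance Definition _ := Measurable.on (rvec V R).

End rvec_structure.

Section rvec_measurability.
Variables (V : finType) (R : realType).

Let box (x : rvec V R) (n : nat) : set (rvec V R) :=
  [set y | forall v, `|x v - y v| < n.+1%:R^-1].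

Let box_anti x m n : (m <= n)%N -> box x n `<=` box x m.
Proof.
move=> mn y xy v; apply: (lt_le_trans (xy v)).
by rewrite lef_pV2 ?posrE// ler_nat.
Qed.

Let box_filter x : Filter (filter_from setT (box x)).
Proof.
apply: filter_from_filter; first by exists 0%N.
move=> m n _ _; exists (maxn m n) => // y xy; split.
  by apply: box_anti xy; exact: leq_maxl.
by apply: box_anti xy; exact: leq_maxr.
Qed.

Let open_box (O : set (rvec V R)) x : open O -> O x ->
  exists n, box x n `<=` O.
Proof.
move=> oO Ox; have FF := box_filter x.
suff cvx : filter_from setT (box x) --> (x : {ptws V -> R}).
  by have [n _ nO] := cvx _ (open_nbhs_nbhs (conj oO Ox)); exists n.
apply/cvg_sup => v A; rewrite nbhsE => -[_ [[C oC <-] Cx] CA].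
have /nbhs_ballP[e /= e0 eC] : nbhs (x v) C by exact: open_nbhs_nbhs.
exists (Num.truncn e^-1) => // y xy; apply: CA; apply: eC => /=.
rewrite /ball/= (lt_trans (xy v))// -[ltRHS]invrK ltf_pV2 ?posrE ?invr_gt0//.
exact: truncnS_gt.
Qed.

Lemma continuous_coord (v : V) : continuous (fun x : rvec V R => x v).
Proof.
move=> x; have : nbhs x --> (x : {ptws V -> R}) by [].
move/cvg_sup => /(_ v) cv A /nbhs_ballP[e /= e0 eA].
apply: (cv ((fun y : V -> R => y v) @^-1` A)).
rewrite nbhsE; exists ((fun y : V -> R => y v) @^-1` ball (x v) e).
  by split; [exists (ball (x v) e) => //; exact: ball_open|exact: ballxx].
by move=> y; exact: eA.
Qed.

Lemma measurable_coord (v : V) : measurable_fun setT (fun x : rvec V R => x v).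
Proof.
apply: (measurability _ (RGenOpens.measurableE R)).
move=> _ [_ [a [b ->]] <-]; rewrite setTI; apply: sub_sigma_algebra.
have /continuousP cv := @continuous_coord v.
by apply: cv; exact: interval_open.
Qed.

Lemma measurable_rvec d (T : measurableType d) (f : T -> rvec V R) :
  (forall v, measurable_fun setT (fun w => f w v)) -> measurable_fun setT f.
Proof.
move=> mf.
have mE : @measurable _ (rvec V R) = <<s @open (rvec V R) >> by [].
apply: (measurability _ mE) => _ [G oG <-].
rewrite setTI.
pose q (a : {ffun V -> rat} * nat) : rvec V R := fun v => ratr (a.1 v).
pose g (a : {ffun V -> rat} * nat) :=
  if `[< box (q a) a.2 `<=` G >] then f @^-1` (box (q a) a.2) else set0.
rewrite (_ : _ @^-1` _ = \bigcup_a g a); last first.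
  apply/seteqP; split => [w Ow|w [a _]]; last first.
    by rewrite /g; case: asboolP => // aO aw; exact: aO.
  have [n nO] := open_box oG Ow.
  have n0 : 0 < (n.*2.+1).+1%:R^-1 :> R by [].
  have /choice[r rP] : forall v, exists r : rat,
      `|ratr r - f w v| < (n.*2.+1).+1%:R^-1.
    move=> v; have [|r] := @rat_in_itvoo R
      (f w v - (n.*2.+1).+1%:R^-1) (f w v + (n.*2.+1).+1%:R^-1).
      by rewrite ltrD2l gtrN.
    by rewrite in_itv/= -ltr_distl distrC; exists r; rewrite distrC.
  exists ([ffun v => r v], n.*2.+1) => //; rewrite /g; case: asboolP => [_ v|].
    by rewrite /q/= ffunE.
  case => y ay; apply: nO => v.
  rewrite -(subrKA (ratr (r v))) (le_lt_trans (ler_normD _ _))//.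
  rewrite [ltRHS](_ : _ = (n.*2.+1).+1%:R^-1 + (n.*2.+1).+1%:R^-1).
    rewrite ltrD// ?(distrC (f w v))//.
    by have := ay v; rewrite /q/= ffunE.
  by rewrite -doubleS -mul2n natrM invfM (mulrC 2^-1); exact: splitr.
apply: countable_bigcupT_measurable => // a; rewrite /g.
case: asboolP => // _.
rewrite -[X in measurable X]setCK; apply: measurableC.
rewrite (_ : ~` _ =
    \bigcup_v ~` ((fun w => f w v) @^-1` ball (q a v) a.2.+1%:R^-1)).
  apply: countable_bigcupT_measurable => // v; apply: measurableC.
  rewrite -[X in measurable X]setTI.
  by apply: mf => //; apply: open_measurable; exact: ball_open.
apply/seteqP; split => [w /existsNP[v nv]|w [v _ nv] wa]; first by exists v.
by apply: nv; exact: wa.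
Qed.

End rvec_measurability.

Section convergence.
Context (R : realType).

Definition weak_cvg d (S : topMeasurableType d)
    (m_ : R -> {measure set S -> \bar R}) (m : {measure set S -> \bar R}) : Prop :=
  forall f : S -> R, continuous f -> bounded_fun f ->
    (\int[m_ t]_x (f x)%:E)%E @[t --> +oo] --> (\int[m]_x (f x)%:E)%E.

Definition regularly_varying (b : R -> R) (tau : R) : Prop :=
  (exists t0, (forall t, t0 < t -> 0 < b t) /\ measurable_fun `]t0, +oo[ b) /\
  forall lambda, 0 < lambda ->
    b (lambda * t) / b t @[t --> +oo] --> lambda `^ tau.

Definition is_pareto (alpha : R) (Q : probability R R) : Prop :=
  forall z, 1 <= z -> Q `]z, +oo[%classic = (z `^ (- alpha))%:E.

End convergence.

Section image.
Context d d' (T : measurableType d) (T' : measurableType d') (R : realType).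
Variables (m : {measure set T -> \bar R}) (f : {mfun T >-> T'}).

(* [distribution] for a measure that need not be a probability *)
Definition image_measure : set T' -> \bar R := pushforward m f.

Let image0 : image_measure set0 = 0%E.
Proof. exact: measure0. Qed.

Let image_ge0 A : (0 <= image_measure A)%E.
Proof. exact: measure_ge0. Qed.

Let image_sigma_additive : semi_sigma_additive image_measure.
Proof. exact: measure_semi_sigma_additive. Qed.

HB.instance Definition _ := isMeasure.Build _ _ _ image_measure
  image0 image_ge0 image_sigma_additive.

End image.

Section maps.
Context d (T : measurableType d) (V : finType) (R : realType).

Lemma measurable_invr : measurable_fun setT (@GRing.inv R).
Proof.
rewrite -(setUv [set 0 : R]); apply/measurable_funU => //.
  exact: measurableC.
split; first exact: measurable_fun_set1.
apply: open_continuous_measurable_fun.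
  apply/closed_openC/accessible_closed_set1/hausdorff_accessible.
  exact: norm_hausdorff.
by move=> x; rewrite inE/= => /eqP x0; exact: inv_continuous.
Qed.

Lemma measurable_gt (Z : {mfun T >-> R}) (t : R) : measurable [set w | t < Z w].
Proof.
rewrite (_ : [set _ | _] = Z @^-1` `]t, +oo[); last first.
  by apply/seteqP; split => w; rewrite /= in_itv/= andbT.
exact: measurable_funPTI.
Qed.

Definition div_by (x : R) : R -> R := fun y => y / x.

HB.instance Definition _ x := isMeasurableFun.Build _ _ _ _ (div_by x)
  (measurable_funM (@measurable_id _ _ _) (measurable_cst x^-1)).

Definition scaled_vec (X : V -> {mfun T >-> R}) (t : R) : T -> rvec V R :=
  fun w v => X v w / t.

Let measurable_scaled X t : measurable_fun setT (scaled_vec X t).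
Proof. by apply: measurable_rvec => v; apply: measurable_funM. Qed.

HB.instance Definition _ X t :=
  isMeasurableFun.Build _ _ _ _ (scaled_vec X t) (measurable_scaled X t).

Definition ratio_vec (X : V -> {mfun T >-> R}) (u : V) : T -> rvec V R :=
  fun w v => X v w / X u w.

Let measurable_ratio X u : measurable_fun setT (ratio_vec X u).
Proof.
apply: measurable_rvec => v; apply: measurable_funM => //.
exact: measurableT_comp measurable_invr _.
Qed.

HB.instance Definition _ X u :=
  isMeasurableFun.Build _ _ _ _ (ratio_vec X u) (measurable_ratio X u).

Definition polar_vec (X : V -> {mfun T >-> R}) (u : V) (t : R) :
    T -> R * rvec V R := fun w => (X u w / t, ratio_vec X u w).

Let measurable_polar X u t : measurable_fun setT (polar_vec X u t).
Proof.
apply: measurable_fun_pair; last exact: measurable_ratio.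
exact: measurable_funM.
Qed.

HB.instance Definition _ X u t :=
  isMeasurableFun.Build _ _ _ _ (polar_vec X u t) (measurable_polar X u t).

Definition tree_product (E : rel V) (M : V * V -> {mfun T >-> R}) (u : V) :
    T -> rvec V R :=
  fun w v => if v == u then 1 else \prod_(e in tree_path E u v) M e w.

Let measurable_tree_product E M u : measurable_fun setT (tree_product E M u).
Proof.
apply: measurable_rvec => v; rewrite /tree_product; case: eqP => // _.
rewrite (_ : (fun _ => _) = fun w =>
    \prod_(e <- enum (tree_path E u v)) M e w).
  by apply: measurable_prod.
by apply/funext => w; rewrite big_enum.
Qed.

HB.instance Definition _ E M u := isMeasurableFun.Build _ _ _ _
  (tree_product E M u) (measurable_tree_product E M u).

Definition scale_vec (z : R * rvec V R) : rvec V R := fun v => z.1 * z.2 v.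

Let measurable_scale : measurable_fun setT scale_vec.
Proof.
apply: measurable_rvec => v; apply: measurable_funM; first exact: measurable_fst.
exact: measurableT_comp (measurable_coord v) measurable_snd.
Qed.

HB.instance Definition _ :=
  isMeasurableFun.Build _ _ _ _ scale_vec measurable_scale.

End maps.
Arguments scale_vec {V R}.

Section probability.
Context d (T : measurableType d) (R : realType) (P : probability T R).

(* P( . | Z > t); it is P itself when P(Z > t) = 0. *)
Definition cond_gt (Z : {RV P >-> R}) (t : R) : probability T R :=
  mnormalize (mrestr P (measurable_gt Z t)) P.

Definition mutually_independent (I : finType) (J : {set I})
    (M : I -> {RV P >-> R}) : Prop :=
  forall K : {set I}, K \subset J ->
  forall B : I -> set R, (forall i, measurable (B i)) ->
    P [set w | forall i, i \in K -> B i (M i w)] =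
    (\prod_(i in K) P (M i @^-1` B i))%E.

Definition cond_distr_version (Xa Xb : {RV P >-> R}) (k : R.-pker R ~> R) :
    Prop :=
  forall A B : set R, measurable A -> measurable B ->
    P (Xa @^-1` A `&` Xb @^-1` B) =
    (\int[distribution P Xa]_(x in A) k x B)%E.

(* [<<s gen_events X W >>] is the sigma-algebra generated by (X_v), v in W. *)
Definition gen_events (V : finType) (X : V -> {RV P >-> R}) (W : {set V}) :
    set (set T) :=
  [set D | exists2 v, v \in W &
             exists2 B : set R, measurable B & D = X v @^-1` B].

Definition cond_prob_version (G : set (set T)) (D : set T) (h : T -> R) : Prop :=
  [/\ measurable_fun [set: g_sigma_algebraType G] h,
      P.-integrable setT (EFin \o h) &
      forall H, <<s G >> H -> (\int[P]_(x in H) (h x)%:E = P (D `&` H))%E].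

(* P(D1 n D2 | GS) = P(D1 | GS) P(D2 | GS) a.s. for D1 in s(GA), D2 in s(GB) *)
Definition cond_independent (GA GB GS : set (set T)) : Prop :=
  forall D1 D2, <<s GA >> D1 -> <<s GB >> D2 ->
  exists h1 h2, [/\ cond_prob_version GS D1 h1, cond_prob_version GS D2 h2 &
                    cond_prob_version GS (D1 `&` D2) (h1 \* h2)].

Definition global_markov (V : finType) (E : rel V) (X : V -> {RV P >-> R}) :
    Prop :=
  forall A B S : {set V},
    A != finset.set0 -> B != finset.set0 -> S != finset.set0 ->
    [disjoint A & B]%B -> [disjoint A & S]%B -> [disjoint B & S]%B ->
    separates E S A B ->
    cond_independent (gen_events X A) (gen_events X B) (gen_events X S).

Definition markov_tree (V : finType) (E : rel V) (X : V -> {RV P >-> R}) :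
    Prop :=
  [/\ (1 < #|V|)%N, undirected_tree E & global_markov E X].

End probability.

Section M0.
Variables (V : finType) (R : realType) (U : {set V}).

Definition orthant : set (rvec V R) := [set x | forall v, 0 <= x v].

(* the maximum of x_U for nonnegative x and nonempty U *)
Definition max_on (x : rvec V R) : R := \big[Num.max/0]_(u in U) x u.

Definition orthant0 : set (rvec V R) := orthant `&` [set x | 0 < max_on x].

Lemma measurable_orthant : measurable orthant.
Proof.
rewrite (_ : orthant = \bigcap_v ((fun x => x v) @^-1` `[0, +oo[)).
  apply: fin_bigcap_measurable; first exact: finite_finset.
  move=> v _; rewrite -[X in measurable X]setTI.
  exact: measurable_coord.
apply/seteqP; split => x x0 v; first by move=> _ /=; rewrite in_itv/= x0.
by have := x0 v I; rewrite /= in_itv/= andbT.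
Qed.

Lemma measurable_max_on : measurable_fun setT max_on.
Proof.
rewrite /max_on; elim: (index_enum V) => [|u s IH].
  rewrite (_ : (fun _ => _) = cst 0); first exact: measurable_cst.
  by apply/funext => x; rewrite big_nil.
rewrite (_ : (fun _ => _) = if u \in U
    then (fun x => x u) \max (fun x => \big[Num.max/0]_(v <- s | v \in U) x v)
    else fun x => \big[Num.max/0]_(v <- s | v \in U) x v).
  by case: ifP => // _; exact: measurable_maxr (measurable_coord u) IH.
by apply/funext => x; rewrite big_cons; case: ifP.
Qed.

Lemma measurable_orthant0 : measurable orthant0.
Proof.
apply: measurableI; first exact: measurable_orthant.
rewrite (_ : [set _ | _] = max_on @^-1` `]0, +oo[).
  rewrite -[X in measurable X]setTI; exact: measurable_max_on.
by apply/seteqP; split => w; rewrite /= in_itv/= andbT.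
Qed.

(* A Borel measure on the Borel set orthant0 is encoded as the Borel measure on
   R^V that agrees with it there and gives no mass to the complement. *)
Record M0 := MkM0 {
  M0_measure :> {measure set (rvec V R) -> \bar R};
  M0_supp : M0_measure (~` orthant0) = 0%E;
  M0_fin : forall B eps, 0 < eps -> measurable B ->
    B `<=` orthant `&` [set x | eps <= max_on x] ->
    (M0_measure B < +oo)%E }.

Definition M0_test (f : rvec V R -> R) : Prop :=
  [/\ {within orthant0, continuous f},
      exists K, forall x, orthant0 x -> `|f x| <= K &
      exists2 eps, 0 < eps &
        forall x, orthant0 x -> max_on x <= eps -> f x = 0].

(* The topology induced by M0_eval is the coarsest one making nu |-> \int f dnu
   continuous for every test function f. *)
Definition M0_eval (nu : M0) : {ptws {f | M0_test f} -> R} :=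
  fun f => \int[nu]_(x in orthant0) (sval f x).

HB.instance Definition _ := gen_eqMixin M0.
HB.instance Definition _ := gen_choiceMixin M0.
HB.instance Definition _ := Topological.copy M0 (initial_topology M0_eval).

End M0.

Section M0_elements.
Context d (T : measurableType d) (R : realType) (P : probability T R).
Context (V : finType) (U : {set V}).

Section scaled_law.
Variables (X : V -> {RV P >-> R}) (b : R -> R) (t : R).

(* b(t) P(X / t \in . ); b is positive near infinity, the absolute value is
   there to get a measure for every t. *)
Definition scaled_law : {measure set (rvec V R) -> \bar R} :=
  mscale `|b t|%:nng (distribution P (scaled_vec X t)).

Let tail : {measure set (rvec V R) -> \bar R} :=
  mrestr scaled_law (@measurable_orthant0 V R U).

Let tail_supp : tail (~` orthant0 U) = 0%E.
Proof. by rewrite /tail/= /mrestr setICl measure0. Qed.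

Let tail_fin (B : set (rvec V R)) eps : 0 < eps -> measurable B ->
  B `<=` @orthant V R `&` [set x | eps <= max_on U x] -> (tail B < +oo)%E.
Proof.
move=> _ mB _; rewrite /tail /= /mrestr /scaled_law /= /mscale /=.
apply: lte_mul_pinfty => //.
have mBU := measurableI _ _ mB (@measurable_orthant0 V R U).
have h := probability_le1 (distribution P (scaled_vec X t)) mBU.
exact: le_lt_trans h (ltry _).
Qed.

Definition scaled_tail : M0 R U := MkM0 tail_supp tail_fin.

End scaled_law.

Section restriction.
Variables (nu : M0 R U) (u : V) (uU : u \in U).

Let le_max_on (x : rvec V R) : max_on [set u]%SET x <= max_on U x.
Proof.
apply/bigmax_leP; split => [|i]; first exact: bigmax_ge_id.
by rewrite inE => /eqP ->; exact: (le_bigmax_cond _ _ uU).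
Qed.

Let restr : {measure set (rvec V R) -> \bar R} :=
  mrestr nu (@measurable_orthant0 V R [set u]%SET).

Let restr_supp : restr (~` orthant0 [set u]%SET) = 0%E.
Proof. by rewrite /restr/= /mrestr setICl measure0. Qed.

Let restr_fin (B : set (rvec V R)) eps : 0 < eps -> measurable B ->
  B `<=` @orthant V R `&` [set x | eps <= max_on [set u]%SET x] ->
  (restr B < +oo)%E.
Proof.
move=> e0 mB Bmax; rewrite /restr/= /mrestr.
have mBU := measurableI _ _ mB (@measurable_orthant0 V R [set u]%SET).
have hfin := @M0_fin V R U nu _ _ e0 mBU.
apply: hfin => x [/Bmax[x0 ex] _]; split => //=.
exact: le_trans ex (le_max_on x).
Qed.

Definition M0_restr1 : M0 R [set u]%SET := MkM0 restr_supp restr_fin.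

End restriction.

End M0_elements.

(* Main.v *)
Require Import Defs.
From HB Require Import structures.
From mathcomp Require Import all_boot all_order all_algebra.
From mathcomp Require Import all_classical all_reals all_analysis.
From mathcomp Require Import measurable_realfun.
From mathcomp Require Import ring lra.
Import Order.TTheory GRing.Theory Num.Theory.
Import numFieldNormedType.Exports.
Local Open Scope classical_set_scope.
Local Open Scope ring_scope.
Set Implicit Arguments.
Unset Strict Implicit.
Unset Printing Implicit Defensive.

(** Fix [u] in [U].  The law of the coordinates of [X / t] in a connected set
    [W] containing [u], given [X_u > t], converges by induction on [W].  If
    [(a, b)] is an edge leaving [W], the global Markov property turns the
    expectation of [f] over [W] and [b] into the expectation over [W] of
    [F_t z = \int f (z, w / t) kappa (t z_a, dw)].  As [t] grows, [F_t] converges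
    continuously: by (i) where [z_a > 0], by (ii) where [z_a = 0]; if (ii) is not
    available then no [M_e] on the path from [u] to [a] has an atom at 0 and
    [z_a = 0] has limit probability zero.  The extended continuous mapping
    theorem gives the step, hence (c).  The map [x |-> (x_u, x / max (x_u, 1))]
    is continuous and is the polar map on [x_u > 1], hence (b) and (a).

    Let [nu_u] be the image of [c_u alpha z^(-alpha-1) dz (x) law (Theta_u)] under
    [(z, theta) |-> z theta].  By regular variation and (c),
    [b(t) E f (X / t)] tends to [\int f d nu_u] whenever [f] vanishes for small
    [x_u].  Limits being unique, [nu_u] and [nu_v] agree where [x_u, x_v > 0], so
    they glue to a measure [nu].  A test function vanishing for small [max x_U] is
    a finite sum of functions each vanishing for some small [x_w], [w] in [U],
    which gives the convergence to [nu]. *)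

(** * Lipschitz functions and the extended continuous mapping theorem *)

(** The obstacle is that a transition along an edge leaves the class of test functions: even for
    Lipschitz [f], the functions [edge_step] need not be continuous, since a kernel is only
    measurable in its state, so the induction hypothesis does not apply to them directly. The
    induction therefore carries the limit for all Lipschitz functions with values in [0, 1], and
    passing to [edge_step] only costs locally uniform convergence at almost every point of the limit
    law. Two conventions keep everything on R^V: coordinates outside the current set are put to 0,
    and positive parts are taken, because points near the orthant may leave it and a version of a
    conditional law may charge negative numbers. No moment of the [M_e] is available, so differences
    are truncated at 1. The radial measure has infinite mass near 0, so identities for [nu_u] are
    proved on [x_u > e], where it is a multiple of the law of [e Y_u]; this is why test functions on
    the punctured orthant are cut up by a partition of unity. *)

Section rvec_metric.
Context {V : finType} {R : realType}.
Implicit Types x y z : rvec V R.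

(** The topology of [rvec V R] comes as a product topology, without a metric; this l1 distance
    supplies one, and [nbhs_rvecP] identifies the two. *)
Definition vdist x y : R := \sum_v `|x v - y v|.

Lemma vdist_ge0 x y : 0 <= vdist x y.
Proof. exact: sumr_ge0. Qed.

Lemma vdistxx x : vdist x x = 0.
Proof. by rewrite /vdist big1// => v _; rewrite subrr normr0. Qed.

Lemma vdistC x y : vdist x y = vdist y x.
Proof. by apply: eq_bigr => v _; rewrite distrC. Qed.

Lemma vdist_triangle y x z : vdist x z <= vdist x y + vdist y z.
Proof.
rewrite /vdist -big_split; apply: ler_sum => v _.
by rewrite -{1}(subrKA (y v)) ler_normD.
Qed.

Lemma le_coord_vdist v x y : `|x v - y v| <= vdist x y.
Proof. by rewrite /vdist (bigD1 v)//= lerDl; exact: sumr_ge0. Qed.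

Lemma continuous_vdist x : continuous (vdist x).
Proof.
move=> y; rewrite /vdist; elim: (index_enum V) => [|v s IH].
  rewrite (_ : (fun _ => _) = cst 0); first exact: cst_continuous.
  by apply/funext => z; rewrite big_nil.
rewrite (_ : (fun _ => _) =
    fun z => `|x v - z v| + \sum_(v <- s) `|x v - z v|); last first.
  by apply/funext => z; rewrite big_cons.
have cg : continuous (fun r : R => `|x v - r|).
  by move=> r; apply: cvg_norm; apply: cvgB; [exact: cvg_cst|exact: cvg_id].
have cv := continuous_comp (@continuous_coord V R v y) (cg _).
exact: cvgD cv IH.
Qed.

(** The product topology is a supremum of topologies pulled back along the coordinates, so the
    filter of l1 balls need only be compared with it one coordinate at a time. The converse is
    continuity of [vdist x]. *)
Lemma nbhs_rvecP x (A : set (rvec V R)) : nbhs x A <->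
  exists2 e, 0 < e & forall y, vdist x y < e -> A y.
Proof.
split; last first.
  move=> [e e0 eA].
  have H : nbhs x (vdist x @^-1` ball (vdist x x) e).
    by apply: (@continuous_vdist x x); exact: nbhsx_ballx.
  apply: filterS H => y; rewrite /preimage/=/ball/= vdistxx sub0r normrN.
  by rewrite ger0_norm ?vdist_ge0//; exact: eA.
rewrite -[nbhs x]/(nbhs (x : {ptws V -> R})) => xA.
pose B := [set e : R | 0 < e].
have FF : Filter (filter_from B (fun e => [set y | vdist x y < e])).
  apply: filter_from_filter; first by exists 1; rewrite /B/=.
  move=> e1 e2 e10 e20; exists (Num.min e1 e2).
    by rewrite /B/= lt_min e10.
  by move=> y /=; rewrite lt_min => /andP[].
suff cvx : filter_from B (fun e => [set y | vdist x y < e]) -->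
    (x : {ptws V -> R}).
  by have [e e0 eA] := cvx _ xA; exists e.
apply/cvg_sup => v C; rewrite nbhsE => -[_ [[D oD <-] Dx] DC].
have /nbhs_ballP[e /= e0 eD] : nbhs (x v) D by exact: open_nbhs_nbhs.
exists e => // y xy; apply: DC; apply: eD => /=.
exact: le_lt_trans (le_coord_vdist v x y) xy.
Qed.

(** No sign is imposed on [L]; arguments that need one pass to |L| or |L| + 1. *)
Definition vlipschitz (L : R) (f : rvec V R -> R) :=
  forall x y, `|f x - f y| <= L * vdist x y.

Lemma vlipschitz_continuous L f : vlipschitz L f -> continuous f.
Proof.
move=> fL x A /nbhs_ballP[e /= e0 eA].
have /nbhs_rvecP : exists2 r, 0 < r & forall y, vdist x y < r ->
    (f @^-1` A) y; last by [].
exists (e / (`|L| + 1)); first by rewrite divr_gt0// ltr_pwDr.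
move=> y; rewrite ltr_pdivlMr ?ltr_pwDr// => xy; apply: eA.
apply: le_lt_trans (fL _ _) (le_lt_trans _ xy).
rewrite mulrC ler_wpM2l ?vdist_ge0// (le_trans (ler_norm _))//.
by rewrite lerDl.
Qed.

Lemma continuous_rvec_measurable (f : rvec V R -> R) :
  continuous f -> measurable_fun setT f.
Proof.
move=> cf; apply: (measurability _ (RGenOpens.measurableE R)).
move=> _ [_ [a [b ->]] <-]; rewrite setTI; apply: sub_sigma_algebra.
by move/continuousP : cf; apply; exact: interval_open.
Qed.

End rvec_metric.

Section bounded_integration.
Context d (T : measurableType d) (R : realType).
Implicit Types (m : probability T R) (f g : T -> R).

Lemma bounded_integrable m f (K : R) : measurable_fun setT f ->
  (forall x, `|f x| <= K) -> m.-integrable setT (EFin \o f).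
Proof.
move=> mf fK; apply: measurable_bounded_integrable => //.
  by rewrite (le_lt_trans (probability_le1 _ _))// ltry.
exists K; split; first exact: num_real.
by move=> K' KK' x _ /=; rewrite (le_trans (fK x))// ltW.
Qed.

Lemma EFin_Rintegral (m : {measure set T -> \bar R}) (D : set T) f :
  measurable D -> m.-integrable D (EFin \o f) ->
  (\int[m]_(x in D) f x)%:E = (\int[m]_(x in D) (f x)%:E)%E.
Proof. by move=> mD intf; rewrite fineK//; exact: integrable_fin_num. Qed.

Lemma unit_bounded_integrable m f : measurable_fun setT f ->
  (forall x, 0 <= f x <= 1) -> m.-integrable setT (EFin \o f).
Proof.
move=> mf f01; apply: (@bounded_integrable m f 1) => // x.
by have /andP[f0 f1] := f01 x; rewrite ger0_norm.
Qed.

Lemma Rintegral_prob_cst m (r : R) : \int[m]_x r = r.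
Proof. by rewrite Rintegral_cst// [X in fine X](@probability_setT _ _ _ m)/= mulr1. Qed.

End bounded_integration.

Section extended_continuous_mapping.
Section lower_bound.
Context {V : finType} {R : realType} d d' (T : measurableType d)
  (T' : measurableType d').
Variables (m_ : R -> probability T R) (Z_ : R -> T -> rvec V R).
Variables (m : probability T' R) (Z : T' -> rvec V R).
Variables (F_ : R -> rvec V R -> R) (F : rvec V R -> R).
Hypothesis mZ_ : forall t, measurable_fun setT (Z_ t).
Hypothesis mZ : measurable_fun setT Z.
Hypothesis Z_Z : forall f L, (forall x, 0 <= f x <= 1) -> vlipschitz L f ->
  \int[m_ t]_w f (Z_ t w) @[t --> +oo] --> \int[m]_w f (Z w).

(* Lipschitz minorants of all the [F_ t], [n <= t] *)
Let phi (n : nat) (z : rvec V R) : R :=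
  inf [set r | exists t y, n%:R <= t /\ r = F_ t y + n%:R * vdist z y].

(** For [n <= t] the minorant [phi n] lies below [F_ t], and it is Lipschitz, so its integrals
    converge. At a point of continuous convergence [phi n] is eventually above [F] minus any given
    error, so dominated convergence lets the integrals of the minorants catch up with that of [F].
    The method is one-sided; the other side comes from [1 - F]. *)
Lemma continuous_convergence_lower_bound :
  (forall t x, 0 <= F_ t x <= 1) -> (forall x, 0 <= F x <= 1) ->
  (forall t, measurable_fun setT (fun w => F_ t (Z_ t w))) ->
  measurable_fun setT (fun w => F (Z w)) ->
  {ae m, forall w, forall e : R, 0 < e -> exists2 r : R, 0 < r & exists t0 : R,
    forall t y, t0 <= t -> vdist (Z w) y < r -> `|F_ t y - F (Z w)| < e} ->
  forall e : R, 0 < e ->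
    \forall t \near +oo, \int[m]_w F (Z w) - e < \int[m_ t]_w F_ t (Z_ t w).
Proof.
move=> F_01 F01 mF_ mF cvF e e0.
have lb n z : lbound [set r | exists t y, n%:R <= t /\
    r = F_ t y + n%:R * vdist z y] 0.
  move=> _ [t [y [_ ->]]]; rewrite addr_ge0// ?mulr_ge0 ?vdist_ge0//.
  by have /andP[] := F_01 t y.
have phi_le n z (t : R) y : n%:R <= t -> phi n z <= F_ t y + n%:R * vdist z y.
  by move=> nt; apply: ge_inf; [exists 0; exact: lb|exists t, y].
have phi_ge n z (r : R) : (forall (t : R) y, n%:R <= t -> r <= F_ t y + n%:R * vdist z y) ->
    r <= phi n z.
  move=> H; apply: lb_le_inf.
    by exists (F_ n%:R z + n%:R * vdist z z), n%:R, z.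
  by move=> _ [t [y [nt ->]]]; exact: H.
have phi01 n z : 0 <= phi n z <= 1.
  rewrite (phi_ge n z 0)/=; last by move=> t y nt; apply: (lb n z); exists t, y.
  rewrite (le_trans (phi_le n z n%:R z _))// vdistxx mulr0 addr0.
  by have /andP[] := F_01 n%:R z.
have phi_lip n : vlipschitz n%:R (phi n).
  suff H x y : phi n x - phi n y <= n%:R * vdist x y.
    by move=> x y; rewrite ler_norml lerNl opprB {1}vdistC !H.
  rewrite lerBlDr addrC -lerBlDr; apply: phi_ge => t z nt.
  rewrite lerBlDr (le_trans (phi_le n x t z nt))// -addrA lerD2l -mulrDr.
  by rewrite ler_wpM2l// addrC vdist_triangle.
have mphi n : measurable_fun setT (fun w => phi n (Z w)).
  apply: measurableT_comp mZ; apply: continuous_rvec_measurable.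
  exact: vlipschitz_continuous (phi_lip n).
have mphi_ n t : measurable_fun setT (fun w => phi n (Z_ t w)).
  apply: measurableT_comp (mZ_ t); apply: continuous_rvec_measurable.
  exact: vlipschitz_continuous (phi_lip n).
(* Only a lower bound on the limit of [phi n] is known; truncating at [F] turns it into convergence,
   as dominated convergence requires. *)
pose g n w := Num.min (phi n (Z w)) (F (Z w)).
have g01 n w : 0 <= g n w <= 1.
  have /andP[p0 p1] := phi01 n (Z w); have /andP[q0 q1] := F01 (Z w).
  by rewrite /g le_min p0 q0 ge_min p1.
have mg n : measurable_fun setT (g n) by exact: measurable_minr.
have cvg_g : {ae m, forall w, setT w -> (g n w)%:E @[n --> \oo] -->
    (F (Z w))%:E}.
  apply: filterS cvF => w cvw _; apply: cvg_EFin; first exact: nearW.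
  apply/cvgrPdist_lt => /= r r0; have [s s0 [t0 st]] := cvw _ (divr_gt0 r0 (ltr0Sn R 1)).
  (* Beyond [t0] continuous convergence handles points closer than [s]; with slope above [s^-1] the
     penalty at distance at least [s] is at least 1, hence at least [F]. *)
  have [n0 n0t] : exists n0 : nat, Num.max t0 s^-1 < n0%:R.
    by exists (Num.truncn (Num.max t0 s^-1)).+1; exact: truncnS_gt.
  move: n0t; rewrite gt_max => /andP[t0n0 sn0].
  exists n0 => // n /= n0n; have n0n' : n0%:R <= n%:R :> R by rewrite ler_nat.
  have H : F (Z w) - r / 2 <= phi n (Z w).
    apply: phi_ge => t y nt; have [wy|wy] := ltP (vdist (Z w) y) s.
      have := st t y (le_trans (ltW t0n0) (le_trans n0n' nt)) wy.
      rewrite distrC ltr_norml => /andP[_]; rewrite ltrBlDr -ltrBlDl => /ltW/le_trans.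
      by apply; rewrite lerDl mulr_ge0// vdist_ge0.
    have /andP[q0 q1] := F01 (Z w); have /andP[p0 p1] := F_01 t y.
    apply: (@le_trans _ _ 1); first by rewrite lerBlDr (le_trans q1)// lerDl divr_ge0// ltW.
    rewrite -[leLHS]add0r lerD//.
    apply: (@le_trans _ _ (s^-1 * s)); first by rewrite mulVf ?gt_eqF.
    rewrite ler_pM ?invr_ge0 ?(ltW s0)//.
    exact: ltW (lt_le_trans sn0 n0n').
  rewrite ger0_norm ?subr_ge0; last by rewrite /g ge_min lexx orbT.
  rewrite ltrBlDl -ltrBlDr /g lt_min; apply/andP; split; last by rewrite gtrBl.
  by apply: lt_le_trans H; rewrite ltrD2l ltrN2 ltr_pdivrMr// mulr2n mulrDr mulr1 ltrDl.
have /cvgrPdist_lt : \int[m]_w g n w @[n --> \oo] --> \int[m]_w F (Z w).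
  have [//| | | |_ _] := @dominated_convergence _ _ _ m setT measurableT
    (fun n => EFin \o g n) (fun w => (F (Z w))%:E) (cst 1%:E) _ _ cvg_g.
  - by move=> n; exact/measurable_EFinP.
  - exact/measurable_EFinP.
  - exact: finite_measure_integrable_cst.
  - apply: nearW => w n _ /=; have /andP[p0 p1] := g01 n w.
    by rewrite lee_fin ger0_norm.
  rewrite -EFin_Rintegral//; last exact: unit_bounded_integrable.
  exact: fine_cvg.
move=> /(_ _ (divr_gt0 e0 (ltr0Sn R 1)))[n _ /(_ n (leqnn _))/=].
rewrite ltr_norml => /andP[_]; rewrite ltrBlDr -ltrBlDl => Hn.
have le_g : \int[m]_w g n w <= \int[m]_w phi n (Z w).
  apply: le_Rintegral => //; try exact: unit_bounded_integrable.
  by move=> w _; rewrite /g ge_min lexx.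
have /cvgrPdist_lt/(_ _ (divr_gt0 e0 (ltr0Sn R 1))) := Z_Z (phi01 n) (phi_lip n).
apply: filterS2 (nbhs_pinfty_ge (num_real n%:R)) => t nt.
rewrite ltr_norml => /andP[_]; rewrite ltrBlDr -ltrBlDl => Ht.
have H1 : \int[m_ t]_w phi n (Z_ t w) <= \int[m_ t]_w F_ t (Z_ t w).
  apply: le_Rintegral => //; try exact: unit_bounded_integrable.
  by move=> w _; rewrite (le_trans (phi_le n _ t (Z_ t w) nt))// vdistxx mulr0 addr0.
apply: lt_le_trans H1; apply: le_lt_trans Ht.
move: Hn le_g; lra.
Qed.

End lower_bound.


Context {V : finType} {R : realType} d d' (T : measurableType d)
  (T' : measurableType d').

(** The lower bound for [F] and for [1 - F] gives both sides. The functions [F_ t] need not be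
    continuous, and convergence may fail on a null set of the limit law; the tree induction uses
    both freedoms. *)
Theorem continuous_convergence_Rintegral
  (m_ : R -> probability T R) (Z_ : R -> T -> rvec V R)
  (m : probability T' R) (Z : T' -> rvec V R)
  (F_ : R -> rvec V R -> R) (F : rvec V R -> R) :
  (forall t, measurable_fun setT (Z_ t)) -> measurable_fun setT Z ->
  (forall (f : rvec V R -> R) (L : R), (forall x, 0 <= f x <= 1) ->
    vlipschitz L f ->
    \int[m_ t]_w f (Z_ t w) @[t --> +oo] --> \int[m]_w f (Z w)) ->
  (forall t x, 0 <= F_ t x <= 1) -> (forall x, 0 <= F x <= 1) ->
  (forall t, measurable_fun setT (fun w => F_ t (Z_ t w))) ->
  measurable_fun setT (fun w => F (Z w)) ->
  {ae m, forall w, forall e : R, 0 < e -> exists2 r : R, 0 < r &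
    exists t0 : R, forall t y, t0 <= t -> vdist (Z w) y < r ->
    `|F_ t y - F (Z w)| < e} ->
  \int[m_ t]_w F_ t (Z_ t w) @[t --> +oo] --> \int[m]_w F (Z w).
Proof.
move=> mZ_ mZ Z_Z F_01 F01 mF_ mF cvF; apply/cvgrPdist_lt => e e0.
have onem_int d0 (T0 : measurableType d0) (m0 : probability T0 R) (f : T0 -> R) :
    measurable_fun setT f -> (forall x, 0 <= f x <= 1) ->
    \int[m0]_x (1 - f x) = 1 - \int[m0]_x f x.
  move=> mf f01; rewrite RintegralB//.
  - by rewrite Rintegral_prob_cst.
  - exact: finite_measure_integrable_cst.
  - exact: unit_bounded_integrable.
have onem01 (r : R) : 0 <= r <= 1 -> 0 <= 1 - r <= 1.
  by move=> /andP[r0 r1]; rewrite subr_ge0 r1/= gerBl.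
have H1 := continuous_convergence_lower_bound mZ_ mZ Z_Z F_01 F01 mF_ mF cvF e0.
have H2 : \forall t \near +oo,
    \int[m]_w (1 - F (Z w)) - e < \int[m_ t]_w (1 - F_ t (Z_ t w)).
  apply: (@continuous_convergence_lower_bound _ _ _ _ _ _ m_ Z_ m Z
    (fun t z => 1 - F_ t z) (fun z => 1 - F z)) => //.
  - by move=> t x; exact: onem01.
  - by move=> x; exact: onem01.
  - by move=> t; exact: measurable_funB.
  - exact: measurable_funB.
  - apply: filterS cvF => w H r r0; have [s s0 [t0 st]] := H _ r0.
    exists s => //; exists t0 => t y tt yw.
    rewrite [X in `|X|](_ : _ = - (F_ t y - F (Z w))) ?normrN; first exact: st.
    ring.
apply: filterS2 H1 H2 => t H1.
rewrite !onem_int// ltr_norml => H2; apply/andP; split; lra.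
Qed.

End extended_continuous_mapping.

(** * Mixtures of measures *)

Section disintegration.
Local Open Scope ereal_scope.
Context d d' (T : measurableType d) (Y : measurableType d') (R : realType).
Variables (P : {measure set T -> \bar R}) (k : T -> {measure set Y -> \bar R}).
Variable m : {measure set Y -> \bar R}.
Hypothesis mk : forall A, measurable A -> measurable_fun setT (k ^~ A).
Hypothesis mE : forall A, measurable A -> m A = \int[P]_w k w A.

Import HBNNSimple.

Let integral_mixture_nnsfun (g : {nnsfun Y >-> R}) :
  \int[m]_y (g y)%:E = \int[P]_w \int[k w]_y (g y)%:E.
Proof.
rewrite integralT_nnsfun sintegralE.
under [RHS]eq_integral do rewrite integralT_nnsfun sintegralE.
have ge0 r w : 0 <= r%:E * k w (g @^-1` [set r]).
  have [r0|r0] := leP 0%R r; first by rewrite mule_ge0.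
  by rewrite preimage_nnfun0// measure0 mule0.
rewrite ge0_integral_fsum//; last first.
  by move=> r; apply: measurable_funeM; exact: mk.
apply: eq_fsbigr => r _; rewrite mE//.
have [r0|r0] := leP 0%R r; first by rewrite ge0_integralZl//; exact: mk.
by rewrite preimage_nnfun0// !integral0_eq ?mule0// => w _; rewrite measure0 ?mule0.
Qed.

(** Indicators are the hypothesis [mE]; simple functions follow by linearity, and monotone
    convergence is used in the inner and in the outer integral. The [k w] need not be probabilities:
    [ge0_integral_density] takes multiples of Dirac masses. *)
Lemma ge0_integral_mixture (h : Y -> \bar R) : measurable_fun setT h ->
  (forall y, 0 <= h y) -> \int[m]_y h y = \int[P]_w \int[k w]_y h y.
Proof.
move=> mh h0; pose g := nnsfun_approx measurableT mh.
have g_ge0 n y : 0 <= (g n y)%:E by rewrite lee_fin.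
have ndg y : {homo (fun n => (g n y)%:E) : n p / (n <= p)%N >-> n <= p}.
  by move=> n p np; rewrite lee_fin; exact/lefP/nd_nnsfun_approx.
have mg n : measurable_fun setT (fun y => (g n y)%:E) by exact/measurable_EFinP.
have gh (y : Y) : h y = limn (fun n => (g n y)%:E).
  by apply/esym/cvg_lim => //; exact: cvg_nnsfun_approx.
have intE (m' : {measure set Y -> \bar R}) :
    \int[m']_y h y = limn (fun n => \int[m']_y (g n y)%:E).
  by under eq_integral do rewrite gh; rewrite monotone_convergence.
rewrite intE; under eq_fun do rewrite integral_mixture_nnsfun.
under [RHS]eq_integral do rewrite intE.
rewrite monotone_convergence//.
- by move=> n; exact: measurable_fun_integral_kernel.
- by move=> n w _; exact: integral_ge0.
- by move=> w _ n p np; apply: ge0_le_integral => // y _; exact: ndg.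
Qed.

End disintegration.

Definition mfun_of d d' (T : measurableType d) (T' : measurableType d')
    (f : T -> T') (mf : measurable_fun setT f) : {mfun T >-> T'} :=
  HB.pack f (isMeasurableFun.Build _ _ _ _ f mf).

Lemma ge0_integral_image d d' (T : measurableType d) (T' : measurableType d')
    (R : realType) (m : {measure set T -> \bar R}) (f : {mfun T >-> T'})
    (h : T' -> \bar R) : measurable_fun setT h -> (forall y, 0 <= h y)%E ->
  (\int[image_measure m f]_y h y = \int[m]_x h (f x))%E.
Proof. by move=> mh h0; rewrite ge0_integral_pushforward. Qed.

Section mixture_unique.
Local Open Scope ereal_scope.
Context d d' (T : measurableType d) (Y : measurableType d') (R : realType).
Variables (P : probability T R) (k : T -> {measure set Y -> \bar R}).
Variables (m : {measure set Y -> \bar R}) (G : set (set Y)).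
Hypothesis mk : forall A, measurable A -> measurable_fun setT (k ^~ A).
Hypothesis k1 : forall w, k w setT = 1.
Hypothesis m1 : m setT = 1.
Hypothesis mG : @measurable _ Y = <<s G >>.
Hypothesis GI : setI_closed G.
Hypothesis mGE : forall A, G A -> m A = \int[P]_w k w A.

(** Agreement on a generating pi-system extends by Dynkin's argument. Unit mass on both sides makes
    complements work, by subtraction. *)
Lemma mixture_unique A : measurable A -> m A = \int[P]_w k w A.
Proof.
rewrite mG; move: A; apply: (dynkin_induction mG GI) => //.
- rewrite m1; under eq_integral do rewrite k1.
  by rewrite integral_cst// mul1e [X in _ = X](@probability_setT _ _ _ P).
- move=> S mS mSE.
  have kS w : k w (~` S) = 1 - k w S.
    have kT : k w setT < +oo by rewrite k1 ltry.
    by rewrite -(k1 w) -setTD measureD// setTI.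
  under eq_integral do rewrite kS.
  have mT : m setT < +oo by rewrite m1 ltry.
  rewrite -setTD measureD// setTI [X in X - _]m1 [X in _ - X]mSE integralB//.
  + by rewrite integral_cst// mul1e [X in _ = X - _](@probability_setT _ _ _ P).
  + exact: finite_measure_integrable_cst.
  + apply: (@le_integrable _ _ _ P setT _ _ (cst 1)) => //.
    * exact: mk.
    * by move=> w _ /=; rewrite gee0_abs// normr1 -(k1 w) le_measure// inE.
    * exact: finite_measure_integrable_cst.
- move=> F mF tF FE.
  rewrite measure_semi_bigcup//; last exact: bigcup_measurable.
  have kF w : k w (\bigcup_n F n) = \sum_(0 <= n <oo) k w (F n).
    by rewrite measure_semi_bigcup//; exact: bigcup_measurable.
  under [RHS]eq_integral do rewrite kF.
  rewrite integral_nneseries//; last by move=> n; exact: mk.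
  by apply: eq_eseriesr => n _; exact: FE.
Qed.

End mixture_unique.

Section boxes.
Context (I : finType) (R : realType).

(** A pair consists of the coordinates already treated and the new one; these rectangles are the
    events that conditional independence and mutual independence can evaluate. *)
Definition boxes : set (set (rvec I R * R)) :=
  [set D | exists B : I -> set R, exists C : set R,
    [/\ forall i, measurable (B i), measurable C &
        D = [set p | (forall i, B i (p.1 i)) /\ C p.2]]].

Lemma boxes_setI_closed : setI_closed boxes.
Proof.
move=> _ _ [B [C [mB mC ->]]] [B' [C' [mB' mC' ->]]].
exists (fun i => B i `&` B' i), (C `&` C'); split.
- by move=> i; exact: measurableI.
- exact: measurableI.
- by apply/seteqP; split=> [p [[H1 H2] [H3 H4]]|p [H [H2 H4]]]; split; split => // i;
    have [] := H i.
Qed.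

Lemma measurable_cylinder d (T : measurableType d) (Z : T -> rvec I R)
    (B : I -> set R) : measurable_fun setT Z -> (forall i, measurable (B i)) ->
  measurable [set w | forall i, B i (Z w i)].
Proof.
move=> mZ mB; rewrite (_ : mkset _ =
    \bigcap_i ((fun w => Z w i) @^-1` B i)); last first.
  by apply/seteqP; split => [w H i _|w H i]; [exact: H|exact: (H i)].
apply: fin_bigcap_measurable; first exact: finite_finset.
move=> i _; rewrite -[X in measurable X]setTI.
have := measurableT_comp (@measurable_coord I R i) mZ.
by apply.
Qed.

(** The identity from the space with the generated sigma-algebra is measurable because each
    coordinate is, by [measurable_rvec]. *)
Lemma boxes_generate : @measurable _ (rvec I R * R)%type = <<s boxes >>.
Proof.
apply/seteqP; split.
  pose Tb := g_sigma_algebraType boxes.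
  have gen D : boxes D -> measurable (D : set Tb) by exact: sub_sigma_algebra.
  have m1 : measurable_fun setT (fst : Tb -> rvec I R).
    apply: measurable_rvec => i _ B mB; rewrite setTI; apply: gen.
    exists (fun j => if j == i then B else setT), setT; split => //.
      by move=> j; case: ifP.
    apply/seteqP; split => [p Bp|p [/(_ i)]]; last by rewrite eqxx.
    by split => // j; case: eqP => // ->.
  have m2 : measurable_fun setT (snd : Tb -> R).
    move=> _ B mB; rewrite setTI; apply: gen.
    by exists (fun=> setT), B; split => //; apply/seteqP; split => [p Bp|p []].
  have m12 : measurable_fun setT (fun p : Tb => (p.1, p.2)).
    exact: measurable_fun_pair.
  move=> D mD; have := m12 measurableT D mD; rewrite setTI.
  by congr (_ _); apply/seteqP; split => -[].
apply: smallest_sub; first exact: sigma_algebra_measurable.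
move=> _ [B [C [mB mC ->]]].
apply: measurableI; first exact: measurable_cylinder.
by rewrite -[X in measurable X]setTI; exact: measurable_snd.
Qed.

End boxes.

Section kernel_pullback.
Context d d0 d1 (T : measurableType d) (S : measurableType d0)
  (Y : measurableType d1) (R : realType).
Variables (k : R.-pker S ~> Y) (a : T -> S).

(** Carrying [ma] as an argument lets the kernel structure be found by unification. *)
Definition kernel_pullback (ma : measurable_fun setT a) (w : T) :
  {measure set Y -> \bar R} := k (a w).

Hypothesis ma : measurable_fun setT a.

Let measurable_kernel_pullback U : measurable U ->
  measurable_fun setT (kernel_pullback ma ^~ U).
Proof. by move=> mU; exact: measurableT_comp (measurable_kernel k U mU) ma. Qed.

HB.instance Definition _ := isKernel.Build _ _ _ _ _ (kernel_pullback ma)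
  measurable_kernel_pullback.

Let kernel_pullback_prob w : kernel_pullback ma w setT = 1%E.
Proof. exact: prob_kernel. Qed.

HB.instance Definition _ := Kernel_isProbability.Build _ _ _ _ _
  (kernel_pullback ma) kernel_pullback_prob.

End kernel_pullback.

Section box_mixture.
Local Open Scope ereal_scope.
Context d d0 (T : measurableType d) (S : measurableType d0) (R : realType).
Context (I : finType).
Variables (P : probability T R) (Z : T -> rvec I R) (Y : T -> R).
Variables (k : R.-pker S ~> R) (a : T -> S).
Hypothesis mZ : measurable_fun setT Z.
Hypothesis mY : measurable_fun setT Y.
Hypothesis ma : measurable_fun setT a.
Hypothesis boxE : forall (B : I -> set R) C,
  (forall i, measurable (B i)) -> measurable C ->
  P ([set w | forall i, B i (Z w i)] `&` Y @^-1` C) =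
  \int[P]_(w in [set w | forall i, B i (Z w i)]) k (a w) C.

Let mZY : measurable_fun setT (fun w => (Z w, Y w)).
Proof. exact: measurable_fun_pair. Qed.

Let kZ (w : T) : {measure set (rvec I R * R) -> \bar R} :=
  image_measure (k (a w)) (mfun_of (pair1_measurable (Z w))).

(** Common engine of the Markov step and of the independence step: if [k (a w)] predicts [Y] given
    [Z] on boxes, it does so for every nonnegative function. The law of the pair is the mixture of
    the laws [kZ w] of [(Z w, y)] with [y] drawn from [k (a w)]. *)
Lemma ge0_integral_box_mixture (h : rvec I R * R -> \bar R) :
  measurable_fun setT h -> (forall p, 0 <= h p) ->
  \int[P]_w h (Z w, Y w) = \int[P]_w \int[k (a w)]_y h (Z w, y).
Proof.
move=> mh h0.
have mkZ A : measurable A -> measurable_fun setT (kZ ^~ A).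
  move=> mA; pose f (p : T * R) : rvec I R * R := (Z p.1, p.2).
  have mf : measurable_fun setT f.
    apply: measurable_fun_pair; last exact: measurable_snd.
    exact: measurableT_comp mZ measurable_fst.
  (* [kZ w A] is the kernel mass of the section at [w] of a measurable subset of the product, hence
     measurable in [w]. *)
  rewrite (_ : kZ ^~ A =
      fun w => kernel_pullback k ma w (xsection (f @^-1` A) w)).
    apply: measurable_fun_xsection_finite_kernel; rewrite inE.
    by rewrite -[X in measurable X]setTI; exact: mf.
  apply/funext => w; rewrite /kZ /= /image_measure /pushforward /=.
  by congr (k (a w) _); apply/seteqP; split => y; rewrite /xsection/= ?inE.
have kZE w : \int[k (a w)]_y h (Z w, y) = \int[kZ w]_p h p.
  by rewrite ge0_integral_image.
under [RHS]eq_integral do rewrite kZE.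
rewrite -(@ge0_integral_mixture _ _ _ _ _ P kZ (image_measure P (mfun_of mZY)))//.
  by rewrite ge0_integral_image.
apply: (@mixture_unique _ _ _ _ _ _ _ _ (@boxes I R)) => //.
- by move=> w; exact: (prob_kernel (s := k)).
- exact: (@probability_setT _ _ _ P).
- exact: boxes_generate.
- exact: boxes_setI_closed.
move=> _ [B [C [mB mC ->]]].
transitivity (P ([set w | forall i, B i (Z w i)] `&` Y @^-1` C)) => //.
rewrite boxE// integral_mkcond; apply: eq_integral => w _.
rewrite patchE; case: ifPn; [rewrite inE|rewrite notin_setE]=> /= wB.
  by congr (k (a w) _); apply/seteqP; split => [y Cy|y []].
apply/esym; rewrite /kZ /= /image_measure /pushforward /=.
by rewrite (_ : _ @^-1` _ = set0) ?measure0//; apply/seteqP; split => // y [].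
Qed.

End box_mixture.

Section density.
Local Open Scope ereal_scope.
Context d (T : measurableType d) (R : realType).
Variables (m : {measure set T -> \bar R}) (rho : T -> R).
Hypothesis mrho : measurable_fun setT rho.
Hypothesis rho0 : forall x, (0 <= rho x)%R.

Let density_fun (A : set T) : \bar R := \int[m]_(x in A) (rho x)%:E.

Let density_fun0 : density_fun set0 = 0.
Proof. exact: integral_set0. Qed.

Let density_fun_ge0 A : 0 <= density_fun A.
Proof. by apply: integral_ge0 => x _; rewrite lee_fin. Qed.

Let density_fun_additive : semi_sigma_additive density_fun.
Proof.
apply: semi_sigma_additive_nng_induced; first exact/measurable_EFinP.
by move=> x; rewrite lee_fin.
Qed.

Definition density_measure : {measure set T -> \bar R} :=
  HB.pack density_fun (isMeasure.Build _ _ _ density_fun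
    density_fun0 density_fun_ge0 density_fun_additive).

Lemma density_measureE A :
  density_measure A = \int[m]_(x in A) (rho x)%:E.
Proof. by []. Qed.

(** A measure with density is the mixture of the point masses at [x] weighted by [rho x], so this is
    an instance of [ge0_integral_mixture]. *)
Lemma ge0_integral_density (h : T -> \bar R) : measurable_fun setT h ->
  (forall x, 0 <= h x) ->
  \int[density_measure]_x h x = \int[m]_x ((rho x)%:E * h x).
Proof.
move=> mh h0.
pose k (x : T) : {measure set T -> \bar R} :=
  mscale (NngNum (rho0 x)) (dirac x).
have mk A : measurable A -> measurable_fun setT (k ^~ A).
  move=> mA; rewrite /k /= /mscale /=.
  apply: emeasurable_funM; first exact/measurable_EFinP.
  under eq_fun do rewrite diracE -indicE.
  exact/measurable_EFinP/measurable_indic.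
rewrite (@ge0_integral_mixture _ _ _ _ _ m k)//.
  apply: eq_integral => x _.
  by rewrite ge0_integral_mscale// integral_dirac// diracT mul1e.
move=> A mA; rewrite density_measureE integral_mkcond; apply: eq_integral.
move=> x _; rewrite patchE /k /= /mscale/= diracE.
by case: (x \in A); rewrite ?mule1 ?mule0.
Qed.

End density.

Section sub_sigma_algebra_comparison.
Context d (T : measurableType d) (R : realType) (P : probability T R).
Variable G : set (set T).
Hypothesis GT : G `<=` measurable.

Let TG := g_sigma_algebraType G.

Lemma sub_gen_measurable H : <<s G >> H -> measurable H.
Proof. by apply: smallest_sub => //; exact: sigma_algebra_measurable. Qed.

Lemma measurable_fun_gen d' (T' : measurableType d') (f : T -> T') :
  measurable_fun [set: TG] f -> measurable_fun [set: T] f.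
Proof.
move=> mf _ B mB; rewrite setTI; apply: sub_gen_measurable.
by have := mf measurableT B mB; rewrite setTI.
Qed.

(** The set where [g < f] belongs to the sub-sigma-algebra, so the hypothesis can be tested on it:
    there [f - g] is positive with nonpositive integral, and the set is null. Used in both
    directions, this gives uniqueness of versions. *)
Lemma ae_le_gen (f g : T -> R) :
  measurable_fun [set: TG] f -> measurable_fun [set: TG] g ->
  P.-integrable setT (EFin \o f) -> P.-integrable setT (EFin \o g) ->
  (forall H, <<s G >> H ->
    (\int[P]_(x in H) (f x)%:E <= \int[P]_(x in H) (g x)%:E)%E) ->
  {ae P, forall x, f x <= g x}.
Proof.
move=> mf mg intf intg fg.
pose H := [set x | g x < f x].
have GH : <<s G >> H.
  have mfg : measurable_fun [set: TG] (fun x => g x - f x).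
    exact: measurable_funB.
  have := mfg measurableT `]-oo, 0[%classic; rewrite setTI.
  have -> : (fun x => g x - f x) @^-1` `]-oo, 0[%classic = H.
    by apply/seteqP; split => x; rewrite /H/= in_itv/= subr_lt0.
  by apply.
have mH := sub_gen_measurable GH.
have intHf := integrableS measurableT mH (@subsetT _ H) intf.
have intHg := integrableS measurableT mH (@subsetT _ H) intg.
have int0 : (\int[P]_(x in H) `|(f x - g x)%:E| = 0)%E.
  apply/eqP; rewrite eq_le integral_ge0// andbT.
  rewrite (_ : integral _ _ _ = \int[P]_(x in H) ((f x)%:E - (g x)%:E))%E.
    by rewrite integralB// sube_le0 fg.
  by apply: eq_integral => x; rewrite inE/= => gf; rewrite ger0_norm// subr_ge0 ltW.
have mfg : measurable_fun H (fun x => (f x - g x)%:E).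
  apply/measurable_funTS/measurable_EFinP.
  by apply: measurable_funB; exact: measurable_fun_gen.
have [+ _] := @ae_eq_integral_abs _ _ _ P H mH _ mfg.
case=> //.
move=> N [mN PN subN]; exists N; split => // x /= /negP; rewrite -ltNge => gf.
by apply: subN => /=; move/(_ gf) => -[] /eqP; rewrite subr_eq0 gt_eqF.
Qed.

End sub_sigma_algebra_comparison.

(** * Kernels and the global Markov property *)

Section markov.
Context d (T : measurableType d) (R : realType) (P : probability T R).
Context (V : finType).
Variable X : V -> {RV P >-> R}.

Lemma gen_events_measurable (W : {set V}) : gen_events X W `<=` measurable.
Proof. by move=> _ [v _ [B mB ->]]; exact: measurable_funPTI. Qed.

(** [cond_distr_version] speaks only of preimages under [X a]; these exhaust the sigma-algebra to
    which conditional independence refers. *)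
Lemma gen_events_set1 a H : <<s gen_events X [set a]%SET >> H ->
  exists2 B, measurable B & H = X a @^-1` B.
Proof.
move=> HG; suff [B mB <-] : preimage_set_system setT (X a) measurable H.
  by exists B => //; rewrite setTI.
move: H HG; apply: smallest_sub.
  by apply: sigma_algebra_preimage; exact: sigma_algebra_measurable.
move=> _ [v + [B mB ->]]; rewrite inE => /eqP ->.
by exists B => //; rewrite setTI.
Qed.

Lemma gen_events_preimage (W : {set V}) v B : v \in W -> measurable B ->
  <<s gen_events X W >> (X v @^-1` B).
Proof. by move=> vW mB; apply: sub_sigma_algebra; exists v => //; exists B. Qed.

Lemma cond_distr_version_preimage (a b : V) (k : R.-pker R ~> R) B C :
  cond_distr_version (X a) (X b) k -> measurable B -> measurable C ->
  P (X a @^-1` B `&` X b @^-1` C) = (\int[P]_(w in X a @^-1` B) k (X a w) C)%E.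
Proof.
move=> kab mB mC; rewrite kab// ge0_integral_pushforward//.
exact/measurable_funTS/measurable_kernel.
Qed.

(** Conditional independence provides versions [h1], [h2] whose product is a version for the
    intersection. By uniqueness [h2] is the kernel value at [X a]; what multiplies [h1] is then a
    function of [X a], and against such functions [h1] integrates like the indicator of [D]. *)
Lemma cond_independent_kernel (GA GB : set (set T)) (a b : V)
    (k : R.-pker R ~> R) (D : set T) (B C : set R) :
  GA `<=` measurable ->
  cond_independent P GA GB (gen_events X [set a]%SET) ->
  cond_distr_version (X a) (X b) k ->
  <<s GA >> D -> measurable B -> <<s GB >> (X b @^-1` C) -> measurable C ->
  P (D `&` X a @^-1` B `&` X b @^-1` C) =
  (\int[P]_(w in D `&` X a @^-1` B) k (X a w) C)%E.
Proof.
move=> mGA ci kab GD mB GC mC.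
have mD := sub_gen_measurable mGA GD.
have [h1 [h2 [[mh1 ih1 h1E] [mh2 ih2 h2E] [mh12 ih12 h12E]]]] := ci _ _ GD GC.
set G := gen_events X [set a]%SET in mh1 mh2 mh12 h1E h2E h12E.
have mG : G `<=` measurable by exact: gen_events_measurable.
have GB' B' : measurable B' -> <<s G >> (X a @^-1` B').
  by apply: gen_events_preimage; rewrite inE.
pose c w := fine (k (X a w) C).
have kfin x : k x C \is a fin_num.
  rewrite ge0_fin_numE// (@le_lt_trans _ _ 1%E) ?ltry//.
  by rewrite -(prob_kernel (s := k) x) le_measure// inE.
have cE w : (c w)%:E = k (X a w) C by rewrite fineK.
have c01 w : 0 <= c w <= 1.
  rewrite -!lee_fin cE measure_ge0/= -(prob_kernel (s := k) (X a w)).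
  by rewrite le_measure// inE.
have mXa : measurable_fun [set: g_sigma_algebraType G] (X a).
  by move=> _ B' mB'; rewrite setTI; exact: GB'.
have mfk : measurable_fun setT (fun x => fine (k x C)).
  by apply: measurableT_comp => //; exact: measurable_kernel.
have mc : measurable_fun [set: g_sigma_algebraType G] c.
  exact: measurableT_comp mfk mXa.
have mcT : measurable_fun [set: T] c by exact: measurable_fun_gen mG _ _ _ mc.
have ic : P.-integrable setT (EFin \o c) by exact: unit_bounded_integrable.
have cH H : <<s G >> H ->
    (\int[P]_(w in H) (c w)%:E = P (X b @^-1` C `&` H))%E.
  move=> /gen_events_set1[B' mB' ->].
  rewrite setIC (cond_distr_version_preimage kab)//.
  by apply: eq_integral => w _; rewrite cE.
have h1_ge0 : {ae P, forall w, 0 <= h1 w}.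
  apply: (ae_le_gen mG) => //; first exact: finite_measure_integrable_cst.
  by move=> H GH; rewrite integral0 h1E.
have h2c : {ae P, forall w, h2 w = c w}.
  have H1 : {ae P, forall w, h2 w <= c w}.
    by apply: (ae_le_gen mG) => // H GH; rewrite h2E// cH.
  have H2 : {ae P, forall w, c w <= h2 w}.
    by apply: (ae_le_gen mG) => // H GH; rewrite h2E// cH.
  by apply: filterS2 H1 H2 => w w1 w2; apply/eqP; rewrite eq_le w1.
have mh1T := measurable_fun_gen mG mh1; have mh2T := measurable_fun_gen mG mh2.
(* A version of a conditional probability may be negative on a null set; its positive part can serve
   as a density. *)
pose r w := Num.max (h1 w) 0.
have mr : measurable_fun setT r by exact: measurable_maxr.
have r0 w : 0 <= r w by rewrite le_max lexx orbT.
have rh1 : {ae P, forall w, h1 w = r w}.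
  by apply: filterS h1_ge0 => w h10; rewrite /r max_l.
have m1D : measurable_fun setT (\1_D : T -> R) by exact: measurable_indic.
have D0 w : 0 <= (\1_D w : R) by rewrite indicE.
(* Equality of these images says that [r] and the indicator of [D] have the same integral against
   every nonnegative function of [X a]. *)
pose m1 := image_measure (density_measure P mr r0) (X a).
pose m2 := image_measure (density_measure P m1D D0) (X a).
have m12 A : measurable A -> m1 A = m2 A.
  move=> mA; have mXA : measurable (X a @^-1` A) by exact: measurable_funPTI.
  rewrite [LHS](_ : _ = \int[P]_(w in X a @^-1` A) (r w)%:E)%E//.
  rewrite [RHS](_ : _ = \int[P]_(w in X a @^-1` A) (\1_D w)%:E)%E//.
  rewrite integral_indic//.
  transitivity (\int[P]_(w in X a @^-1` A) (h1 w)%:E)%E; last first.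
    by apply: h1E; exact: GB'.
  apply: ae_eq_integral => //.
  - exact/measurable_funTS/measurable_EFinP.
  - exact/measurable_funTS/measurable_EFinP.
  - by apply: filterS rh1 => w ->.
pose g x := (k x C * (\1_B x)%:E)%E.
have mg : measurable_fun setT g.
  apply: emeasurable_funM; first exact: measurable_kernel.
  exact/measurable_EFinP/measurable_indic.
have g0 x : (0 <= g x)%E by rewrite mule_ge0// lee_fin indicE.
have : (\int[m1]_x g x = \int[m2]_x g x)%E by apply: eq_measure_integral => A mA _; exact: m12.
have mgXa : measurable_fun setT (g \o X a) by exact: measurableT_comp.
rewrite !ge0_integral_image// !ge0_integral_density// => g12.
have mXB : measurable (X a @^-1` B) by exact: measurable_funPTI.
transitivity (\int[P]_(w in X a @^-1` B) ((h1 \* h2) w)%:E)%E.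
  by rewrite h12E; [rewrite setIAC|exact: GB'].
transitivity (\int[P]_(w in X a @^-1` B) (r w * c w)%:E)%E.
  apply: ae_eq_integral => //.
  - by apply/measurable_funTS/measurable_EFinP; exact: measurable_funM.
  - by apply/measurable_funTS/measurable_EFinP; exact: measurable_funM.
  - by apply: filterS2 rh1 h2c => w /= -> ->.
have memXB w : (w \in X a @^-1` B) = (X a w \in B).
  by apply/idP/idP; rewrite !inE.
transitivity (\int[P]_w ((r w)%:E * g (X a w)))%E.
  rewrite integral_mkcond; apply: eq_integral => w _.
  rewrite patchE /g indicE EFinM cE memXB.
  by case: ifPn => _; rewrite ?mule1 ?mule0 ?mule0.
rewrite g12 [RHS]integral_mkcond; apply: eq_integral => w _.
rewrite patchE in_setI /g !indicE memXB.
by case: (_ \in D); case: (_ \in B) => /=; rewrite ?mule1 ?mule0 ?mul0e ?mul1e.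
Qed.

End markov.

Section projections.
Context {V : finType} {R : realType}.
Implicit Types (x : rvec V R) (W : {set V}).

(** Filling with 0 keeps the subvectors for all [W] in one type, so the induction over [W] never
    changes space. *)
Definition vproj W x : rvec V R := fun v => if v \in W then x v else 0.

Lemma measurable_vproj W d (T : measurableType d) (Z : T -> rvec V R) :
  measurable_fun setT Z -> measurable_fun setT (fun w => vproj W (Z w)).
Proof.
move=> mZ; apply: measurable_rvec => v; rewrite /vproj; case: (v \in W) => //.
exact: measurableT_comp (measurable_coord v) mZ.
Qed.

End projections.

Section markov_integral.
Context d (T : measurableType d) (R : realType) (P : probability T R).
Context (V : finType).
Variable X : V -> {RV P >-> R}.

Definition vec_of (w : T) : rvec V R := fun v => X v w.

Lemma measurable_vec_of : measurable_fun setT vec_of.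
Proof. exact: measurable_rvec. Qed.

(** Given [X a], the rest of [W] carries no information on [X b], so the conditional law of [X b]
    given all of [W] is the kernel at [X a]. The box criterion reduces this to
    [cond_independent_kernel]. *)
Lemma markov_kernel_integral (W : {set V}) (a b : V) (k : R.-pker R ~> R)
    (h : rvec V R * R -> \bar R) : a \in W ->
  ((W :\ a)%SET != finset.set0 ->
    cond_independent P (gen_events X (W :\ a)%SET) (gen_events X [set b]%SET)
      (gen_events X [set a]%SET)) ->
  cond_distr_version (X a) (X b) k ->
  measurable_fun setT h -> (forall p, 0 <= h p)%E ->
  (\int[P]_w h (vproj W (vec_of w), X b w) =
   \int[P]_w \int[k (X a w)]_y h (vproj W (vec_of w), y))%E.
Proof.
move=> aW ci kab mh h0.
have mZ := measurable_vproj W measurable_vec_of.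
apply: (ge0_integral_box_mixture mZ) => //.
move=> B C mB mC.
pose D := [set w | forall i, i != a -> B i (vproj W (vec_of w) i)].
have BE : [set w | forall i, B i (vproj W (vec_of w) i)] =
    D `&` X a @^-1` B a.
  apply/seteqP; split => [w H|w [Dw Ba] i].
    by split => [i _|]; [exact: H|have := H a; rewrite /vproj aW].
  by have [->|/Dw//] := eqVneq i a; rewrite /vproj aW.
rewrite BE.
(* Conditional independence is only supplied for a non-empty rest of [W]. When [W] reduces to [a],
   membership in [D] does not depend on [w], so [D] is everything or empty and the defining property
   of the kernel suffices. *)
have [W0|W0] := eqVneq (W :\ a)%SET finset.set0; last first.
  apply: (cond_independent_kernel _ (ci W0)) => //.
  - exact: gen_events_measurable.
  - pose TG := g_sigma_algebraType (gen_events X (W :\ a)%SET).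
    suff : measurable (D : set TG) by [].
    rewrite (_ : D = \bigcap_(i in [set i | i != a])
        [set w | B i (vproj W (vec_of w) i)]); last first.
      by apply/seteqP; split => w H i; exact: H.
    apply: fin_bigcap_measurable; first exact: finite_finset.
    move=> i /= ia; have [iW|iW] := boolP (i \in W).
      rewrite (_ : mkset _ = X i @^-1` B i); last by rewrite /vproj iW.
      by apply: gen_events_preimage => //; rewrite !inE ia.
    rewrite (_ : mkset _ = [set _ | B i 0]); last first.
      by rewrite /vproj (negbTE iW).
    by have [Bi|Bi] := pselect (B i 0);
      [rewrite (_ : mkset _ = setT)//|rewrite (_ : mkset _ = set0)//];
      apply/seteqP; split.
  - by apply: gen_events_preimage; rewrite ?inE.
have Dcst w w' : D w -> D w'.
  move=> Dw i ia; have := Dw i ia; rewrite /vproj.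
  suff -> : (i \in W) = false by [].
  apply/negP => iW; have : i \in (W :\ a)%SET by rewrite !inE ia iW.
  by rewrite W0 inE.
have [[w Dw]|D0] := pselect (exists w, D w).
  have -> : D = setT by apply/seteqP; split => // w' _; exact: Dcst Dw.
  by rewrite setTI (cond_distr_version_preimage kab).
have -> : D = set0 by apply/seteqP; split => // w Dw; apply: D0; exists w.
by rewrite !set0I measure0 integral_set0.
Qed.

End markov_integral.

(** * Paths in trees *)

Section tree_paths.
Local Open Scope set_scope.
Context (V : finType) (E : rel V).
Hypothesis treeE : undirected_tree E.

Let symE : symmetric E. Proof. by case: treeE. Qed.

Lemma path_edges_rcons (u : V) p b :
  path_edges u (rcons p b) = (last u p, b) |: path_edges u p.
Proof.
have zipE : zip (u :: rcons p b) (rcons p b) = rcons (zip (u :: p) p) (last u p, b).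
  by elim: p u => //= x p IH u; rewrite IH.
by apply/setP => e; rewrite /path_edges zipE !inE mem_rcons inE.
Qed.

Lemma path_edgesP (u : V) p e : e \in path_edges u p -> e.1 \in u :: p /\ e.2 \in p.
Proof.
rewrite /path_edges inE; elim: p u => //= x p IH u; rewrite inE.
move=> /predU1P[->/=|/IH[e1 e2]]; first by rewrite !inE !eqxx.
by rewrite in_cons e1 orbT inE e2 orbT.
Qed.

Lemma simple_path_edges u v p q : simple_path E u v p -> simple_path E u v q ->
  path_edges u p = path_edges u q.
Proof.
have [->|uv] := eqVneq u v.
  have nilE r : simple_path E v v r -> r = [::].
    move=> /and3P[_ /eqP lr]; case: r lr => //= x r lr.
    by rewrite -{1}lr mem_last.
  by move=> /nilE -> /nilE ->.
move=> up uq; have [_ _ /(_ _ _ uv)[W [_ WE]]] := treeE.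
have <- : W = path_edges u p by apply: WE; exists p.
by apply: WE; exists q.
Qed.

Lemma tree_pathE u v p : simple_path E u v p -> tree_path E u v = path_edges u p.
Proof.
move=> up; rewrite /tree_path; case: xgetP => [_ _ [q uq ->]|].
  exact: simple_path_edges uq up.
by move=> /(_ (path_edges u p)) []; exists p.
Qed.

Definition tree_connected (W : {set V}) := forall w w', w \in W -> w' \in W ->
  exists2 p, simple_path E w w' p & {subset p <= W}.

Section extension.
Variables (W : {set V}) (a b : V).
Hypotheses (cW : tree_connected W) (aW : a \in W) (bW : b \notin W) (ab : E a b).

Lemma simple_path_rcons w : w \in W -> exists p,
  [/\ simple_path E w a p, {subset p <= W} & simple_path E w b (rcons p b)].
Proof.
move=> wW; have [p /and3P[pp /eqP lp up] pW] := cW wW aW; exists p.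
have bp : b \notin w :: p.
  rewrite inE negb_or; apply/andP; split; last by apply: contra bW => /pW.
  by apply: contraNneq bW => ->.
split => //; rewrite /simple_path ?pp ?lp ?eqxx//.
by rewrite rcons_path pp lp ab last_rcons eqxx -rcons_cons rcons_uniq bp up.
Qed.

(** A path inside [W] to [a], followed by [b], is simple and uses the edge [(a, b)]; every other
    simple path to [b] has the same edges. Both the orientation of [(a, b)] away from [W] and the
    separation by [a] follow. *)
Lemma simple_path_through w q : w \in W -> simple_path E w b q -> a \in w :: q.
Proof.
move=> wW wq; have [p [/and3P[_ /eqP lp _] _ wp]] := simple_path_rcons wW.
have : (a, b) \in path_edges w q.
  by rewrite -(simple_path_edges wp wq) path_edges_rcons lp setU11.
by move=> /path_edgesP[].
Qed.

Lemma tree_path_extend u : u \in W ->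
  tree_path E u b = (a, b) |: tree_path E u a.
Proof.
move=> uW; have [p [up pW upb]] := simple_path_rcons uW.
rewrite (tree_pathE upb) (tree_pathE up) path_edges_rcons.
by have /and3P[_ /eqP -> _] := up.
Qed.

Lemma edge_from u : u \in W -> (a, b) \in edges_from E u.
Proof.
move=> uW; rewrite inE ab; apply/asboolP; right => p /=.
exact: simple_path_through.
Qed.

Lemma separates_extension : separates E [set a] (W :\ a) [set b].
Proof.
move=> w b' p; rewrite !inE => /andP[_ wW] /eqP -> wp.
by exists a; [rewrite inE|exact: simple_path_through wp].
Qed.

Lemma tree_connected_extension : tree_connected (b |: W).
Proof.
have pathbW w : w \in W -> exists2 p, simple_path E b w p & {subset p <= b |: W}.
  move=> wW; have [p /and3P[pp /eqP lp up] pW] := cW aW wW.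
  exists (a :: p).
    rewrite /simple_path/= symE ab pp lp eqxx; move: up => /= ->.
    rewrite inE negb_or !andbT; apply/andP; split.
      by apply: contraNneq bW => ->.
    by apply: contra bW => /pW.
  by move=> x; rewrite !inE => /predU1P[->|/pW ->]; rewrite ?aW orbT.
move=> w w'; rewrite !inE => /predU1P[->|wW] /predU1P[->|w'W].
- by exists [::]; rewrite // /simple_path/= eqxx.
- exact: pathbW.
- have [p [_ pW wp]] := simple_path_rcons wW; exists (rcons p b) => //.
  by move=> x; rewrite mem_rcons !inE => /predU1P[->|/pW ->]; rewrite ?eqxx ?orbT.
- have [p wp pW] := cW wW w'W; exists p => // x /pW xW.
  by rewrite !inE xW orbT.
Qed.

End extension.

Lemma exists_boundary_edge (W : {set V}) u v : u \in W -> v \notin W ->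
  exists a b, [/\ a \in W, b \notin W & E a b].
Proof.
move=> uW vW; have uv : u != v by apply: contraNneq vW => <-.
have [_ _ /(_ _ _ uv)[_ [[p /and3P[pp /eqP lp _] _] _]]] := treeE.
elim: p u uW pp lp {uv} => [u uW _ /= uv|x p IH u uW /= /andP[ux pp] lp].
  by rewrite -uv uW in vW.
have [xW|xW] := boolP (x \in W); first exact: IH xW pp lp.
by exists u, x.
Qed.

(** A proper subset containing [u] always has an edge leaving it, so the complement can be exhausted
    node by node. The invariant that path edges end in [W] ensures that an edge to a node outside
    [W] is not among those used so far, which is what independence of the [M_e] requires. *)
Lemma tree_growth_ind (u : V) (Q : {set V} -> Prop) :
  Q [set u] ->
  (forall (W : {set V}) a b, u \in W -> tree_connected W ->
    (forall v e, v \in W -> e \in tree_path E u v ->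
      e \in edges_from E u /\ e.2 \in W) ->
    a \in W -> b \notin W -> E a b -> Q W -> Q (b |: W)) ->
  Q [set: V].
Proof.
move=> Qu Qstep.
suff H n (W : {set V}) : (#|~: W| <= n)%N -> u \in W -> tree_connected W ->
    (forall v e, v \in W -> e \in tree_path E u v ->
      e \in edges_from E u /\ e.2 \in W) -> Q W -> Q [set: V].
  have spu : simple_path E u u [::] by rewrite /simple_path/= eqxx.
  apply: (H #|~: [set u]| [set u]) => //; first by rewrite inE.
    by move=> w w'; rewrite !inE => /eqP -> /eqP ->; exists [::].
  by move=> v e; rewrite inE => /eqP ->; rewrite (tree_pathE spu) => /path_edgesP[_].
elim: n W => [|n IH] W.
  rewrite leqn0 cards_eq0 => /eqP W0 _ _ _.
  suff -> : W = [set: V] by [].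
  by rewrite -[W]finset.setCK W0 finset.setC0.
move=> Wn uW cW pW QW.
have [/setP WT|/existsNP[v]] := pselect (W =i [set: V]); first by rewrite -WT.
rewrite inE; move=> /eqP; rewrite eqb_id => vW.
have [a [b [aW bW ab]]] := exists_boundary_edge uW vW.
apply: (IH (b |: W)).
- move: Wn; rewrite (cardsD1 b) inE bW add1n ltnS; apply: leq_trans.
  by apply: subset_leq_card; apply/fintype.subsetP => x; rewrite !inE negb_or.
- by rewrite !inE uW orbT.
- exact: tree_connected_extension aW bW ab.
- move=> v' e; rewrite !inE => /predU1P[->|v'W].
    rewrite (tree_path_extend cW aW bW ab uW) !inE => /predU1P[->|/(pW _ _ aW)[e1 e2]].
      split; last by rewrite eqxx.
      by have := edge_from cW aW bW ab uW; rewrite inE.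
    by rewrite inE in e1; rewrite e1 e2 orbT.
  by move=> /(pW _ _ v'W)[e1 e2]; rewrite inE in e1; rewrite e1 e2 orbT.
- exact: (Qstep W a b).
Qed.

End tree_paths.

Section tree_independence.
Context d (T : measurableType d) (R : realType) (P : probability T R).
Context (V : finType) (E : rel V) (M : V * V -> {RV P >-> R}).
Variables (J : {set V * V}) (mu : probability R R) (e0 : V * V).
Hypothesis M_indep : mutually_independent J M.
Hypothesis e0J : e0 \in J.
Hypothesis M_law : forall B, measurable B -> distribution P (M e0) B = mu B.

(** Independence is the box criterion with the constant kernel [mu]. *)
Lemma ge0_integral_independent (K : {set V * V})
    (h : rvec (V * V)%type R * R -> \bar R) :
  K \subset J -> e0 \notin K -> measurable_fun setT h ->
  (forall p, 0 <= h p)%E ->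
  (\int[P]_w h (vproj K (vec_of M w), M e0 w) =
   \int[P]_w \int[mu]_y h (vproj K (vec_of M w), y))%E.
Proof.
move=> KJ e0K mh h0.
have mZ := measurable_vproj K (measurable_vec_of M).
pose k := kprobability (measurable_cst (mu : pprobability R R)) :
  R.-pker T ~> R.
apply: (@ge0_integral_box_mixture _ _ _ _ _ _ P _ (M e0) k id) => //.
move=> B C mB mC.
rewrite (_ : (fun w => k (id w) C) = cst (mu C))// integral_cst; last first.
  exact: (measurable_cylinder mZ mB).
(* Coordinates outside [K] are frozen at 0: a box excluding 0 there is never met and both sides
   vanish; otherwise it constrains only the [M i] with [i] in [K]. *)
have [B0|/existsNP[e /not_implyP[eK Be]]] :=
  pselect (forall e, e \notin K -> B e 0); last first.
  rewrite (_ : [set w | _] = set0) ?set0I ?measure0 ?mule0//.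
  apply/seteqP; split => // w /(_ e); rewrite /vproj (negbTE eK).
  exact: Be.
have BE : [set w | forall i, B i (vproj K (vec_of M w) i)] =
    [set w | forall i, i \in K -> B i (M i w)].
  apply/seteqP; split => [w H i iK|w H i]; first by have := H i; rewrite /vproj iK.
  rewrite /vproj; case: ifPn => [iK|iK]; [exact: H|exact: B0].
rewrite BE [X in (_ * X)%E](M_indep KJ mB).
pose B' e := if e == e0 then C else B e.
have B'K e : e \in K -> B' e = B e.
  by move=> eK; rewrite /B'; case: eqP => // ee0; rewrite -ee0 eK in e0K.
have -> : [set w | forall i, i \in K -> B i (M i w)] `&` M e0 @^-1` C =
    [set w | forall i, i \in (e0 |: K)%SET -> B' i (M i w)].
  apply/seteqP; split => [w [H Cw] i|w H].
    rewrite !inE /B'; have [->//|ie0 /= iK] := eqVneq i e0.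
    exact: H.
  split => [i iK|]; last by have := H e0; rewrite /B' !inE eqxx; apply.
  by rewrite -B'K//; apply: H; rewrite !inE iK orbT.
transitivity (\prod_(i in (e0 |: K)%SET) P (M i @^-1` B' i))%E.
  apply: M_indep; first by rewrite finset.subUset finset.sub1set e0J.
  by move=> i; rewrite /B'; case: ifP.
rewrite big_setU1//=; congr (_ * _)%E; last by apply: eq_bigr => i iK; rewrite B'K.
by rewrite /B' eqxx -M_law.
Qed.

(** The entries indexed by [W] are functions of the [M e] with [e.2] in [W], a family that omits
    [e0]. *)
Lemma ge0_integral_tree_product (u : V) (W : {set V})
    (h : rvec V R * R -> \bar R) :
  (forall v e, v \in W -> e \in tree_path E u v -> e \in J /\ e.2 \in W) ->
  e0.2 \notin W -> measurable_fun setT h -> (forall p, 0 <= h p)%E ->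
  (\int[P]_w h (vproj W (tree_product E M u w), M e0 w) =
   \int[P]_w \int[mu]_y h (vproj W (tree_product E M u w), y))%E.
Proof.
move=> pW e0W mh h0.
pose K := [set e in J | e.2 \in W]%SET.
pose phi (z : rvec (V * V)%type R) : rvec V R :=
  fun v => if v == u then 1 else \prod_(e in tree_path E u v) z e.
have mphi : measurable_fun setT phi.
  apply: measurable_rvec => v; rewrite /phi; case: (v == u) => //.
  rewrite (_ : (fun _ => _) = fun z : rvec (V * V)%type R =>
      \prod_(e <- enum (tree_path E u v)) z e).
    by apply: measurable_prod => e _; exact: measurable_coord.
  by apply/funext => w; rewrite big_enum.
have phiE w : vproj W (tree_product E M u w) =
    vproj W (phi (vproj K (vec_of M w))).
  apply/funext => v; rewrite /vproj; case: ifP => // vW.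
  rewrite /tree_product /phi; case: ifP => // _; apply: eq_bigr => e ep.
  by have [eJ eW] := pW v e vW ep; rewrite inE eJ eW.
pose h' (p : rvec (V * V)%type R * R) := h (vproj W (phi p.1), p.2).
have mh' : measurable_fun setT h'.
  apply: measurableT_comp mh _; apply: measurable_fun_pair.
    apply: measurable_vproj; exact: measurableT_comp mphi measurable_fst.
  exact: measurable_snd.
transitivity (\int[P]_w h' (vproj K (vec_of M w), M e0 w))%E.
  by apply: eq_integral => w _; rewrite phiE.
transitivity (\int[P]_w \int[mu]_y h' (vproj K (vec_of M w), y))%E; last first.
  by apply: eq_integral => w _; rewrite phiE.
apply: ge0_integral_independent => //.
- by apply/fintype.subsetP => e; rewrite inE => /andP[].
- by rewrite inE negb_and e0W orbT.
- by move=> p; exact: h0.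
Qed.

End tree_independence.

(** * Convergence to the Pareto law *)

Section step_approximation.
Context (R : realType) (g : R -> R) (L : R) (N : nat).
Hypothesis g01 : forall x, 0 <= g x <= 1.
Hypothesis gL : forall x y, `|g x - g y| <= L * `|x - y|.
Hypothesis L0 : 0 <= L.

Let mesh : R := N.+1%:R^-1.
Let node (j : nat) : R := 1 + j%:R * mesh.

Let gt_ind (l x : R) : R := \1_`]l, +oo[%classic x.

Let gt_indT l x : l < x -> gt_ind l x = 1.
Proof. by move=> lx; rewrite /gt_ind indicE mem_setE in_itv/= lx. Qed.

Let gt_indF l x : x <= l -> gt_ind l x = 0.
Proof. by move=> lx; rewrite /gt_ind indicE mem_setE in_itv/= ltNge lx. Qed.

(** A staircase summed by parts: beyond 1 it takes the value of [g] at the last node, of index at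
    most [n], strictly below [x]. In this form its integral involves tail probabilities only. *)
Let step (n : nat) (x : R) : R :=
  g 1 * gt_ind 1 x + \sum_(j < n) (g (node j.+1) - g (node j)) * gt_ind (node j.+1) x.

Let mesh_gt0 : 0 < mesh. Proof. by rewrite invr_gt0. Qed.

Let node0 : node 0 = 1.
Proof. by rewrite /node -[0%:R]/(0 : R) mul0r addr0. Qed.

Let nodeS j : node j.+1 = node j + mesh.
Proof. by rewrite /node -natr1 mulrDl mul1r addrA. Qed.

Let node_ge1 j : 1 <= node j.
Proof. by rewrite lerDl mulr_ge0// ltW. Qed.

Let stepS n x : step n.+1 x =
  step n x + (g (node n.+1) - g (node n)) * gt_ind (node n.+1) x.
Proof. by rewrite /step big_ord_recr addrA. Qed.

Let step_gt n x : node n < x -> step n x = g (node n).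
Proof.
elim: n => [|n IH].
  by rewrite node0 /step big_ord0 addr0 => x1; rewrite gt_indT// mulr1.
move=> xn; have xn' : node n < x by apply: lt_trans xn; rewrite nodeS ltrDl.
by rewrite stepS (gt_indT xn) mulr1 (IH xn') addrC subrK.
Qed.

Let step_near n x : 1 < x -> x <= node n.+1 -> `|g x - step n x| <= L * mesh.
Proof.
move=> x1; elim: n => [|n IH] xn.
  rewrite step_gt ?node0// (le_trans (gL _ _))// ler_wpM2l// ger0_norm ?subr_ge0 ?(ltW x1)//.
  by move: xn; rewrite nodeS node0 lerBlDl.
have [xn1|xn1] := leP x (node n.+1).
  by rewrite stepS gt_indF// mulr0 addr0; exact: IH.
rewrite step_gt// (le_trans (gL _ _))// ler_wpM2l// ger0_norm ?subr_ge0 ?(ltW xn1)//.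
by move: xn; rewrite nodeS lerBlDl.
Qed.

Let step_bound n x : `|g x - step n x| <=
  L * mesh + (1 - gt_ind 1 x) + gt_ind (node n.+1) x.
Proof.
have Lm : 0 <= L * mesh by rewrite mulr_ge0// ltW.
have dist01 y z : `|g y - g z| <= 1.
  have /andP[y0 y1] := g01 y; have /andP[z0 z1] := g01 z.
  by rewrite ler_norml; apply/andP; split; lra.
have [x1|x1] := ltP 1 x; last first.
  have x1n j : x <= node j by exact: le_trans x1 (node_ge1 j).
  have -> : step n x = 0.
    by rewrite /step gt_indF// mulr0 add0r big1// => j _; rewrite gt_indF// mulr0.
  rewrite subr0 !gt_indF// subr0 addr0.
  have /andP[y0 y1] := g01 x; rewrite ger0_norm//; lra.
rewrite (gt_indT x1) subrr addr0.
have [xn|xn] := ltP (node n.+1) x; last by rewrite gt_indF// addr0 step_near.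
rewrite gt_indT// step_gt; last by apply: lt_trans xn; rewrite nodeS ltrDl.
by rewrite (le_trans (dist01 _ _))// lerDr.
Qed.

(** The coefficients and levels are chosen before the measure, so one staircase serves the prelimit
    laws and the Pareto law. The three errors come from the mesh, from mass at or below 1, and from
    mass beyond the last node. *)
Lemma step_approximation n : exists (s : nat -> R) (l : nat -> R),
  (forall j, 1 <= l j) /\
  forall d (T : measurableType d) (m : probability T R) (Y : T -> R),
    measurable_fun setT Y -> measurable_fun setT g ->
  `|\int[m]_w g (Y w) - \sum_(j < n.+1) s j * fine (m [set w | l j < Y w])| <=
  L * N.+1%:R^-1 + (1 - fine (m [set w | 1 < Y w])) +
  fine (m [set w | 1 + n.+1%:R * N.+1%:R^-1 < Y w]).
Proof.
exists (fun j => if j is i.+1 then g (node i.+1) - g (node i) else g 1).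
exists (fun j => if j is i.+1 then node i.+1 else 1); split; first by case.
move=> d T m Y mY mg.
have mind l : measurable_fun setT (fun w => gt_ind l (Y w)).
  by apply: measurableT_comp mY; exact: measurable_indic.
have ind1 l x : `|gt_ind l x| <= 1 
    by have [lx|lx] := ltP l x; [rewrite gt_indT// normr1|rewrite gt_indF// normr0].
have iind l : m.-integrable setT (EFin \o (fun w => gt_ind l (Y w))).
  exact: bounded_integrable (mind l) (fun w => ind1 l (Y w)).
have intind l : \int[m]_w gt_ind l (Y w) = fine (m [set w | l < Y w]).
  have -> : [set w | l < Y w] = Y @^-1` `]l, +oo[%classic.
    by apply/seteqP; split => w; rewrite /= in_itv/= andbT.
  rewrite /Rintegral; congr fine.
  transitivity (\int[m]_w (\1_(Y @^-1` `]l, +oo[%classic) w)%:E)%E.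
    by apply: eq_integral => w _; rewrite /gt_ind !indicE.
  rewrite integral_indic// ?setIT// -[X in measurable X]setTI; exact: mY.
have istep k : m.-integrable setT (EFin \o (fun w => step k (Y w))) /\
    \int[m]_w step k (Y w) = g 1 * fine (m [set w | 1 < Y w]) +
    \sum_(j < k) (g (node j.+1) - g (node j)) * fine (m [set w | node j.+1 < Y w]).
  elim: k => [|k [IHi IH]].
    have -> : (fun w => step 0 (Y w)) = fun w => g 1 * gt_ind 1 (Y w).
      by apply/funext => w; rewrite /step big_ord0 addr0.
    split; first exact: (integrableZl measurableT (g 1) (iind 1)).
    by rewrite big_ord0 addr0 RintegralZl// intind.
  have -> : (fun w => step k.+1 (Y w)) = fun w => step k (Y w) +
      (g (node k.+1) - g (node k)) * gt_ind (node k.+1) (Y w).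
    by apply/funext => w; rewrite stepS.
  have iZ := integrableZl measurableT (g (node k.+1) - g (node k)) (iind (node k.+1)).
  split; first exact: (integrableD measurableT IHi iZ).
  by rewrite RintegralD// RintegralZl// intind IH big_ord_recr addrA.
have [is_ sE] := istep n.
have ig : m.-integrable setT (EFin \o (fun w => g (Y w))).
  by apply: unit_bounded_integrable => //; exact: measurableT_comp.
rewrite big_ord_recl/= -sE -RintegralB//.
have isub := integrableB measurableT ig is_.
apply: le_trans (le_normr_Rintegral measurableT isub) _.
pose B w := (L * mesh + (1 - gt_ind 1 (Y w))) + gt_ind (node n.+1) (Y w).
have ic r : m.-integrable setT (EFin \o (fun _ : T => r : R)).
  exact: finite_measure_integrable_cst.
have iB1 : m.-integrable setT (EFin \o (fun w => 1 - gt_ind 1 (Y w))).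
  exact: (integrableB measurableT (ic 1) (iind 1)).
have iB2 : m.-integrable setT (EFin \o (fun w => L * mesh + (1 - gt_ind 1 (Y w)))).
  exact: (integrableD measurableT (ic (L * mesh)) iB1).
have -> : L * N.+1%:R^-1 + (1 - fine (m [set w | 1 < Y w])) +
  fine (m [set w | 1 + n.+1%:R * N.+1%:R^-1 < Y w]) = \int[m]_w B w.
  rewrite /B RintegralD// RintegralD// RintegralB// !intind !Rintegral_prob_cst.
  by [].
apply: le_Rintegral => //.
- exact: (integrable_norm isub).
- exact: (integrableD measurableT iB2 (iind _)).
Qed.

End step_approximation.

Lemma lipschitz_cts (R : realType) (g : R -> R) (L : R) :
  (forall x y, `|g x - g y| <= L * `|x - y|) -> continuous g.
Proof.
move=> gL x.
apply/cvgrPdist_lt => e e0; near=> y.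
apply: le_lt_trans (gL _ _) _.
apply: (@le_lt_trans _ _ ((`|L| + 1) * `|x - y|)).
  by rewrite ler_wpM2r// (le_trans (ler_norm _))// lerDl.
rewrite -ltr_pdivlMl ?ltr_pwDr//; near: y.
by apply: cvgr_dist_lt => //; rewrite mulr_gt0// invr_gt0 ltr_pwDr.
Unshelve. all: by end_near. Qed.

Lemma lipschitz_measurable (R : realType) (g : R -> R) (L : R) :
  (forall x y, `|g x - g y| <= L * `|x - y|) -> measurable_fun setT g.
Proof. by move=> /lipschitz_cts; exact: continuous_measurable_fun. Qed.

Section pareto_convergence.
Context (R : realType) (alpha : R) (Pa : probability R R).
Hypothesis alpha_gt0 : 0 < alpha.
Hypothesis Pa_pareto : is_pareto alpha Pa.

Lemma powR_small (e : R) : 0 < e ->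
  exists2 l0 : R, 1 <= l0 & forall l, l0 < l -> l `^ (- alpha) < e.
Proof.
move=> e0; exists (Num.max 1 (e^-1 `^ alpha^-1)); first by rewrite le_max lexx.
move=> l; rewrite gt_max => /andP[l1 le].
have l0 : 0 < l by exact: lt_trans l1.
rewrite powRN -[ltRHS]invrK ltf_pV2 ?posrE ?powR_gt0 ?invr_gt0//.
have := gt0_ltr_powR alpha_gt0 (powR_ge0 _ _) (ltW l0) le.
by rewrite -powRrM mulVf ?gt_eqF// powRr1// invr_ge0 ltW.
Qed.

(** Tails at levels at least 1 are enough: the one at level 1 tends to 1, which leaves no mass
    below, and the Pareto tail is small far out. *)
Lemma pareto_cvg d (T : measurableType d) (m_ : R -> probability T R)
    (Y_ : R -> T -> R) (g : R -> R) (L : R) :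
  (forall t, measurable_fun setT (Y_ t)) ->
  (forall l, 1 <= l -> fine (m_ t [set w | l < Y_ t w]) @[t --> +oo] -->
    l `^ (- alpha)) ->
  0 <= L -> (forall x, 0 <= g x <= 1) ->
  (forall x y, `|g x - g y| <= L * `|x - y|) ->
  \int[m_ t]_w g (Y_ t w) @[t --> +oo] --> \int[Pa]_y g y.
Proof.
move=> mY_ tail L0 g01 gL; have mg := lipschitz_measurable gL.
(* Seven errors below [e / 8] add up: the mesh error twice, the far tail once for [Pa] and twice for
   the prelimit law (limit value and deviation), the mass below 1, and the change of the finite
   sum. *)
apply/cvgrPdist_lt => e e0; have e8 : 0 < e / 8 by rewrite divr_gt0.
have [N LN] : exists N : nat, L * N.+1%:R^-1 < e / 8.
  exists (Num.truncn (L / (e / 8))); rewrite ltr_pdivrMr// mulrC -ltr_pdivrMr//.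
  exact: truncnS_gt.
have [l0 l01 l0e] := powR_small e8.
have [n ln] : exists n : nat, l0 < 1 + n.+1%:R * N.+1%:R^-1.
  exists (Num.truncn (l0 * N.+1%:R)); rewrite -ltrBlDl ltr_pdivlMr//.
  apply: le_lt_trans (truncnS_gt _); rewrite ler_wpM2r//.
  by rewrite gerDl oppr_le0.
set lam := 1 + n.+1%:R * N.+1%:R^-1 in ln.
have lam1 : 1 <= lam by rewrite (le_trans l01)// ltW.
have [s [l [l1 app]]] := step_approximation N g01 gL L0 n.
have PaT x : 1 <= x -> fine (Pa [set y | x < y]) = x `^ (- alpha).
  move=> x1; rewrite (_ : mkset _ = `]x, +oo[%classic) ?Pa_pareto//.
  by apply/seteqP; split => y; rewrite /= in_itv/= andbT.
have cvgS : \sum_(j < n.+1) s j * fine (m_ t [set w | l j < Y_ t w])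
    @[t --> +oo] --> \sum_(j < n.+1) s j * (l j) `^ (- alpha).
  elim: n.+1 => [|k IH].
    under eq_fun do rewrite big_ord0; rewrite big_ord0; exact: cvg_cst.
  under eq_fun do rewrite big_ord_recr; rewrite big_ord_recr/=.
  by apply: cvgD => //; apply: cvgMr; exact: tail.
have := app _ _ Pa id (@measurable_id _ _ _) mg.
rewrite -/lam !PaT// powR1 subrr addr0.
under eq_bigr do rewrite PaT//.
have := l0e _ ln; set Sl := \sum_(j < _) _; set IP := Rintegral _ _ _.
move=> tlam appP.
near=> t.
have H1 : `|1 - fine (m_ t [set w | 1 < Y_ t w])| < e / 8.
  near: t.
  by have := tail 1 (lexx _); rewrite powR1 => /cvgrPdist_lt; apply.
have H2 : `|lam `^ (- alpha) - fine (m_ t [set w | lam < Y_ t w])| < e / 8.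
  near: t.
  by move: (tail lam lam1) => /cvgrPdist_lt; apply.
have H3 : `|Sl - \sum_(j < n.+1) s j * fine (m_ t [set w | l j < Y_ t w])| < e / 8.
  near: t.
  by move: cvgS => /cvgrPdist_lt; apply.
have appT := app _ _ (m_ t) (Y_ t) (mY_ t) mg.
rewrite -/lam in appT.
rewrite ltr_norml; move: H1 H2 H3 appT appP tlam LN.
rewrite !ltr_norml !ler_norml.
move: (L * _) (fine (m_ t [set w | 1 < _])) (fine (m_ t [set w | lam < _])).
move: (\sum_(j < n.+1) _) (lam `^ _) (\int[m_ t]_w _) (IP) (Sl).
move=> x1 x2 x3 x4 x5 x6 x7 x8.
move=> /andP[? ?] /andP[? ?] /andP[? ?] /andP[? ?] /andP[? ?] ? ?.
by apply/andP; split; lra.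
Unshelve. all: by end_near. Qed.

End pareto_convergence.

(** * One transition along an edge *)

Section kernel_at.
Context d d' (S : measurableType d) (Y : measurableType d') (R : realType).
Variables (k : R.-pker S ~> Y) (x : S).

Definition kernel_at : set Y -> \bar R := k x.

HB.instance Definition _ := Measure.on kernel_at.

HB.instance Definition _ := Measure_isProbability.Build _ _ _ kernel_at
  (prob_kernel (s := k) x).

Definition pker_at : probability Y R := kernel_at.

End kernel_at.

Section one_dimensional_limits.
Context (R : realType) (k : R.-pker R ~> R) (mu : probability R R).

(** Continuous convergence looks at points near the orthant, which may have negative coordinates;
    and a version of a conditional law may charge negative numbers, on which (ii) says nothing.
    Positive parts of states and outcomes dispose of both, without effect on [X] itself. *)
Definition pospart (x : R) : R := Num.max x 0.

Lemma pospart_ge0 x : 0 <= pospart x.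
Proof. by rewrite /pospart le_max lexx orbT. Qed.

Lemma pospart_id x : 0 <= x -> pospart x = x.
Proof. by rewrite /pospart => x0; rewrite max_l. Qed.

Lemma pospart_lip x y : `|pospart x - pospart y| <= `|x - y|.
Proof.
rewrite /pospart; have [x0|x0] := leP 0 x; have [y0|y0] := leP 0 y.
- by [].
- by rewrite subr0 !ger0_norm//; lra.
- by rewrite sub0r normrN distrC !ger0_norm//; lra.
- by rewrite subrr normr0.
Qed.

Variables (G : R -> R) (L : R).
Hypothesis L0 : 0 <= L.
Hypothesis G01 : forall x, 0 <= G x <= 1.
Hypothesis GL : forall x y, `|G x - G y| <= L * `|x - y|.

Let dist01 x y : `|G x - G y| <= 1.
Proof.
have /andP[x0 x1] := G01 x; have /andP[y0 y1] := G01 y.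
by rewrite ler_norml; apply/andP; split; lra.
Qed.

Let mG : measurable_fun setT G. Proof. exact: lipschitz_measurable GL. Qed.

Let mpos : measurable_fun setT pospart.
Proof. exact: measurable_maxr. Qed.

Let mGpos (c : R) : measurable_fun setT (fun y : R => G (pospart (c * y))).
Proof. by apply: measurableT_comp mG _; apply: measurableT_comp mpos _; exact: measurable_funM. Qed.

Let mGposr (c : R) : measurable_fun setT (fun y : R => G (pospart (y / c))).
Proof. by apply: measurableT_comp mG _; apply: measurableT_comp mpos _; exact: measurable_funM. Qed.

Lemma integral_dist_le (m : probability R R) (f g h : R -> R) :
  measurable_fun setT f -> measurable_fun setT g -> measurable_fun setT h ->
  (forall x, 0 <= f x <= 1) -> (forall x, 0 <= g x <= 1) ->
  (forall x, 0 <= h x <= 1) -> (forall x, `|f x - g x| <= h x) ->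
  `|\int[m]_x f x - \int[m]_x g x| <= \int[m]_x h x.
Proof.
move=> mf mg mh f01 g01 h01 fgh.
have i_f := unit_bounded_integrable m mf f01.
have i_g := unit_bounded_integrable m mg g01.
have i_h := unit_bounded_integrable m mh h01.
rewrite -RintegralB//; apply: le_trans (le_normr_Rintegral _ _) _ => //.
  exact: (integrableB measurableT i_f i_g).
apply: le_Rintegral => //.
exact: (integrable_norm (integrableB measurableT i_f i_g)).
Qed.

(** With [x = s * t] one has [y / t = s * (y / x)], and (i) governs [y / x]. Replacing [s] by [c]
    costs at most L |s - c| |y / x|; capped at 1, this is a bounded continuous function, whose
    [mu]-integral is small for [s] near [c] without any moment assumption. *)
Lemma positive_state_limit (c : R) : 0 < c ->
  (forall g : R -> R, continuous g -> (forall x, 0 <= g x <= 1) ->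
    \int[pker_at k x]_y g (y / x) @[x --> +oo] --> \int[mu]_y g y) ->
  forall e : R, 0 < e -> exists2 r : R, 0 < r & exists t0 : R,
  forall t s, t0 <= t -> `|s - c| < r ->
  `|\int[pker_at k (s * t)]_y G (pospart (y / t)) -
    \int[mu]_y G (pospart (c * y))| < e.
Proof.
move=> c0 kmu e e0; have e4 : 0 < e / 4 by rewrite divr_gt0.
pose H (r v : R) := Num.min 1 (L * r * `|v|).
have H01 (r : R) v : 0 <= r -> 0 <= H r v <= 1.
  by move=> r0; rewrite /H le_min ler01 !mulr_ge0//= ge_min lexx.
have Hlip (r : R) (r0 : 0 <= r) x y : `|H r x - H r y| <= L * r * `|x - y|.
  have K0 : 0 <= L * r by rewrite mulr_ge0.
  have D : `|L * r * `|x| - L * r * `|y| | <= L * r * `|x - y|.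
    by rewrite -mulrBr normrM ger0_norm// ler_wpM2l// ler_dist_dist.
  apply: le_trans D; rewrite /H.
  move: (L * r * `|x|) (L * r * `|y|) => p q.
  have [p1|p1] := leP 1 p; have [q1|q1] := leP 1 q; rewrite ?subrr ?normr0//.
  - by rewrite !ger0_norm; lra.
  - by rewrite distrC [leRHS]distrC !ger0_norm; lra.
have mH (r : R) : 0 <= r -> measurable_fun setT (H r).
  by move=> r0; exact: lipschitz_measurable (Hlip r r0).
have [n Hn] : exists n : nat, \int[mu]_v H n.+1%:R^-1 v < e / 4.
  have cvgH : \int[mu]_v H n.+1%:R^-1 v @[n --> \oo] --> (0 : R).
    have [|//| | | |_ _] := @dominated_convergence _ _ _ mu setT measurableT
      (fun n v => (H n.+1%:R^-1 v)%:E) (fun=> 0%E) (cst 1%E).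
    - by move=> n; apply/measurable_EFinP; exact: mH.
    - apply: aeW => v _; apply: cvg_EFin; first exact: nearW.
      have : L * n.+1%:R^-1 * `|v| @[n --> \oo] --> L * 0 * `|v|.
        by apply: cvgMl; apply: cvgMr; exact: cvg_harmonic.
      rewrite mulr0 mul0r => cv.
      apply: (squeeze_cvgr _ (cvg_cst 0) cv); apply: nearW => n /=.
      by have /andP[-> _] := H01 n.+1%:R^-1 v (ltac:(by rewrite invr_ge0));
        rewrite /H ge_min lexx orbT.
    - exact: finite_measure_integrable_cst.
    - apply: aeW => v n _ /=; rewrite lee_fin.
      by have /andP[h0 h1] := H01 n.+1%:R^-1 v (ltac:(by rewrite invr_ge0)); rewrite ger0_norm.
    rewrite integral0; exact: fine_cvg.
  move: cvgH => /cvgrPdist_lt/(_ _ e4)[n _ /(_ n (leqnn _))/=].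
  rewrite sub0r normrN ger0_norm; first by move=> ?; exists n.
  by apply: Rintegral_ge0 => v _; have /andP[] := H01 n.+1%:R^-1 v (ltac:(by rewrite invr_ge0)).
pose r := n.+1%:R^-1 : R; have r0 : 0 < r by rewrite invr_gt0.
have /cvgrPdist_lt/(_ _ e4) C1 := kmu _ (lipschitz_cts (Hlip r (ltW r0)))
  (fun v => H01 r v (ltW r0)).
have Gc_lip x y : `|G (pospart (c * x)) - G (pospart (c * y))| <= L * c * `|x - y|.
  apply: le_trans (GL _ _) _; rewrite -mulrA ler_wpM2l//.
  by rewrite (le_trans (pospart_lip _ _))// -mulrBr normrM gtr0_norm.
have /cvgrPdist_lt/(_ _ e4) C2 := kmu _ (lipschitz_cts Gc_lip)
  (fun v => G01 (pospart (c * v))).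
have [x0 [_ xP]] : \forall x \near +oo,
    `|\int[mu]_y H r y - \int[pker_at k x]_y H r (y / x)| < e / 4 /\
    `|\int[mu]_y G (pospart (c * y)) -
      \int[pker_at k x]_y G (pospart (c * (y / x)))| < e / 4.
  by apply: filterS2 C1 C2.
(* The bound [c / 2] keeps [s] away from 0, so that [s * t] exceeds [x0] once [t] is large. *)
exists (Num.min r (c / 2)); first by rewrite lt_min r0 divr_gt0.
exists (Num.max 1 ((`|x0| + 1) / (c / 2))) => t s.
rewrite ge_max => /andP[t1 tx]; rewrite lt_min => /andP[sr sc].
have t0 : 0 < t by exact: lt_le_trans t1.
have sc2 : c / 2 < s by move: sc; rewrite ltr_norml => /andP[? ?]; lra.
have s0 : 0 < s by apply: lt_trans sc2; rewrite divr_gt0.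
have st : x0 < s * t.
  apply: (@lt_le_trans _ _ (c / 2 * t)); last by rewrite ler_wpM2r// ltW.
  rewrite -ltr_pdivrMl ?divr_gt0// mulrC; apply: lt_le_trans tx.
  by rewrite ltr_pM2r ?invr_gt0 ?divr_gt0// (le_lt_trans (ler_norm _))// ltrDl.
have [X1 X2] := xP _ st.
have E (y : R) : y / t = s * (y / (s * t)).
  by field; rewrite !gt_eqF.
have D : `|\int[pker_at k (s * t)]_y G (pospart (y / t)) -
    \int[pker_at k (s * t)]_y G (pospart (c * (y / (s * t))))| <=
    \int[pker_at k (s * t)]_y H r (y / (s * t)).
  apply: integral_dist_le => //.
  - apply: (measurableT_comp (mGpos c)); exact: measurable_funM.
  - apply: (measurableT_comp (mH r (ltW r0))); exact: measurable_funM.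
  - by move=> x; exact: H01 (ltW r0).
  - move=> x; rewrite /H le_min dist01/= E (le_trans (GL _ _))//.
    rewrite -mulrA ler_wpM2l// (le_trans (pospart_lip _ _))// -mulrBl normrM.
    by rewrite ler_wpM2r// ltW.
move: X1 X2 D Hn; rewrite -/r.
move: (\int[mu]_y H r y) (\int[pker_at k (s * t)]_y H r (y / (s * t))).
move: (Rintegral mu _ _) (Rintegral _ _ (fun y : R => G (pospart (y / t)))).
move: (Rintegral _ _ _).
move=> a1 a2 a3 a4 a5; rewrite !ltr_norml ler_norml.
move=> /andP[? ?] /andP[? ?] /andP[? ?] ?.
by apply/andP; split; lra.
Qed.

(** Outcomes with [y / t] at most [eta] move [G] by at most [L * eta]; the others have small mass by
    (ii). The choice of [eta] bounds [L * eta] by [e / 2], with [L + 1] in place of [L] to avoid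
    dividing by 0. *)
Lemma null_state_limit :
  (forall eta e : R, 0 < eta -> 0 < e -> exists2 delta : R, 0 < delta &
    exists x0 : R, forall x s, x0 <= x -> 0 <= s <= delta ->
    fine (k (s * x) [set y | eta < y / x]) < e) ->
  forall e : R, 0 < e -> exists2 r : R, 0 < r & exists t0 : R,
  forall t s, t0 <= t -> 0 <= s < r ->
  `|\int[pker_at k (s * t)]_y G (pospart (y / t)) - G 0| < e.
Proof.
move=> small e e0; pose eta := e / 2 / (L + 1).
have eta0 : 0 < eta by rewrite !divr_gt0// ltr_wpDl.
have [r r0 [x0 xP]] := small eta (e / 2) eta0 (divr_gt0 e0 (ltr0Sn R 1)).
exists r => //; exists x0 => t s tx /andP[s0 sr].
have {xP} := xP t s tx; rewrite s0 ltW// => /(_ isT).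
set A := [set y | _]; have mA : measurable A.
  rewrite (_ : A = (fun y => y / t) @^-1` `]eta, +oo[%classic).
    have mdiv : measurable_fun setT (fun y : R => y / t) by exact: measurable_funM.
    by rewrite -[X in measurable X]setTI; exact: mdiv.
  by apply/seteqP; split => y; rewrite /= in_itv/= andbT.
move=> kA; have mI : measurable_fun setT (\1_A : R -> R) by exact: measurable_indic.
set m := pker_at k (s * t) in kA *.
have iI : m.-integrable setT (EFin \o (\1_A : R -> R)).
  by apply: unit_bounded_integrable => // x; rewrite indicE; case: (_ \in _);
    rewrite /= ?lexx ?ler01.
have intI : \int[m]_y \1_A y = fine (k (s * t) A).
  by rewrite /Rintegral integral_indic// setIT.
have ic (x : R) : m.-integrable setT (EFin \o (fun _ : R => x)).
  exact: finite_measure_integrable_cst.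
have iG := unit_bounded_integrable m (mGposr t) (fun y => G01 (pospart (y / t))).
rewrite -[X in _ - X](Rintegral_prob_cst m) -RintegralB//.
have isub := integrableB measurableT iG (ic (G 0)).
apply: le_lt_trans (le_normr_Rintegral measurableT isub) _.
apply: (@le_lt_trans _ _ (\int[m]_y (L * eta + \1_A y))).
  apply: le_Rintegral => //.
  - exact: (integrable_norm isub).
  - exact: (integrableD measurableT (ic (L * eta)) iI).
  - move=> y _; rewrite indicE; have [yA|yA] := boolP (y \in A).
      by rewrite (le_trans (dist01 _ _))// lerDr mulr_ge0// ltW.
    rewrite addr0 (le_trans (GL _ _))// ler_wpM2l// subr0 ger0_norm ?pospart_ge0//.
    move: yA; rewrite notin_setE /A/= => /negP; rewrite -leNgt => ye.
    by rewrite /pospart ge_max ye ltW.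
rewrite RintegralD// Rintegral_prob_cst intI.
have : L * eta <= e / 2.
  rewrite /eta mulrCA ger_pMr ?divr_gt0// ler_pdivrMr ?mul1r ?ltr_wpDl//.
  by rewrite lerDl.
by move: kA; move: (fine _) (L * eta) => ? ?; lra.
Qed.

End one_dimensional_limits.

Section coordinate_update.
Context {V : finType} {R : realType}.
Implicit Types (x y : rvec V R) (b : V).

Definition vupd x b (r : R) : rvec V R := fun v => if v == b then r else x v.

Lemma vdist_vupd x y b r : vdist (vupd x b r) (vupd y b r) <= vdist x y.
Proof.
apply: ler_sum => v _; rewrite /vupd; case: ifP => // _.
by rewrite subrr normr0.
Qed.

Lemma vdist_vupdr x b (r s : R) : vdist (vupd x b r) (vupd x b s) = `|r - s|.
Proof.
rewrite /vdist (bigD1 b)//= /vupd eqxx big1 ?addr0// => v /negbTE ->.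
by rewrite subrr normr0.
Qed.

Lemma measurable_vupd d (T : measurableType d) (Z : T -> rvec V R)
    (Y : T -> R) b : measurable_fun setT Z -> measurable_fun setT Y ->
  measurable_fun setT (fun w => vupd (Z w) b (Y w)).
Proof.
move=> mZ mY; apply: measurable_rvec => v; rewrite /vupd.
case: (v == b) => //; exact: measurableT_comp (measurable_coord v) mZ.
Qed.

End coordinate_update.

Section edge_transition.
Context {V : finType} {R : realType} (k : R.-pker R ~> R) (mu : probability R R).
Variables (a b : V) (f : rvec V R -> R) (L : R).
Hypothesis L0 : 0 <= L.
Hypothesis f01 : forall x, 0 <= f x <= 1.
Hypothesis fL : vlipschitz L f.

Definition edge_step (t : R) (z : rvec V R) : R :=
  \int[pker_at k (pospart (z a) * t)]_y f (vupd z b (pospart (y / t))).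

Definition edge_limit (z : rvec V R) : R :=
  \int[mu]_y f (vupd z b (pospart (z a * y))).

Let mf : measurable_fun setT f.
Proof. by apply: continuous_rvec_measurable; exact: vlipschitz_continuous fL. Qed.

Let mfv d (T : measurableType d) (Z : T -> rvec V R) (Y : T -> R) :
  measurable_fun setT Z -> measurable_fun setT Y ->
  measurable_fun setT (fun w => f (vupd (Z w) b (pospart (Y w)))).
Proof.
move=> mZ mY; apply: measurableT_comp mf _; apply: measurable_vupd => //.
exact: measurable_maxr.
Qed.

Lemma Rintegral_unit d (T : measurableType d) (m : probability T R) (g : T -> R) :
  measurable_fun setT g -> (forall x, 0 <= g x <= 1) ->
  0 <= \int[m]_x g x <= 1.
Proof.
move=> mg g01; have ig := unit_bounded_integrable m mg g01.
rewrite Rintegral_ge0/=; last by move=> x _; have /andP[] := g01 x.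
rewrite -[leRHS](Rintegral_prob_cst m); apply: le_Rintegral => //.
  exact: finite_measure_integrable_cst.
by move=> x _; have /andP[] := g01 x.
Qed.

Lemma edge_step01 t z : 0 <= edge_step t z <= 1.
Proof.
apply: Rintegral_unit => //; apply: mfv; first exact: measurable_cst.
exact: measurable_funM.
Qed.

Lemma edge_limit01 z : 0 <= edge_limit z <= 1.
Proof.
apply: Rintegral_unit => //; apply: mfv; first exact: measurable_cst.
exact: measurable_funM.
Qed.

Lemma edge_stepE t z : (edge_step t z)%:E =
  (\int[k (pospart (z a) * t)%R]_y (f (vupd z b (pospart (y / t))))%:E)%E.
Proof.
rewrite /edge_step EFin_Rintegral//; apply: unit_bounded_integrable => //.
by apply: mfv; [exact: measurable_cst|exact: measurable_funM].
Qed.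

Lemma edge_limitE z : (edge_limit z)%:E =
  (\int[mu]_y (f (vupd z b (pospart (z a * y))))%:E)%E.
Proof.
rewrite /edge_limit EFin_Rintegral//; apply: unit_bounded_integrable => //.
by apply: mfv; [exact: measurable_cst|exact: measurable_funM].
Qed.

Lemma measurable_edge_step t : measurable_fun setT (edge_step t).
Proof.
apply/measurable_EFinP; rewrite (_ : _ \o _ = fun z =>
   \int[k (pospart (z a) * t)%R]_y (f (vupd z b (pospart (y / t))))%:E)%E; last first.
  by apply/funext => z /=; exact: edge_stepE.
have ma : measurable_fun setT (fun z : rvec V R => pospart (z a) * t).
  apply: measurable_funM => //.
  by apply: measurable_maxr => //; exact: measurable_coord.
apply: (@measurable_fun_integral_finite_kernel _ _ _ _ _
  (fun p : rvec V R * R => (f (vupd p.1 b (pospart (p.2 / t))))%:E)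
  (kernel_pullback k ma)) => //.
  by move=> p; rewrite lee_fin; have /andP[] := f01 (vupd p.1 b (pospart (p.2 / t))).
by apply/measurable_EFinP; apply: mfv => //; exact: measurable_funM.
Qed.

Lemma measurable_edge_limit : measurable_fun setT edge_limit.
Proof.
apply/measurable_EFinP; rewrite (_ : _ \o _ = fun z =>
   \int[mu]_y (f (vupd z b (pospart (z a * y))))%:E)%E; last first.
  by apply/funext => z /=; exact: edge_limitE.
apply: (@measurable_fun_fubini_tonelli_F _ _ _ _ _ mu
  (fun p : rvec V R * R => (f (vupd p.1 b (pospart (p.1 a * p.2))))%:E)).
- by apply/measurable_EFinP; apply: mfv => //; apply: measurable_funM => //;
    exact: measurableT_comp (measurable_coord a) _.
- by move=> p; rewrite lee_fin; have /andP[] := f01 (vupd p.1 b (pospart (p.1 a * p.2))).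
Qed.

Let slice_lip z r s : `|f (vupd z b r) - f (vupd z b s)| <= L * `|r - s|.
Proof. by rewrite (le_trans (fL _ _))// vdist_vupdr. Qed.

(** Only the argument of [f] moves from [y] to [z]; the kernel state stays at [y a], since at fixed
    [t] no regularity in the state is assumed. *)
Let edge_step_shift t y z : `|edge_step t y -
  \int[pker_at k (pospart (y a) * t)]_w f (vupd z b (pospart (w / t)))| <=
  L * vdist z y.
Proof.
set m := pker_at _ _.
have md : measurable_fun setT (fun w : R => w / t) by exact: measurable_funM.
have i1 : m.-integrable setT (EFin \o (fun w => f (vupd y b (pospart (w / t))))).
  by apply: unit_bounded_integrable => //; apply: mfv => //; exact: measurable_cst.
have i2 : m.-integrable setT (EFin \o (fun w => f (vupd z b (pospart (w / t))))).
  by apply: unit_bounded_integrable => //; apply: mfv => //; exact: measurable_cst.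
rewrite /edge_step -/m -RintegralB//.
apply: le_trans (le_normr_Rintegral measurableT (integrableB measurableT i1 i2)) _.
rewrite -[leRHS](Rintegral_prob_cst m); apply: le_Rintegral => //.
- exact: (integrable_norm (integrableB measurableT i1 i2)).
- exact: finite_measure_integrable_cst.
- move=> w _; rewrite (le_trans (fL _ _))// ler_wpM2l// vdistC.
  by rewrite (le_trans (vdist_vupd _ _ _ _))// vdistC.
Qed.

Lemma edge_step_cvg (z : rvec V R) :
  (forall g : R -> R, continuous g -> (forall x, 0 <= g x <= 1) ->
    \int[pker_at k x]_y g (y / x) @[x --> +oo] --> \int[mu]_y g y) ->
  0 <= z a ->
  (z a = 0 ->
    forall eta e : R, 0 < eta -> 0 < e -> exists2 delta : R, 0 < delta &
    exists x0 : R, forall x s, x0 <= x -> 0 <= s <= delta ->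
    fine (k (s * x) [set y | eta < y / x]) < e) ->
  forall e : R, 0 < e -> exists2 r : R, 0 < r & exists t0 : R,
    forall t y, t0 <= t -> vdist z y < r -> `|edge_step t y - edge_limit z| < e.
Proof.
move=> kmu za0 small e e0; have e2 : 0 < e / 2 by rewrite divr_gt0.
suff [r r0 [t0 H]] : exists2 r : R, 0 < r & exists t0 : R, forall t s, t0 <= t ->
    0 <= s -> `|s - z a| < r ->
    `|\int[pker_at k (s * t)]_w f (vupd z b (pospart (w / t))) - edge_limit z|
    < e / 2.
  exists (Num.min r (e / 2 / (L + 1))).
    by rewrite lt_min r0 divr_gt0// ltr_wpDl.
  exists t0 => t y tt; rewrite lt_min => /andP[yr yL].
  rewrite (splitr e) -(subrKA (\int[pker_at k (pospart (y a) * t)]_w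
    f (vupd z b (pospart (w / t))))).
  apply: le_lt_trans (ler_normD _ _) _; rewrite ltrD//.
    apply: le_lt_trans (edge_step_shift t y z) _.
    move: yL; rewrite ltr_pdivlMr ?ltr_wpDl//; apply: le_lt_trans.
    by rewrite mulrC ler_wpM2l ?vdist_ge0// lerDl.
  apply: H => //; first exact: pospart_ge0.
  rewrite -[X in _ - X](pospart_id za0) (le_lt_trans (pospart_lip _ _))//.
  by rewrite distrC (le_lt_trans (le_coord_vdist _ _ _)).
pose G r := f (vupd z b r).
have G01 x : 0 <= G x <= 1 by exact: f01.
have GL x y : `|G x - G y| <= L * `|x - y| by exact: slice_lip.
have [za|za] := ltP 0 (z a).
  have [r r0 [t0 H]] := positive_state_limit L0 G01 GL za kmu e2.
  by exists r => //; exists t0 => t s tt _ sr; exact: H.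
have {}za : z a = 0 by apply/eqP; rewrite eq_le za.
have [r r0 [t0 H]] := null_state_limit L0 G01 GL (small za) e2.
exists r => //; exists t0 => t s tt s0 sr.
have -> : edge_limit z = G 0.
  rewrite /edge_limit za -[RHS](Rintegral_prob_cst mu).
  by apply: eq_Rintegral => y _; rewrite mul0r pospart_id.
apply: H => //; rewrite s0/=; move: sr; rewrite za subr0.
exact: le_lt_trans (ler_norm _).
Qed.

End edge_transition.

(** * Induction along the tree *)

Section restriction_integral.
Local Open Scope ereal_scope.
Context d (T : measurableType d) (R : realType).

Lemma ge0_integral_mrestr (m : {measure set T -> \bar R}) (D : set T)
    (mD : measurable D) (h : T -> \bar R) : measurable_fun setT h ->
  (forall x, 0 <= h x) -> \int[mrestr m mD]_x h x = \int[m]_(x in D) h x.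
Proof.
move=> mh h0.
have mI : measurable_fun setT (\1_D : T -> R) by exact: measurable_indic.
have I0 x : (0 <= (\1_D x : R))%R by rewrite indicE.
transitivity (\int[density_measure m mI I0]_x h x).
  apply: eq_measure_integral => A mA _.
  by rewrite density_measureE integral_indic// setIC.
rewrite ge0_integral_density// [RHS]integral_mkcond; apply: eq_integral => x _.
by rewrite patchE indicE; case: (x \in D); rewrite ?mul1e ?mul0e.
Qed.

Context (P : probability T R) (Z : {RV P >-> R}) (t : R).
Hypothesis Pt : 0 < P [set w | (t < Z w)%R].

Let p := fine (P [set w | (t < Z w)%R]).

Let p_gt0 : (0 < p)%R.
Proof.
apply: fine_gt0; rewrite Pt/= (le_lt_trans _ (ltry 1))//.
by apply: probability_le1; exact: measurable_gt.
Qed.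

Let pE : P [set w | (t < Z w)%R] = p%:E.
Proof.
rewrite /p fineK// ge0_fin_numE// (le_lt_trans _ (ltry 1))//.
by apply: probability_le1; exact: measurable_gt.
Qed.

(** [Pt] excludes the case in which the normalisation falls back to [P] itself. *)
Lemma cond_gtE A : cond_gt Z t A = P (A `&` [set w | (t < Z w)%R]) * p^-1%:E.
Proof.
rewrite /cond_gt /= /mnormalize /= /mrestr setTI pE.
by rewrite eqe gt_eqF//= .
Qed.

Lemma ge0_integral_cond_gt (h : T -> \bar R) : measurable_fun setT h ->
  (forall x, 0 <= h x) ->
  \int[cond_gt Z t]_w h w =
  p^-1%:E * \int[P]_(w in [set w | (t < Z w)%R]) h w.
Proof.
move=> mh h0; have q0 : (0 <= p^-1)%R by rewrite invr_ge0 ltW.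
rewrite -(ge0_integral_mrestr P (measurable_gt Z t))//.
rewrite -(ge0_integral_mscale _ measurableT (NngNum q0))//.
apply: eq_measure_integral => A mA _.
by rewrite [LHS]cond_gtE muleC.
Qed.

End restriction_integral.

Section tree_products.
Context d (T : measurableType d) (R : realType) (P : probability T R).
Context (V : finType) (E : rel V) (M : V * V -> {RV P >-> R}).
Hypothesis treeE : undirected_tree E.

Lemma tree_path_from u v e : e \in tree_path E u v -> e \in edges_from E u.
Proof.
pose Q (W : {set V}) := forall v e, v \in W -> e \in tree_path E u v ->
  e \in edges_from E u.
suff H : Q [set: V]%SET by apply: H; rewrite inE.
have spu : simple_path E u u [::] by rewrite /simple_path/= eqxx.
apply: (@tree_growth_ind _ _ treeE u Q) => [{}v {}e|W a b uW cW pW aW bW ab IH {}v {}e].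
  by rewrite inE => /eqP ->; rewrite (tree_pathE treeE spu) => /path_edgesP[].
rewrite inE inE => /predU1P[->|]; last exact: IH.
rewrite (tree_path_extend treeE cW aW bW ab uW) finset.inE finset.inE.
move=> /predU1P[->|]; last exact: IH.
exact: (edge_from treeE cW aW bW ab uW).
Qed.

Lemma tree_productE u w v :
  tree_product E M u w v = \prod_(e in tree_path E u v) M e w.
Proof.
rewrite /tree_product; case: eqP => // ->.
have spu : simple_path E u u [::] by rewrite /simple_path/= eqxx.
by rewrite (tree_pathE treeE spu) big1// => e /path_edgesP[].
Qed.

Lemma tree_product_root u w : tree_product E M u w u = 1.
Proof. by rewrite /tree_product eqxx. Qed.

Lemma tree_product_ge0 u w v :
  (forall e, e \in edges_from E u -> 0 <= M e w) -> 0 <= tree_product E M u w v.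
Proof.
move=> M0; rewrite tree_productE; apply: prodr_ge0 => e /tree_path_from.
exact: M0.
Qed.

End tree_products.

Lemma measurable_coord_gt (V : finType) (R : realType) (u : V) (e : R) :
  measurable [set x : rvec V R | e < x u].
Proof.
rewrite (_ : [set _ | _] = (fun x : rvec V R => x u) @^-1` `]e, +oo[).
  by rewrite -[X in measurable X]setTI; exact: measurable_coord.
by apply/seteqP; split => x; rewrite /= in_itv/= andbT.
Qed.

Section rooted_induction.
Context (R : realType) d (T : measurableType d) (P : probability T R).
Context (V : finType) (E : rel V) (X : V -> {RV P >-> R}) (u : V).
Context (kappa : V * V -> R.-pker R ~> R) (mu : V * V -> probability R R).
Context d' (T' : measurableType d') (P' : probability T' R).
Context (M : V * V -> {RV P' >-> R}) (Pa : probability R R) (alpha : R).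

Hypothesis X_ge0 : forall v w, 0 <= X v w.
Hypothesis treeE : undirected_tree E.
Hypothesis markovE : global_markov E X.
Hypothesis alpha_gt0 : 0 < alpha.
Hypothesis Pa_pareto : is_pareto alpha Pa.
Hypothesis X_pos : \forall t \near +oo, (0 < P [set w | (t < X u w)%R])%E.
Hypothesis X_tail : forall l, 1 <= l ->
  fine (cond_gt (X u) t [set w | l < X u w / t]) @[t --> +oo] --> l `^ (- alpha).

Let J := edges_from E u.
Hypothesis kappa_version : forall e, e \in J ->
  cond_distr_version (X e.1) (X e.2) (kappa e).
Hypothesis kappa_cvg : forall e, e \in J -> forall g : R -> R, continuous g ->
  (forall x, 0 <= g x <= 1) ->
  \int[pker_at (kappa e) x]_y g (y / x) @[x --> +oo] --> \int[mu e]_y g y.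
Hypothesis kappa_small : forall e ebar, e \in J ->
  ebar \in tree_path E u e.1 -> (0 < mu ebar [set 0%R])%E ->
  forall eta eps : R, 0 < eta -> 0 < eps -> exists2 delta : R, 0 < delta &
    exists x0 : R, forall x s, x0 <= x -> 0 <= s <= delta ->
    fine (kappa e (s * x) [set y | eta < y / x]) < eps.
Hypothesis M_ge0 : forall e w, e \in J -> 0 <= M e w.
Hypothesis M_indep : mutually_independent J M.
Hypothesis M_law : forall e, e \in J ->
  forall B : set R, measurable B -> distribution P' (M e) B = mu e B.

Let Theta := tree_product E M u.
Let law_Theta : probability (rvec V R) R := distribution P' (tree_product E M u).
(** The limit is kept in polar form, radius times direction; the limit law of [X / t] is its image
    under [scale_vec]. *)
Let lim : probability (R * rvec V R)%type R := (Pa \x law_Theta)%E.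

Let mscaled t : measurable_fun setT (scaled_vec X t).
Proof. exact: measurable_funPT. Qed.

Let mscale_vec : measurable_fun setT (@scale_vec V R).
Proof. exact: measurable_funPT. Qed.

(** Brings integrals under the limit law back to the space carrying the [M_e], where their
    independence can be used. *)
Lemma ge0_integral_limit (h : R * rvec V R -> \bar R) :
  measurable_fun setT h -> (forall p, 0 <= h p)%E ->
  (\int[lim]_p h p = \int[Pa]_z \int[P']_w h (z, Theta w))%E.
Proof.
move=> mh h0; rewrite /lim fubini_tonelli1//; apply: eq_integral => z _.
rewrite /fubini_F ge0_integral_pushforward//.
exact: measurableT_comp (pair1_measurable z).
Qed.

Lemma measurable_inner (h : R * rvec V R -> \bar R) :
  measurable_fun setT h -> (forall p, 0 <= h p)%E ->
  measurable_fun setT (fun z => \int[P']_w h (z, Theta w))%E.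
Proof.
move=> mh h0; apply: (@measurable_fun_fubini_tonelli_F _ _ _ _ _ P'
  (fun q : R * T' => h (q.1, Theta q.2))) => //.
apply: measurableT_comp mh _; apply: measurable_fun_pair => //.
by apply: measurableT_comp measurable_snd; exact: measurable_funPT.
Qed.

Lemma Pa_gt1 : {ae Pa, forall z : R, 1 < z}.
Proof.
have P1 : Pa `]1, +oo[%classic = 1%E by rewrite Pa_pareto// powR1.
exists (~` `]1, +oo[%classic); split.
- exact: measurableC.
- by rewrite probability_setC// [Z in (_ - Z)%E]P1 subee.
- by move=> z /= z1; rewrite in_itv/= andbT.
Qed.

Section step.
Variables (W : {set V}) (a b : V).
Hypotheses (uW : u \in W) (cW : tree_connected E W).
Hypothesis pW : forall v e, v \in W -> e \in tree_path E u v ->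
  e \in edges_from E u /\ e.2 \in W.
Hypotheses (aW : a \in W) (bW : b \notin W) (ab : E a b).
Variables (f : rvec V R -> R) (L : R).
Hypothesis L0 : 0 <= L.
Hypothesis f01 : forall x, 0 <= f x <= 1.
Hypothesis fL : vlipschitz L f.

Let e0 := (a, b).
Let e0J : e0 \in J. Proof. exact: (edge_from treeE cW aW bW ab uW). Qed.

Let mf : measurable_fun setT f.
Proof. by apply: continuous_rvec_measurable; exact: vlipschitz_continuous fL. Qed.

Let f0 x : (0 <= (f x)%:E)%E.
Proof. by rewrite lee_fin; have /andP[] := f01 x. Qed.

Lemma vproj_extend (x : rvec V R) (r : R) : 0 <= x b -> r = x b ->
  vproj (b |: W)%SET x = vupd (vproj W x) b (pospart r).
Proof.
move=> xb ->; apply/funext => v; rewrite /vproj /vupd !inE.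
by case: eqVneq => [->|//]; rewrite pospart_id.
Qed.

(** The conditioning event concerns [X u] with [u] in [W], so its indicator can be absorbed into the
    function given to [markov_kernel_integral]; hence the identity is proved before normalising. *)
Lemma prelimit_step t : 0 < t ->
  (\int[P]_(w in [set w | (t < X u w)%R]) (f (vproj (b |: W)%SET (scaled_vec X t w)))%:E =
   \int[P]_(w in [set w | (t < X u w)%R])
     (edge_step (kappa e0) a b f t (vproj W (scaled_vec X t w)))%:E)%E.
Proof.
move=> t0.
pose sc (x : rvec V R) : rvec V R := fun v => x v / t.
have msc : measurable_fun setT sc.
  by apply: measurable_rvec => v; apply: measurable_funM => //; exact: measurable_coord.
have scE w : sc (vproj W (vec_of X w)) = vproj W (scaled_vec X t w).
  apply/funext => v; rewrite /sc /vproj /vec_of /scaled_vec.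
  by case: (v \in W) => //; rewrite mul0r.
pose I (x : rvec V R) : R := \1_(`]t, +oo[%classic) (x u).
have mI : measurable_fun setT I.
  apply: measurableT_comp (measurable_coord u); exact: measurable_indic.
have IE w : I (vproj W (vec_of X w)) = \1_[set w | t < X u w] w.
  rewrite /I /vproj uW /vec_of !indicE; congr (_%:R); congr nat_of_bool.
  by apply/idP/idP; rewrite !inE /= in_itv/= andbT.
pose h (p : rvec V R * R) : \bar R :=
  ((I p.1)%:E * (f (vupd (sc p.1) b (pospart (p.2 / t))))%:E)%E.
have mh : measurable_fun setT h.
  apply: emeasurable_funM.
    by apply/measurable_EFinP; exact: measurableT_comp mI measurable_fst.
  apply/measurable_EFinP; apply: measurableT_comp mf _; apply: measurable_vupd.
    exact: measurableT_comp msc measurable_fst.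
  apply: measurable_maxr => //; apply: measurable_funM => //.
have h0 p : (0 <= h p)%E by rewrite mule_ge0// lee_fin.
have := @markov_kernel_integral _ _ _ P V X W a b (kappa e0) h aW.
move=> /(_ _ _ mh h0) => mki.
have {}mki : (\int[P]_w h (vproj W (vec_of X w), X b w) =
    \int[P]_w \int[kappa e0 (X a w)]_y h (vproj W (vec_of X w), y))%E.
  apply: mki; last exact: kappa_version e0J.
  move=> Wa; apply: markovE => //.
  - by apply/set0Pn; exists b; rewrite inE.
  - by apply/set0Pn; exists a; rewrite inE.
  - by rewrite fintype.disjoint_sym finset.disjoints1 !inE negb_and bW orbT.
  - by rewrite fintype.disjoint_sym finset.disjoints1 !inE eqxx.
  - by rewrite finset.disjoints1 inE; apply: contraNneq bW => ->.
  - exact: (separates_extension treeE cW aW bW ab).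
rewrite integral_mkcond [RHS]integral_mkcond.
transitivity (\int[P]_w h (vproj W (vec_of X w), X b w))%E.
  apply: eq_integral => w _; rewrite /h /= IE scE patchE indicE.
  rewrite -vproj_extend//; last by rewrite /scaled_vec divr_ge0// ltW.
  by case: (w \in _); rewrite ?mul1e ?mul0e.
rewrite mki; apply: eq_integral => w _; rewrite /h /= IE patchE indicE.
case: (w \in _); last by apply: integral0_eq => y _; rewrite mul0e.
rewrite (edge_stepE _ _ _ f01 fL); have -> : pospart (vproj W (scaled_vec X t w) a) * t = X a w.
  rewrite /vproj aW /scaled_vec pospart_id ?divr_ge0 ?(ltW t0)//.
  by rewrite divfK// gt_eqF.
by apply: eq_integral => y _; rewrite mul1e scE.
Qed.

(** For almost every radius, the entry at [b] is the entry at [a] times [M_(a, b)], which is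
    independent of all entries in [W]; integrating this factor out produces [edge_limit]. *)
Lemma limit_step :
  \int[lim]_p f (vproj (b |: W)%SET (scale_vec p)) =
  \int[lim]_p edge_limit (mu e0) a b f (vproj W (scale_vec p)).
Proof.
rewrite /Rintegral; congr fine.
have mL : measurable_fun setT (fun p =>
    (f (vproj (b |: W)%SET (scale_vec p)))%:E).
  apply/measurable_EFinP; apply: measurableT_comp mf _.
  exact: measurable_vproj mscale_vec.
have mRR : measurable_fun setT (fun p =>
    (edge_limit (mu e0) a b f (vproj W (scale_vec p)))%:E).
  apply/measurable_EFinP.
  apply: measurableT_comp (measurable_edge_limit (mu e0) a b f01 fL) _.
  exact: measurable_vproj mscale_vec.
have l0 p : (0 <= (edge_limit (mu e0) a b f (vproj W (scale_vec p)))%:E)%E.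
  rewrite lee_fin.
  by have /andP[] := edge_limit01 (mu e0) a b f01 fL (vproj W (scale_vec p)).
rewrite (ge0_integral_limit mL (fun p => f0 _)) (ge0_integral_limit mRR l0).
apply: ge0_ae_eq_integral => //.
- exact: (measurable_inner mL (fun p => f0 _)).
- exact: (measurable_inner mRR l0).
- by move=> z _; exact: integral_ge0.
- by move=> z _; exact: integral_ge0.
apply: filterS Pa_gt1 => z z1 _; have z0 : 0 < z := lt_trans ltr01 z1.
pose sc (x : rvec V R) : rvec V R := fun v => z * x v.
have msc : measurable_fun setT sc.
  by apply: measurable_rvec => v; apply: measurable_funM => //; exact: measurable_coord.
pose h (p : rvec V R * R) : \bar R :=
  (f (vupd (sc p.1) b (pospart (z * p.1 a * p.2))))%:E.
have mh : measurable_fun setT h.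
  apply/measurable_EFinP; apply: measurableT_comp mf _; apply: measurable_vupd.
    exact: measurableT_comp msc measurable_fst.
  apply: measurable_maxr => //; apply: measurable_funM => //.
  apply: measurable_funM => //; exact: measurableT_comp (measurable_coord a) measurable_fst.
transitivity (\int[P']_w h (vproj W (Theta w), M e0 w))%E.
  apply: eq_integral => w _; rewrite /h /=; congr (f _)%:E.
  have Th0 v : 0 <= Theta w v.
    by apply: tree_product_ge0 => // e; exact: M_ge0.
  rewrite (@vproj_extend _ (z * vproj W (Theta w) a * M e0 w)).
  - congr vupd; apply/funext => v; rewrite /vproj /sc /scale_vec/=.
    by case: (v \in W); rewrite ?mulr0.
  - by rewrite /scale_vec /= mulr_ge0// ltW.
  - rewrite /scale_vec /= /vproj aW -mulrA; congr (_ * _).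
    rewrite /Theta !tree_productE// (tree_path_extend treeE cW aW bW ab uW).
    have nin : (a, b) \notin tree_path E u a.
      by apply/negP => H; have [_] := pW aW H; rewrite /= (negbTE bW).
    by rewrite mulrC (big_setU1 _ nin).
rewrite (ge0_integral_tree_product M_indep e0J (M_law e0J))//.
apply: eq_integral => w _; rewrite (edge_limitE _ _ _ f01 fL).
apply: eq_integral => y _; rewrite /h /=; congr (f _)%:E.
congr vupd; last by rewrite /vproj aW.
apply/funext => v; rewrite /vproj /sc /scale_vec/=.
by case: (v \in W); rewrite ?mulr0.
by move=> p; exact: f0.
Qed.

End step.

(** A null set in one factor gives a null cylinder in the product. Both factors are treated together
    because a positive radius is always needed along with a property of the direction. *)
Lemma ae_limit (Q : set (rvec V R)) : measurable Q ->
  {ae P', forall w, Q (Theta w)} -> {ae lim, forall p, 1 < p.1 /\ Q p.2}.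
Proof.
move=> mQ QTheta.
have m1 : measurable [set z : R | 1 < z].
  rewrite (_ : mkset _ = `]1, +oo[%classic) //.
  by apply/seteqP; split => z; rewrite /= in_itv/= andbT.
have n1 : lim.-negligible (~` [set z : R | 1 < z] `*` setT).
  exists (~` [set z : R | 1 < z] `*` setT); split => //.
    by apply: measurableX => //; exact: measurableC.
  rewrite [LHS]product_measure1E//; last exact: measurableC.
  have Pa0 : Pa (~` [set z : R | 1 < z]) = 0%E.
    by apply: measure_negligible Pa_gt1; exact: measurableC.
  by rewrite [x in (x * _)%E]Pa0 mul0e.
have n2 : lim.-negligible (setT `*` ~` Q).
  exists (setT `*` ~` Q); split => //.
    by apply: measurableX => //; exact: measurableC.
  rewrite [LHS]product_measure1E//; last exact: measurableC.
  have Q0 : law_Theta (~` Q) = 0%E.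
    have mTQ : measurable (Theta @^-1` (~` Q)).
      have mT : measurable_fun setT Theta by exact: measurable_funPT.
      by rewrite -[Z in measurable Z]setTI; apply: mT => //; exact: measurableC.
    exact: (measure_negligible mTQ QTheta).
  by rewrite [x in (_ * x)%E]Q0 mule0.
have := negligibleU n1 n2; apply: negligibleS => p /= np.
have [p0|p0] := pselect (1 < p.1); last by left.
by right; split => // Qp; apply: np.
Qed.

Let mcoord0 (a : V) : measurable [set x : rvec V R | 0 <= x a].
Proof.
rewrite (_ : mkset _ = (fun x => x a) @^-1` `[0, +oo[%classic).
  by rewrite -[Z in measurable Z]setTI; exact: measurable_coord.
by apply/seteqP; split => z; rewrite /= in_itv/= andbT.
Qed.

Let Theta_ge0 w v : 0 <= Theta w v.
Proof. by apply: tree_product_ge0 => // e; exact: M_ge0. Qed.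

(** A finite product of nonnegative factors, none of which has an atom at 0. *)
Lemma Theta_gt0 a : (forall e, e \in tree_path E u a -> mu e [set 0%R] = 0%E) ->
  {ae P', forall w, 0 < Theta w a}.
Proof.
move=> mu0.
have H (e : V * V) : {ae P', forall w, e \in tree_path E u a -> 0 < M e w}.
  have [ea|ea] := boolP (e \in tree_path E u a); last exact: nearW.
  have eJ : e \in J by exact: tree_path_from ea.
  exists (M e @^-1` [set 0]); split.
  - by apply: measurable_funPTI.
  - by have := M_law eJ (measurable_set1 0); rewrite mu0.
  - move=> w /= Mw; apply/eqP; apply: contra_notT Mw => Mw _.
    by rewrite lt_neqAle eq_sym Mw M_ge0.
apply: filterS (filter_forall (F := almost_everywhere P') _ H) => w Mw.
by rewrite /Theta tree_productE// prodr_gt0// => e ea; exact: Mw.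
Qed.

(** Base of the induction: only [X u / t] is involved, whose conditional tails converge to the
    Pareto tails. *)
Lemma scaled_limit_root (f : rvec V R -> R) (L : R) : 0 <= L ->
  (forall x, 0 <= f x <= 1) -> vlipschitz L f ->
  \int[cond_gt (X u) t]_w f (vproj [set u]%SET (scaled_vec X t w)) @[t --> +oo] -->
  \int[lim]_p f (vproj [set u]%SET (scale_vec p)).
Proof.
move=> L0 f01 fL; pose g (r : R) := f (vupd (fun=> 0) u r).
have gE x : f (vproj [set u]%SET x) = g (x u).
  rewrite /g; congr f; apply/funext => v; rewrite /vproj /vupd inE.
  by case: eqVneq => [->|].
have gL x y : `|g x - g y| <= L * `|x - y|.
  by rewrite (le_trans (fL _ _))// vdist_vupdr.
have g01 x : 0 <= g x <= 1 by exact: f01.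
have mg := lipschitz_measurable gL.
have -> : \int[lim]_p f (vproj [set u]%SET (scale_vec p)) = \int[Pa]_y g y.
  rewrite /Rintegral; congr fine; under eq_integral do rewrite gE.
  rewrite ge0_integral_limit; last 2 first.
  - apply/measurable_EFinP; apply: measurableT_comp mg _.
    exact: measurableT_comp (measurable_coord u) mscale_vec.
  - by move=> p; rewrite lee_fin; have /andP[] := g01 (scale_vec p u).
  apply: eq_integral => z _.
  rewrite (_ : (fun w => _) = cst (g z)%:E); last first.
    by apply/funext => w; rewrite /scale_vec/= /Theta tree_product_root mulr1.
  by rewrite integral_cst// [Z in (_ * Z)%E]probability_setT mule1.
under eq_fun do under eq_Rintegral do rewrite gE.
apply: (pareto_cvg alpha_gt0 Pa_pareto _ X_tail L0 g01 gL) => t.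
exact: measurable_funM.
Qed.

Theorem scaled_limit_lipschitz (f : rvec V R -> R) (L : R) :
  (forall x, 0 <= f x <= 1) -> vlipschitz L f ->
  \int[cond_gt (X u) t]_w f (scaled_vec X t w) @[t --> +oo] -->
  \int[lim]_p f (scale_vec p).
Proof.
(* All Lipschitz functions are treated at once: the extended mapping theorem needs the full weak
   limit on [W], not the limit for one function. *)
pose Q (W : {set V}) := forall (f : rvec V R -> R) (L : R),
  (forall x, 0 <= f x <= 1) -> vlipschitz L f ->
  \int[cond_gt (X u) t]_w f (vproj W (scaled_vec X t w)) @[t --> +oo] -->
  \int[lim]_p f (vproj W (scale_vec p)).
suff QT : Q [set: V]%SET.
  have vprojT x : vproj [set: V]%SET x = x :> rvec V R.
    by apply/funext => v; rewrite /vproj inE.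
  move=> f01 fL; have := QT f L f01 fL.
  under eq_fun do under eq_Rintegral do rewrite vprojT.
  by under [Z in _ --> Z -> _]eq_Rintegral do rewrite vprojT.
have lipW (g : rvec V R -> R) K : vlipschitz K g -> vlipschitz `|K| g.
  move=> gK x y; rewrite (le_trans (gK _ _))// ler_wpM2r ?vdist_ge0//.
  exact: ler_norm.
apply: (@tree_growth_ind _ _ treeE u Q) => [{}f {}L f01 fL|].
  exact: scaled_limit_root (normr_ge0 L) f01 (lipW _ _ fL).
move=> W a b uW cW pW aW bW ab IH {}f {}L f01 {}/lipW fL.
have e0J : (a, b) \in J by exact: (edge_from treeE cW aW bW ab uW).
have mf : measurable_fun setT f.
  by apply: continuous_rvec_measurable; exact: vlipschitz_continuous fL.
have L0 := normr_ge0 L.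
have mZ_ t : measurable_fun setT (fun w => vproj W (scaled_vec X t w)).
  exact: measurable_vproj.
have mZ : measurable_fun setT (fun p => vproj W (@scale_vec V R p)).
  exact: measurable_vproj.
have mstep t := measurable_edge_step (kappa (a, b)) a b f01 fL t.
have mlim := measurable_edge_limit (mu (a, b)) a b f01 fL.
rewrite (limit_step uW cW pW aW bW ab f01 fL).
apply: cvg_trans (_ : \int[cond_gt (X u) t]_w edge_step (kappa (a, b)) a b f t
  (vproj W (scaled_vec X t w)) @[t --> +oo] --> _).
  apply: near_eq_cvg; near=> t.
  have t0 : 0 < t by [].
  have Pt : (0 < P [set w | (t < X u w)%R])%E by near: t.
  rewrite /Rintegral; congr fine; rewrite !ge0_integral_cond_gt//.
  - by congr (_ * _)%E; rewrite (prelimit_step uW cW aW bW ab f01 fL t0).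
  - by apply/measurable_EFinP; apply: measurableT_comp mf _; exact: measurable_vproj.
  - by move=> w; rewrite lee_fin; have /andP[] := f01 (vproj (b |: W)%SET (scaled_vec X t w)).
  - by apply/measurable_EFinP; exact: measurableT_comp (mstep t) (mZ_ t).
  - move=> w; rewrite lee_fin.
    by have /andP[] := edge_step01 (kappa (a, b)) a b f01 fL t (vproj W (scaled_vec X t w)).
apply: (@continuous_convergence_Rintegral V R _ _ _ _ (fun t => cond_gt (X u) t)
  (fun t w => vproj W (scaled_vec X t w)) lim (fun p => vproj W (scale_vec p))
  (edge_step (kappa (a, b)) a b f) (edge_limit (mu (a, b)) a b f)) => //.
- by move=> t x; exact: edge_step01.
- by move=> x; exact: edge_limit01 f01 fL _.
- by move=> t; exact: measurableT_comp (mstep t) (mZ_ t).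
- exact: measurableT_comp mlim mZ.
have zaE p : vproj W (scale_vec p) a = p.1 * p.2 a.
  by rewrite /vproj aW.
(* An atom at 0 on the path to [a] is what makes (ii) available at [(a, b)]. Without one, [Theta] is
   almost surely positive at [a], so [z a = 0] is excluded outside a null set. *)
have [[ebar [ea eb0]]|nosmall] := pselect (exists ebar,
    ebar \in tree_path E u a /\ (0 < mu ebar [set 0%R])%E).
  have Theta0 : {ae P', forall w, [set x : rvec V R | 0 <= x a] (Theta w)}.
    by apply: aeW => w; exact: Theta_ge0.
  apply: filterS (ae_limit (mcoord0 a) Theta0) => p [/(lt_trans ltr01) p1 p2].
  apply: (@edge_step_cvg V R (kappa (a, b)) (mu (a, b)) a b f _ L0 f01 fL
    (vproj W (scale_vec p))) => //.
  - exact: kappa_cvg.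
  - by rewrite zaE mulr_ge0// ltW.
  - by move=> _; exact: kappa_small e0J ea eb0.
have mu0 e : e \in tree_path E u a -> mu e [set 0%R] = 0%E.
  move=> ea; apply/eqP; rewrite eq_le measure_ge0 andbT leNgt.
  by apply/negP => e0; apply: nosmall; exists e.
apply: filterS (ae_limit (measurable_coord_gt a 0) (Theta_gt0 mu0)) => p [/(lt_trans ltr01) p1 p2].
apply: (@edge_step_cvg V R (kappa (a, b)) (mu (a, b)) a b f _ L0 f01 fL
    (vproj W (scale_vec p))) => //.
- exact: kappa_cvg.
- by rewrite zaE mulr_ge0// ltW.
- by move=> /eqP; rewrite zaE mulf_eq0 !gt_eqF.
Unshelve. all: by end_near. Qed.

End rooted_induction.

(** * Weak convergence of the scaled and polar vectors *)

Section rvec_continuity.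
Context {V : finType} {R : realType}.

Lemma cvg_to_rvec (S : Type) (F : set_system S) (FF : Filter F)
    (phi : S -> rvec V R) (x : rvec V R) :
  (forall v, phi s v @[s --> F] --> x v) -> phi @ F --> x.
Proof.
move=> cv A /nbhs_rvecP[e e0 eA].
(* The successor leaves strict slack in the sum over [V], and is nonzero even if [V] is empty. *)
have e1 : 0 < e / (#|V|.+1)%:R by rewrite divr_gt0.
have H v : \forall s \near F, `|x v - phi s v| < e / (#|V|.+1)%:R.
  by move: (cv v) => /cvgrPdist_lt; apply.
apply: filterS (filter_forall FF H) => s Hs; apply: eA.
apply: (@le_lt_trans _ _ (\sum_(v : V) e / (#|V|.+1)%:R)).
  by apply: ler_sum => v _; exact: ltW.
by rewrite sumr_const -[ltLHS]mulr_natr mulrAC ltr_pdivrMr// ltr_pM2l// ltr_nat.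
Qed.

Lemma rvec_continuous (S : topologicalType) (phi : S -> rvec V R) :
  (forall v, continuous (fun s => phi s v)) -> continuous phi.
Proof. by move=> cphi s; apply: cvg_to_rvec => v; exact: cphi. Qed.

Lemma rvec_continuousP (F : rvec V R -> R) : continuous F ->
  forall z e, 0 < e -> exists2 r : R, 0 < r &
    forall y, vdist z y < r -> `|F y - F z| < e.
Proof.
move=> cF z e e0; have : nbhs z (F @^-1` ball (F z) e).
  by apply: (cF z); exact: nbhsx_ballx.
move=> /nbhs_rvecP[r r0 rF]; exists r => // y /rF.
by rewrite /preimage /ball /= distrC.
Qed.

End rvec_continuity.

(** Open sets of [R * rvec V R] have to be related to the product sigma-algebra. Adding a coordinate
    indexed by [None] identifies the pair with a single vector, and for vectors open sets are
    measurable by definition. *)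
Lemma continuous_pair_rvec_measurable (V : finType) (R : realType)
    (f : R * rvec V R -> R) : continuous f -> measurable_fun setT f.
Proof.
move=> cf; pose h (x : rvec (option V) R) : R * rvec V R :=
  (x None, fun v => x (Some v)).
have ch : continuous h.
  move=> x.
  have c2 : continuous (fun y => (h y).2).
    by apply: rvec_continuous => v; exact: continuous_coord.
  exact: (@cvg_pair _ _ _ (nbhs x) (nbhs (x None)) (nbhs (h x).2)
    (nbhs_filter _) (nbhs_filter _) (nbhs_filter _) (fun y => y None)
    (fun y => (h y).2) (@continuous_coord _ _ None x) (c2 x)).
have mfh : measurable_fun setT (f \o h).
  by apply: continuous_rvec_measurable => x; exact: continuous_comp (ch x) (cf _).
pose g (p : R * rvec V R) : rvec (option V) R :=
  fun o => if o is Some v then p.2 v else p.1.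
have mg : measurable_fun setT g.
  apply: measurable_rvec => -[v|]; rewrite /g; last exact: measurable_fst.
  exact: measurableT_comp (measurable_coord v) measurable_snd.
rewrite (_ : f = (f \o h) \o g); first exact: measurableT_comp mfh mg.
by apply/funext => -[r x].
Qed.

Section weak_limits.
Context {V : finType} {R : realType} d d' (T : measurableType d)
  (T' : measurableType d').
Variables (m_ : R -> probability T R) (Z_ : R -> T -> rvec V R).
Variables (m : probability T' R) (Z : T' -> rvec V R).
Hypothesis mZ_ : forall t, measurable_fun setT (Z_ t).
Hypothesis mZ : measurable_fun setT Z.
Hypothesis Z_Z : forall (f : rvec V R -> R) (L : R), (forall x, 0 <= f x <= 1) ->
  vlipschitz L f ->
  \int[m_ t]_w f (Z_ t w) @[t --> +oo] --> \int[m]_w f (Z w).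

Lemma Rintegral_affine d0 (T0 : measurableType d0) (m0 : probability T0 R)
    (g : T0 -> R) (p q : R) : measurable_fun setT g -> (forall x, 0 <= g x <= 1) ->
  \int[m0]_x (p * g x - q) = p * \int[m0]_x g x - q.
Proof.
move=> mg g01; have ig := unit_bounded_integrable m0 mg g01.
rewrite RintegralB//.
- by rewrite RintegralZl// Rintegral_prob_cst.
- exact: (integrableZl measurableT p ig).
- exact: finite_measure_integrable_cst.
Qed.

(** An affine change brings [F] into [0, 1]; a continuous function converges continuously to itself,
    so the extended mapping theorem for a constant family removes the Lipschitz condition. *)
Lemma continuous_bounded_limit (F : rvec V R -> R) (K : R) : continuous F ->
  (forall x, `|F x| <= K) ->
  \int[m_ t]_w F (Z_ t w) @[t --> +oo] --> \int[m]_w F (Z w).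
Proof.
move=> cF FK; pose K' := Num.max K 1.
have K'0 : 0 < K' by rewrite /K' lt_max ltr01 orbT.
have FK' x : `|F x| <= K' by rewrite /K' le_max FK.
pose G x := (2 * K')^-1 * (F x + K').
have G01 x : 0 <= G x <= 1.
  have := FK' x; rewrite ler_norml => /andP[F1 F2].
  have F3 : 0 <= F x + K' by rewrite -lerBlDr sub0r.
  have F4 : F x + K' <= 2 * K' by rewrite mulr2n mulrDl !mul1r lerD2r.
  rewrite /G mulr_ge0 ?invr_ge0 ?mulr_ge0 ?(ltW K'0)//=.
  by rewrite mulrC ler_pdivrMr ?mulr_gt0// mul1r.
have FG x : F x = (2 * K') * G x - K'.
  by rewrite /G mulrA mulfV ?gt_eqF ?mulr_gt0// mul1r addrK.
have mF : measurable_fun setT F by exact: continuous_rvec_measurable.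
have mG : measurable_fun setT G by apply: measurable_funM => //; exact: measurable_funD.
have mGZ_ t : measurable_fun setT (fun w => G (Z_ t w)) by exact: measurableT_comp.
have mGZ : measurable_fun setT (fun w => G (Z w)) by exact: measurableT_comp.
have cvgG : \int[m_ t]_w G (Z_ t w) @[t --> +oo] --> \int[m]_w G (Z w).
  apply: (@continuous_convergence_Rintegral _ _ _ _ _ _ m_ Z_ m Z (fun=> G) G) => //.
  apply: aeW => w e e0.
  have [r r0 rF] := rvec_continuousP cF (Z w) (mulr_gt0 e0 (mulr_gt0 (ltr0Sn R 1) K'0)).
  exists r => //; exists 0 => _ y _ wy.
  have -> : G y - G (Z w) = (2 * K')^-1 * (F y - F (Z w)) by rewrite /G; ring.
  rewrite normrM gtr0_norm ?invr_gt0 ?mulr_gt0//.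
  by rewrite mulrC ltr_pdivrMr ?mulr_gt0//; exact: rF.
have E d0 (T0 : measurableType d0) (m0 : probability T0 R) (z : T0 -> rvec V R) :
    measurable_fun setT z ->
    \int[m0]_w F (z w) = 2 * K' * \int[m0]_w G (z w) - K'.
  move=> mz; under eq_Rintegral do rewrite FG.
  by rewrite Rintegral_affine//; exact: measurableT_comp mG mz.
under eq_fun do rewrite E//; rewrite E//.
by apply: cvgB; [apply: cvgMr|exact: cvg_cst].
Qed.

End weak_limits.

Lemma Rintegral_image d d' (T : measurableType d) (T' : measurableType d')
    (R : realType) (m : probability T R) (f : {mfun T >-> T'}) (g : T' -> R) (K : R) :
  measurable_fun setT g -> (forall x, `|g x| <= K) ->
  (\int[image_measure m f]_y (g y)%:E)%E = (\int[m]_x g (f x))%:E.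
Proof.
move=> mg gK; have mgf : measurable_fun setT (fun x => g (f x)).
  exact: measurableT_comp.
have igf : m.-integrable setT (EFin \o (fun x => g (f x))).
  exact: bounded_integrable mgf (fun x => gK (f x)).
rewrite EFin_Rintegral// integral_pushforward//.
exact/measurable_EFinP.
Qed.

Section polar_limits.
Context (R : realType) d (T : measurableType d) (P : probability T R).
Context (V : finType) (X : V -> {RV P >-> R}) (u : V).
Context (Pa : probability R R) (Q : probability (rvec V R) R).
Hypothesis X_pos : \forall t \near +oo, (0 < P [set w | (t < X u w)%R])%E.

Let lim : probability (R * rvec V R)%type R := (Pa \x Q)%E.

Hypothesis scaled_limit : forall (f : rvec V R -> R) (L : R),
  (forall x, 0 <= f x <= 1) -> vlipschitz L f ->
  \int[cond_gt (X u) t]_w f (scaled_vec X t w) @[t --> +oo] -->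
  \int[lim]_p f (scale_vec p).
Hypothesis lim_ae : {ae lim, forall p, 1 < p.1 /\ p.2 u = 1}.

Let mscaled t : measurable_fun setT (scaled_vec X t).
Proof. exact: measurable_funPT. Qed.

Let mscale_vec : measurable_fun setT (@scale_vec V R).
Proof. exact: measurable_funPT. Qed.

Let scaled_continuous (F : rvec V R -> R) (K : R) : continuous F ->
  (forall x, `|F x| <= K) ->
  \int[cond_gt (X u) t]_w F (scaled_vec X t w) @[t --> +oo] -->
  \int[lim]_p F (scale_vec p).
Proof.
move=> cF FK.
exact: (continuous_bounded_limit mscaled mscale_vec scaled_limit cF FK).
Qed.

Lemma bounded_funP (S : Type) (f : S -> R) : bounded_fun f ->
  exists K : R, forall x, `|f x| <= K.
Proof.
move=> [K [_ fK]]; exists (K + 1) => x; apply: fK => //.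
by rewrite ltrDl.
Qed.

Lemma weak_cvg_scaled :
  weak_cvg (fun t => distribution (cond_gt (X u) t) (scaled_vec X t))
    (image_measure (Pa \x Q)%E scale_vec).
Proof.
move=> f cf /bounded_funP[K fK].
have mf : measurable_fun setT f by exact: continuous_rvec_measurable.
rewrite (_ : (fun t => _) = fun t =>
    (\int[cond_gt (X u) t]_w f (scaled_vec X t w))%:E); last first.
  by apply/funext => t; exact: (Rintegral_image (cond_gt (X u) t) (scaled_vec X t) mf fK).
rewrite (Rintegral_image lim scale_vec mf fK).
apply: cvg_EFin; first exact: nearW.
exact: scaled_continuous cf fK.
Qed.

(* On [X u > t] the second coordinate is [X / X u]; dividing by
   [Num.max (x u) 1] makes the map continuous on the whole of R^V. *)
Let polar (x : rvec V R) : R * rvec V R :=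
  (x u, fun v => x v / Num.max (x u) 1).

Let max1_gt0 (r : R) : 0 < Num.max r 1.
Proof. by rewrite lt_max ltr01 orbT. Qed.

Let polar_continuous : continuous polar.
Proof.
move=> x.
have c2 : continuous (fun y => (polar y).2).
  have cinv : continuous (fun r : R => (Num.max r 1)^-1).
    move=> r; apply: cvgV; first by rewrite gt_eqF.
    by apply: continuous_max; [exact: cvg_id|exact: cvg_cst].
  apply: rvec_continuous => v y.
  have h1 := @continuous_coord V R v y.
  have h2 := continuous_comp (@continuous_coord V R u y) (cinv _).
  exact: (cvgM h1 h2).
exact: (@cvg_pair _ _ _ (nbhs x) (nbhs (x u)) (nbhs (polar x).2)
  (nbhs_filter _) (nbhs_filter _) (nbhs_filter _) (fun y => y u)
  (fun y => (polar y).2) (@continuous_coord _ _ u x) (c2 x)).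
Qed.

(** Two almost sure identities: [polar] inverts [scale_vec] where the radius exceeds 1 and the root
    entry is 1, and [polar] of [X / t] is [polar_vec] on the conditioning event. *)
Lemma polar_limit (f : R * rvec V R -> R) (K : R) : continuous f ->
  (forall x, `|f x| <= K) ->
  \int[cond_gt (X u) t]_w f (polar_vec X u t w) @[t --> +oo] -->
  \int[lim]_p f p.
Proof.
move=> cf fK.
have mf := continuous_pair_rvec_measurable cf.
have cfp : continuous (f \o polar).
  by move=> x; exact: (continuous_comp (@polar_continuous x) (cf _)).
have mfp : measurable_fun setT (f \o polar) by exact: continuous_rvec_measurable.
have -> : \int[lim]_p f p = \int[lim]_p (f \o polar) (scale_vec p).
  have aeE : {ae lim, forall p, [set: R * rvec V R] p ->
      (f p)%:E = ((f \o polar) (scale_vec p))%:E}.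
    have [N [mN N0 subN]] := lim_ae.
    exists N; split => //; apply: subset_trans subN => p /=.
    apply: contra_not => -[p1 pu] _; congr (f _)%:E.
    rewrite /polar /scale_vec /= pu mulr1 max_l ?(ltW p1)//.
    rewrite [LHS]surjective_pairing; congr pair; apply/funext => v.
    by rewrite mulrAC mulfV ?mul1r// gt_eqF// (lt_trans _ p1).
  rewrite /Rintegral; congr fine; apply: ae_eq_integral => //.
  - exact/measurable_EFinP.
  - by apply/measurable_EFinP; exact: measurableT_comp mfp mscale_vec.
apply: cvg_trans (scaled_continuous cfp (fun x => fK (polar x))).
apply: near_eq_cvg; near=> t.
have Pt : (0 < P [set w | (t < X u w)%R])%E by near: t.
rewrite /Rintegral; congr fine; apply: ae_eq_integral => //.
- by apply/measurable_EFinP; exact: measurableT_comp mfp (mscaled t).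
- apply/measurable_EFinP; apply: measurableT_comp mf _; exact: measurable_funPT.
- exists (~` [set w | t < X u w]); split.
  + by apply: measurableC; exact: measurable_gt.
  + by rewrite [LHS](cond_gtE Pt) setICl measure0 mul0e.
  + move=> w /=; apply: contra_not => Xt _; congr (f _)%:E.
    rewrite /polar /polar_vec /scaled_vec /ratio_vec.
    have Xt1 : 1 <= X u w / t by rewrite ler_pdivlMr// mul1r ltW.
    rewrite max_l//; congr pair; apply/funext => v.
    have Xu0 : 0 < X u w by exact: lt_trans Xt.
    by field; rewrite !gt_eqF.
Unshelve. all: by end_near. Qed.

Lemma weak_cvg_polar :
  weak_cvg (fun t => distribution (cond_gt (X u) t) (polar_vec X u t))
    (Pa \x Q)%E.
Proof.
move=> f cf /bounded_funP[K fK].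
have mf := continuous_pair_rvec_measurable cf.
rewrite (_ : (fun t => _) = fun t =>
    (\int[cond_gt (X u) t]_w f (polar_vec X u t w))%:E); last first.
  by apply/funext => t; exact: (Rintegral_image (cond_gt (X u) t) (polar_vec X u t) mf fK).
have i_f : lim.-integrable setT (EFin \o f) by exact: bounded_integrable mf fK.
rewrite -[X in _ --> X](@EFin_Rintegral _ _ _ lim)//.
apply: cvg_EFin; first exact: nearW.
exact: polar_limit cf fK.
Qed.

Lemma weak_cvg_ratio :
  weak_cvg (fun t => distribution (cond_gt (X u) t) (ratio_vec X u)) Q.
Proof.
move=> f cf /bounded_funP[K fK].
have mf : measurable_fun setT f by exact: continuous_rvec_measurable.
rewrite (_ : (fun t => _) = fun t =>
    (\int[cond_gt (X u) t]_w f (polar_vec X u t w).2)%:E); last first.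
  by apply/funext => t; exact: (Rintegral_image (cond_gt (X u) t) (ratio_vec X u) mf fK).
have cf2 : continuous (fun p : R * rvec V R => f p.2).
  by move=> p; apply: continuous_comp (cf _); exact: cvg_snd.
have -> : (\int[Q]_x (f x)%:E)%E = (\int[lim]_p f p.2)%:E.
  rewrite -(Rintegral_image lim (mfun_of measurable_snd) mf fK).
  apply: eq_measure_integral => A mA _; apply/esym.
  rewrite /image_measure /pushforward /= (_ : _ @^-1` _ = setT `*` A); last first.
    by apply/seteqP; split => p; [|case].
  rewrite [LHS]product_measure1E//.
  by rewrite [Z in (Z * _)%E]probability_setT mul1e.
apply: cvg_EFin; first exact: nearW.
exact: polar_limit cf2 (fun p => fK p.2).
Qed.

End polar_limits.

(** * The radial measure and the spectral representation *)

Section pareto_power_measure.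
Context (R : realType) (alpha : R).
Hypothesis alpha_gt0 : 0 < alpha.

Lemma powR_cvg_pinfty : (fun x : R => x `^ (- alpha)) @ +oo --> (0 : R).
Proof.
apply/cvgrPdist_lt => e e0; have [l0 l01 H] := powR_small alpha_gt0 e0.
near=> x; rewrite sub0r normrN ger0_norm ?powR_ge0//; apply: H.
by near: x; exact: nbhs_pinfty_gt (num_real _).
Unshelve. all: by end_near. Qed.

(** Minus the derivative of z^(-alpha) on the positive half-line: the radial density, of infinite
    mass near 0. *)
Definition power_density (z : R) : R :=
  (alpha * z `^ (- alpha - 1)) * \1_(`]0, +oo[%classic) z.

Lemma power_density_ge0 z : 0 <= power_density z.
Proof. by rewrite /power_density indicE !mulr_ge0// ?powR_ge0// ltW. Qed.

Lemma measurable_power_density : measurable_fun setT power_density.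
Proof.
apply: measurable_funM; last exact: measurable_indic.
apply: measurable_funM => //; exact: measurable_powR.
Qed.

Let idR (x : measurableTypeR R) : R := x.

Let midR : measurable_fun setT idR.
Proof. by move=> _ B mB; rewrite setTI. Qed.

Let mdensity : measurable_fun [set: measurableTypeR R] power_density.
Proof. by have := measurable_power_density. Qed.

Let dens : {measure set (measurableTypeR R) -> \bar R} :=
  density_measure (@lebesgue_measure R) mdensity power_density_ge0.

(* The reals carry two displays in the library, hence the transport by [idR]. *)
Definition power_measure : {measure set R -> \bar R} :=
  image_measure dens (mfun_of midR).

Lemma ge0_integral_power_measure (h : R -> \bar R) : measurable_fun setT h ->
  (forall x, 0 <= h x)%E ->
  (\int[power_measure]_x h x =
   \int[lebesgue_measure]_(x in `]0%R, +oo[%classic)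
     (h x * (alpha * x `^ (- alpha - 1))%R%:E))%E.
Proof.
move=> mh h0; have mh' : measurable_fun [set: measurableTypeR R] h by have := mh.
rewrite (ge0_integral_image dens (mfun_of midR))// ge0_integral_density//.
rewrite [RHS]integral_mkcond; apply: eq_integral => x _.
rewrite patchE /power_density indicE; case: ifP => _.
  by rewrite mulr1 muleC.
by rewrite mulr0 mul0e.
Qed.

Lemma power_measure_ray (z : R) : 0 < z -> power_measure `]z, +oo[%classic = (z `^ (- alpha))%:E.
Proof.
move=> z0; rewrite (_ : power_measure _ =
  \int[lebesgue_measure]_(x in `]z, +oo[%classic) (power_density x)%:E)%E//.
pose f x : R := alpha * x `^ (- alpha - 1).
have mf : measurable_fun [set: R] f.
  by apply: measurable_funM => //; exact: measurable_powR.
transitivity (\int[lebesgue_measure]_(x in `]z, +oo[%classic) (f x)%:E)%E.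
  apply: eq_integral => x; rewrite inE /= in_itv/= andbT => zx.
  by rewrite /power_density indicE mem_set ?mulr1//= in_itv/= andbT (lt_trans z0).
(* The fundamental theorem is used on the closed half-line; the endpoint is a null set. *)
rewrite integral_itv_obnd_cbnd; last exact/measurable_funTS/measurable_EFinP.
pose F x : R := - (x `^ (- alpha)).
have dF (x : R) : 0 < x -> is_derive x 1 F (f x).
  move=> x0; have := is_deriveN (is_derive1_powR (- alpha) x0).
  by rewrite mulNr opprK.
have cpow (a x : R) : 0 < x -> (fun y : R => y `^ a) y @[y --> x] --> x `^ a.
  move=> x0; have [dpow _] := is_derive1_powR a x0.
  exact: (@differentiable_continuous R R R x (fun y : R => y `^ a)
    (proj1 (derivable1_diffP _ _) dpow)).
have cF (x : R) : 0 < x -> F y @[y --> x] --> F x.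
  by move=> x0; apply: cvgN; exact: cpow.
have cf (x : R) : 0 < x -> f y @[y --> x] --> f x.
  by move=> x0; apply: cvgMr; exact: cpow.
rewrite (@ge0_continuous_FTC2y _ f F z 0).
- by rewrite sub0e /F -EFinN opprK.
- by move=> x _; rewrite /f mulr_ge0 ?powR_ge0// ltW.
- apply/continuous_within_itvcyP; split.
    by move=> x; rewrite in_itv/= andbT => zx; exact: cf (lt_trans z0 zx).
  by apply: cvg_at_right_filter; exact: cf.
- by rewrite -[X in _ --> X]oppr0; apply: cvgN; exact: powR_cvg_pinfty.
- by move=> x zx; have [] := dF x (lt_trans z0 zx).
- by apply: cvg_at_right_filter; exact: cF.
- move=> x; rewrite in_itv/= andbT => zx; rewrite derive1E.
  by have [_ ->] := dF x (lt_trans z0 zx).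
Qed.

Context (Pa : probability R R).
Hypothesis Pa_pareto : is_pareto alpha Pa.

(** Homogeneity of the radial measure: beyond [e] it is e^(-alpha) times the law of [e] times a
    Pareto variable. Both sides are finite on rays, so comparing tails suffices. *)
Lemma power_measure_pareto (e : R) (A : set R) : 0 < e -> measurable A ->
  power_measure (A `&` `]e, +oo[%classic) =
  ((e `^ (- alpha))%:E * Pa (( *%R e) @^-1` A))%E.
Proof.
move=> e0; have me : measurable (`]e, +oo[%classic : set R) by [].
have mmul : measurable_fun setT ( *%R e) by exact: measurable_funM.
have p0 : 0 <= e `^ (- alpha) by exact: powR_ge0.
pose m1 : {measure set R -> \bar R} := mrestr power_measure me.
pose m2 : {measure set R -> \bar R} :=
  mscale (NngNum p0) (image_measure Pa (mfun_of mmul)).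
have ray_max (x : R) : `]x, +oo[%classic `&` `]e, +oo[%classic =
    `]Num.max x e, +oo[%classic.
  by apply/seteqP; split => y; rewrite /= !in_itv/= !andbT gt_max => /andP.
have ray_mul (x : R) : ( *%R e) @^-1` `]x, +oo[%classic = `]x / e, +oo[%classic.
  apply/seteqP; split => y; rewrite /= !in_itv/= !andbT.
    by rewrite ltr_pdivrMr// mulrC.
  by rewrite ltr_pdivrMr// mulrC.
move=> mA; change (m1 A = m2 A); move: A mA.
apply: (measure_unique (@RGenOInfty.G R) (fun n => `](- n%:R), +oo[%classic)).
- exact: RGenOInfty.measurableE.
- move=> _ _ [x ->] [y ->]; exists (Num.max x y).
  by apply/seteqP; split => z; rewrite /= !in_itv/= !andbT gt_max => /andP.
- by move=> n; exists (- n%:R).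
- apply/seteqP; split => // x _; exists (Num.truncn `|x|).+1 => //=.
  rewrite in_itv/= andbT ltrNl.
  by apply: le_lt_trans (truncnS_gt _); rewrite -normrN ler_norm.
- move=> _ [x ->].
  change (power_measure (`]x, +oo[%classic `&` `]e, +oo[%classic) =
    (e `^ (- alpha))%:E * Pa (( *%R e) @^-1` `]x, +oo[%classic))%E.
  rewrite ray_max ray_mul power_measure_ray; last by rewrite lt_max e0 orbT.
  case: (leP e x) => ex.
    rewrite Pa_pareto ?ler_pdivlMr ?mul1r//.
    rewrite -EFinM -powRM ?divr_ge0 ?(ltW e0) ?(le_trans (ltW e0))//.
    by rewrite mulrC mulfVK ?gt_eqF.
  (* Here [x < e], so the ray starts below 1, where [is_pareto] says nothing; comparison with the
     ray at 1 gives full mass. *)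
  rewrite (_ : Pa _ = 1%E) ?mule1//; apply/eqP; rewrite eq_le probability_le1//=.
  have -> : (1 = Pa `]1%R, +oo[%classic)%E by rewrite Pa_pareto// powR1.
  rewrite le_measure ?inE// => y; rewrite /= !in_itv/= !andbT.
  by apply: lt_trans; rewrite ltr_pdivrMr// mul1r.
- move=> n.
  change (power_measure (`](- n%:R)%R, +oo[%classic `&` `]e, +oo[%classic) < +oo)%E.
  rewrite ray_max power_measure_ray ?ltry//.
  by rewrite lt_max e0 orbT.
Qed.

End pareto_power_measure.

Lemma measure_integral_indic d (T : measurableType d) (R : realType)
    (m : {measure set T -> \bar R}) (A : set T) : measurable A ->
  m A = (\int[m]_x (\1_A x)%:E)%E.
Proof. by move=> mA; rewrite integral_indic// setIT. Qed.

Section spectral_measure.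
Context (R : realType) (V : finType) (u : V) (alpha c : R).
Context d' (T' : measurableType d') (P' : probability T' R).
Context (Th : {mfun T' >-> rvec V R}).
Hypothesis alpha_gt0 : 0 < alpha.
Hypothesis c_ge0 : 0 <= c.
Hypothesis Th_root : forall w, Th w u = 1.

Let LT := (measurableTypeR R * T')%type.

Let rho (p : LT) : R := power_density alpha p.1.

Let rho_ge0 p : 0 <= rho p.
Proof. exact: power_density_ge0. Qed.

Let mrho : measurable_fun setT rho.
Proof.
have m1 : measurable_fun [set: measurableTypeR R] (@power_density R alpha).
  by have := measurable_power_density alpha.
exact: measurableT_comp m1 measurable_fst.
Qed.

Let scl (p : LT) : rvec V R := scale_vec (p.1 : R, Th p.2).

Let mscl : measurable_fun setT scl.
Proof.
apply: measurable_rvec => v; rewrite /scl /scale_vec /=.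
have m1 : measurable_fun [set: LT] (fun p : LT => p.1 : R).
  by have := @measurable_fst _ _ (measurableTypeR R) T'.
have m2 : measurable_fun [set: LT] (fun p : LT => Th p.2 v).
  have m3 : measurable_fun [set: LT] (Th \o snd).
    exact: measurableT_comp (@measurable_funPT _ _ _ _ Th) measurable_snd.
  exact: (@measurableT_comp _ _ _ _ _ _ (fun x : rvec V R => x v) _
    (Th \o snd) (measurable_coord v) m3).
exact: measurable_funM m1 m2.
Qed.

(** The density is taken with respect to Lebesgue measure times [P'], both sigma-finite, so that
    Tonelli applies at once; a product with the infinite [power_measure] would call for a
    sigma-finiteness proof of its own. *)
Definition spectral_measure : {measure set (rvec V R) -> \bar R} :=
  mscale (NngNum c_ge0) (image_measure
    (density_measure (lebesgue_measure \x P')%E mrho rho_ge0) (mfun_of mscl)).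

Lemma ge0_integral_spectral (h : rvec V R -> \bar R) : measurable_fun setT h ->
  (forall x, 0 <= h x)%E ->
  (\int[spectral_measure]_x h x =
   c%:E * \int[P']_w \int[lebesgue_measure]_(z in `]0%R, +oo[%classic)
     (h (scale_vec (z, Th w)) * (alpha * z `^ (- alpha - 1))%R%:E))%E.
Proof.
move=> mh h0; rewrite ge0_integral_mscale//; congr (_ * _)%E.
rewrite (ge0_integral_image _ (mfun_of mscl))//.
have mhs : measurable_fun setT (h \o scl) by exact: measurableT_comp mh mscl.
rewrite ge0_integral_density//.
pose F p := ((rho p)%:E * h (scl p))%E.
have mF : measurable_fun setT F.
  by apply: emeasurable_funM; [exact/measurable_EFinP|exact: mhs].
have F0 p : (0 <= F p)%E by rewrite /F mule_ge0// lee_fin.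
transitivity (\int[P']_w fubini_G lebesgue_measure F w)%E.
  exact: (@fubini_tonelli2 _ _ _ _ _ lebesgue_measure P' F mF F0).
apply: eq_integral => w _; rewrite /fubini_G [RHS]integral_mkcond.
apply: eq_integral => z _; rewrite patchE /F /rho /power_density /= indicE.
case: ifP => _; first by rewrite mulr1 muleC.
by rewrite mulr0 mul0e.
Qed.

Lemma spectral_measure_null (N : set (rvec V R)) : measurable N ->
  (forall (z : R) w, 0 < z -> ~ N (scale_vec (z, Th w))) ->
  spectral_measure N = 0%E.
Proof.
move=> mN N0; have mI : measurable_fun setT (fun x => (\1_N x)%:E : \bar R).
  exact/measurable_EFinP/measurable_indic.
have I0 x : (0 <= (\1_N x)%:E :> \bar R)%E by rewrite lee_fin.
rewrite [LHS]measure_integral_indic// (ge0_integral_spectral mI I0).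
rewrite integral0_eq ?mule0// => w _; apply: integral0_eq => z.
rewrite /= in_itv/= andbT => /(N0 _ w) Nz.
by rewrite indicE memNset ?mul0e.
Qed.

Let inner_power (h : rvec V R -> \bar R) w : measurable_fun setT h ->
  (forall x, 0 <= h x)%E ->
  (\int[lebesgue_measure]_(z in `]0%R, +oo[%classic)
     (h (scale_vec (z, Th w)) * (alpha * z `^ (- alpha - 1))%R%:E) =
   \int[power_measure alpha_gt0]_z h (scale_vec (z, Th w)))%E.
Proof.
move=> mh h0; rewrite (ge0_integral_power_measure alpha_gt0
  (h := fun z => h (scale_vec (z, Th w))))//.
apply: measurableT_comp mh _; apply: measurable_rvec => v.
by rewrite /scale_vec /=; exact: measurable_funM.
Qed.

Context (Pa : probability R R).
Hypothesis Pa_pareto : is_pareto alpha Pa.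

Let Q : probability (rvec V R) R := distribution P' Th.
Let LY : {measure set (rvec V R) -> \bar R} := image_measure (Pa \x Q)%E scale_vec.

Let swap_scale (h : rvec V R -> \bar R) (p : R * rvec V R) := h (scale_vec p).

Let mswap_scale h : measurable_fun setT h -> measurable_fun setT (swap_scale h).
Proof. by move=> mh; apply: measurableT_comp mh _; exact: measurable_funPT. Qed.

(** The radius is the inner variable, as in [ge0_integral_spectral], so that the two can be compared
    for each fixed direction. *)
Lemma ge0_integral_scale_image (h : rvec V R -> \bar R) : measurable_fun setT h ->
  (forall x, 0 <= h x)%E ->
  (\int[LY]_x h x = \int[P']_w \int[Pa]_z h (scale_vec (z, Th w)))%E.
Proof.
move=> mh h0; have mS := mswap_scale mh.
have S0 p : (0 <= swap_scale h p)%E by exact: h0.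
rewrite (ge0_integral_image _ scale_vec)//.
transitivity (\int[Q]_x fubini_G Pa (swap_scale h) x)%E.
  exact: (@fubini_tonelli2 _ _ _ _ _ Pa Q (swap_scale h) mS S0).
rewrite (ge0_integral_image P' Th)//.
- exact: (measurable_fun_fubini_tonelli_G _ mS S0).
- by move=> y; apply: integral_ge0 => z _; exact: h0.
Qed.

Let measurable_inner (h : rvec V R -> \bar R) : measurable_fun setT h ->
  (forall x, 0 <= h x)%E ->
  measurable_fun setT (fun w => \int[Pa]_z h (scale_vec (z, Th w)))%E.
Proof.
move=> mh h0; have mS := mswap_scale mh.
have S0 p : (0 <= swap_scale h p)%E by exact: h0.
exact: measurableT_comp (measurable_fun_fubini_tonelli_G _ mS S0)
  (@measurable_funPT _ _ _ _ Th).
Qed.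

(** The root entry of [Th] is 1, so [e < x u] reads [e < z] in every direction and the Pareto
    scaling applies inside the integral over [P']. At [e = 1] this relates [nu_u] to the law of
    [Y_u]; general [e] serves [spectral_limit]. *)
Lemma spectral_measure_tail (e : R) (B : set (rvec V R)) : 0 < e -> measurable B ->
  spectral_measure (B `&` [set x | e < x u]) =
  ((c * e `^ (- alpha))%:E * LY [set x | B (fun v => (e * x v)%R)])%E.
Proof.
move=> e0 mB.
have mBe : measurable (B `&` [set x : rvec V R | e < x u]).
  by apply: measurableI => //; exact: measurable_coord_gt.
have mmul : measurable_fun setT (fun x : rvec V R => (fun v => e * x v) : rvec V R).
  by apply: measurable_rvec => v; apply: measurable_funM => //; exact: measurable_coord.
have mB' : measurable [set x : rvec V R | B (fun v => e * x v)].
  by rewrite -[X in measurable X]setTI; exact: mmul.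
have mI (A : set (rvec V R)) : measurable A ->
    measurable_fun setT (fun x => (\1_A x)%:E : \bar R).
  by move=> mA; exact/measurable_EFinP/measurable_indic.
have I0 (A : set (rvec V R)) x : (0 <= (\1_A x)%:E :> \bar R)%E by rewrite lee_fin.
rewrite [LHS]measure_integral_indic// ge0_integral_spectral//; last exact: mI.
rewrite [X in _ = (_ * X)%E](measure_integral_indic LY mB').
rewrite ge0_integral_scale_image//; last exact: mI.
rewrite EFinM -muleA; congr (_ * _)%E.
rewrite -ge0_integralZl_EFin ?powR_ge0//; last 2 first.
- by move=> w _; apply: integral_ge0 => z _; exact: I0.
- by apply: (measurable_inner (h := fun x => (\1__ x)%:E)); [exact: mI|exact: I0].
apply: eq_integral => w _; rewrite (inner_power w (mI _ mBe) (I0 _)).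
have mray : measurable_fun setT (fun z : R => scale_vec (z, Th w)).
  apply: measurable_rvec => v.
  by rewrite /scale_vec /=; exact: measurable_funM.
have mA (A : set (rvec V R)) : measurable A ->
    measurable [set z : R | A (scale_vec (z, Th w))].
  by move=> mA; rewrite -[X in measurable X]setTI; exact: mray.
transitivity (power_measure alpha_gt0
    ([set z : R | B (scale_vec (z, Th w))] `&` `]e, +oo[%classic)).
  rewrite [RHS]measure_integral_indic//; last first.
    by apply: measurableI => //; exact: mA.
  apply: eq_integral => z _; rewrite !indicE; congr ((_ : bool)%:R%:E).
  apply/idP/idP; rewrite !inE /= in_itv/= andbT /scale_vec/= Th_root mulr1;
    by move=> -[].
rewrite (power_measure_pareto alpha_gt0 Pa_pareto)//; last exact: mA.
congr (_ * _)%E; rewrite [LHS]measure_integral_indic//; last first.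
  by rewrite -[X in measurable X]setTI; apply: measurable_funM => //; exact: mA.
apply: eq_integral => z _; rewrite !indicE; congr ((_ : bool)%:R%:E).
have eqB : scale_vec (e * z, Th w) = (fun v => e * scale_vec (z, Th w) v).
  by apply/funext => v; rewrite /scale_vec /= mulrA.
by apply/idP/idP; rewrite !inE /= eqB.
Qed.

End spectral_measure.

Lemma pinfty_scale (R : realType) (l : R) (Q : R -> Prop) : 0 < l ->
  (\forall t \near +oo, Q t) -> \forall t \near +oo, Q (l * t).
Proof.
move=> l0 [t0 [t0r Qt0]]; exists (t0 / l); split; first exact: num_real.
by move=> t tl; apply: Qt0; rewrite mulrC -ltr_pdivrMr.
Qed.

Section regular_tail.
Context (R : realType) d (T : measurableType d) (P : probability T R).
Context (Z : {RV P >-> R}) (b : R -> R) (alpha c : R).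
Hypothesis c_gt0 : 0 < c.
Hypothesis b_gt0 : \forall t \near +oo, 0 < b t.
Hypothesis b_rv : forall l : R, 0 < l -> b (l * t) / b t @[t --> +oo] --> l `^ alpha.
Hypothesis tail :
  ((b t)%:E * P [set w | (t < Z w)%R])%E @[t --> +oo] --> c%:E.

Let p (t : R) := fine (P [set w | (t < Z w)%R]).

Let pE t : P [set w | (t < Z w)%R] = (p t)%:E.
Proof. by rewrite /p fineK// fin_num_measure//; exact: measurable_gt. Qed.

Let bp : b t * p t @[t --> +oo] --> c.
Proof.
have := tail; under eq_fun do rewrite pE -EFinM.
by move=> /fine_cvgP[].
Qed.

Lemma tail_gt0 : \forall t \near +oo, (0 < P [set w | (t < Z w)%R])%E.
Proof.
near=> t; rewrite pE lte_fin lt0r fine_ge0// andbT.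
have H : `|c - b t * p t| < c.
  by near: t; move: bp => /cvgrPdist_lt; apply.
by apply: contraTneq H => ->; rewrite mulr0 subr0 gtr0_norm// ltxx.
Unshelve. all: by end_near. Qed.

(** The product is b(et) p(et), which tends to [c], divided by b(et) / b(t). *)
Lemma scaled_tail_cvg (e : R) : 0 < e ->
  b t * p (e * t) @[t --> +oo] --> c * e `^ (- alpha).
Proof.
move=> e0.
have H1 : b (e * t) * p (e * t) @[t --> +oo] --> c.
  by move=> A /bp/(pinfty_scale e0).
have H2 : (b (e * t) / b t)^-1 @[t --> +oo] --> (e `^ alpha)^-1.
  by apply: cvgV; [rewrite gt_eqF// powR_gt0|exact: b_rv].
rewrite powRN; apply: cvg_trans (cvgM H1 H2); apply: near_eq_cvg; near=> t.
have b1 : 0 < b t by near: t.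
have b2 : 0 < b (e * t) by near: t; exact: (pinfty_scale e0 b_gt0).
by rewrite /=; field; rewrite !gt_eqF.
Unshelve. all: by end_near. Qed.

(** For [l >= 1] and [t > 0] the event [l < Z / t] implies [t < Z], so the conditional tail is a
    quotient of two unconditional ones. *)
Lemma cond_gt_tail (l : R) : 1 <= l ->
  fine (cond_gt Z t [set w | l < Z w / t]) @[t --> +oo] --> l `^ (- alpha).
Proof.
move=> l1; have l0 : 0 < l by exact: lt_le_trans l1.
have -> : l `^ (- alpha) = (c * l `^ (- alpha)) / c by rewrite mulrAC mulfV ?mul1r// gt_eqF.
have cV : (b t * p t)^-1 @[t --> +oo] --> c^-1 by apply: cvgV => //; rewrite gt_eqF.
apply: cvg_trans (cvgM (scaled_tail_cvg l0) cV); apply: near_eq_cvg; near=> t.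
have b1 : 0 < b t by near: t.
have Pt : (0 < P [set w | (t < Z w)%R])%E by near: t; exact: tail_gt0.
have pt : 0 < p t by rewrite -lte_fin -pE.
rewrite [X in fine X](cond_gtE Pt).
have -> : [set w | l < Z w / t] `&` [set w | t < Z w] = [set w | l * t < Z w].
  apply/seteqP; split => w /=; rewrite ltr_pdivlMr//; first by case.
  by move=> H; split => //; apply: le_lt_trans H; rewrite ler_peMl// ltW.
by rewrite pE -EFinM/= -/(p t); field; rewrite !gt_eqF.
Unshelve. all: by end_near. Qed.

End regular_tail.

Section spectral_limit.
Context (R : realType) d (T : measurableType d) (P : probability T R).
Context (V : finType) (X : V -> {RV P >-> R}) (u : V) (b : R -> R) (alpha c : R).
Context d' (T' : measurableType d') (P' : probability T' R).
Context (Th : {mfun T' >-> rvec V R}) (Pa : probability R R).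
Hypothesis alpha_gt0 : 0 < alpha.
Hypothesis c_gt0 : 0 < c.
Hypothesis Th_root : forall w, Th w u = 1.
Hypothesis Pa_pareto : is_pareto alpha Pa.
Hypothesis b_gt0 : \forall t \near +oo, 0 < b t.
Hypothesis b_rv : forall l : R, 0 < l -> b (l * t) / b t @[t --> +oo] --> l `^ alpha.
Hypothesis tail :
  ((b t)%:E * P [set w | (t < X u w)%R])%E @[t --> +oo] --> c%:E.
Hypothesis scaled : weak_cvg
  (fun t => distribution (cond_gt (X u) t) (scaled_vec X t))
  (image_measure (Pa \x distribution P' Th)%E scale_vec).

Let spec := spectral_measure P' Th alpha_gt0 (ltW c_gt0).

Lemma spectral_integralE (f : rvec V R -> R) (e : R) : 0 < e ->
  measurable_fun setT f -> (forall x, 0 <= f x) ->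
  (forall x, x u <= e -> f x = 0) ->
  (\int[spec]_x (f x)%:E = (c * e `^ (- alpha))%:E *
    \int[image_measure (Pa \x distribution P' Th) scale_vec]_x
      (f (fun v => (e * x v)%R))%:E)%E.
Proof.
move=> e0 mf f0 fe; pose D := [set x : rvec V R | e < x u].
have mD : measurable D by exact: measurable_coord_gt.
have mmul : measurable_fun setT (fun x : rvec V R => (fun v => e * x v) : rvec V R).
  by apply: measurable_rvec => v; apply: measurable_funM => //; exact: measurable_coord.
have mfE : measurable_fun setT (fun x => (f x)%:E) by exact/measurable_EFinP.
have f0E x : (0 <= (f x)%:E)%E by rewrite lee_fin.
have k0 : 0 <= c * e `^ (- alpha) by rewrite mulr_ge0 ?powR_ge0 ?ltW.
pose LY : {measure set (rvec V R) -> \bar R} :=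
  image_measure (Pa \x distribution P' Th)%E scale_vec.
transitivity (\int[spec]_(x in D) (f x)%:E)%E.
  rewrite [RHS]integral_mkcond; apply: eq_integral => x _.
  rewrite patchE; case: ifPn => //; rewrite notin_setE /D /= => /negP.
  by rewrite -leNgt => /fe ->.
rewrite -(ge0_integral_mrestr spec mD mfE f0E).
rewrite -(ge0_integral_image LY (mfun_of mmul) mfE f0E).
transitivity (\int[mscale (NngNum k0) (image_measure LY (mfun_of mmul))]_x (f x)%:E)%E;
  last by rewrite ge0_integral_mscale.
apply: eq_measure_integral => A mA _.
exact: (spectral_measure_tail P' alpha_gt0 (ltW c_gt0) Th_root Pa_pareto e0 mA).
Qed.

(** As [f] vanishes for [x u <= e], only [X u > e t] contributes: the quantity is b(t) P(X_u > et)
    times a conditional expectation given that event. The first factor converges by regular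
    variation, the second by the weak limit of the scaled vector at level [e t]. *)
Lemma spectral_limit (f : rvec V R -> R) (e K : R) : 0 < e ->
  continuous f -> (forall x, 0 <= f x <= K) ->
  (forall x, x u <= e -> f x = 0) ->
  (`|b t|%:E * \int[P]_w (f (scaled_vec X t w))%:E)%E @[t --> +oo] -->
  (\int[spec]_x (f x)%:E)%E.
Proof.
move=> e0 cf fK fe.
have f0 x : 0 <= f x by have /andP[] := fK x.
have mf : measurable_fun setT f by exact: continuous_rvec_measurable.
rewrite (spectral_integralE e0 mf f0 fe).
pose g (x : rvec V R) := f (fun v => e * x v).
have cg : continuous g.
  move=> x.
  have cm : continuous (fun x : rvec V R => (fun v => e * x v) : rvec V R).
    apply: rvec_continuous => v y; have h := @continuous_coord V R v y.
    exact: (continuous_comp h (@mulrl_continuous R e _)).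
  exact: (continuous_comp (cm x) (cf _)).
have g0 x : 0 <= g x by exact: f0.
have gK x : `|g x| <= K.
  by rewrite ger0_norm//; have /andP[] := fK (fun v => e * x v).
have bg : bounded_fun g.
  exists K; split; first exact: num_real.
  by move=> M KM x _; apply: le_trans (gK x) (ltW KM).
have mg : measurable_fun setT g by exact: continuous_rvec_measurable.
have mgE : measurable_fun setT (fun x => (g x)%:E) by exact/measurable_EFinP.
have g0E x : (0 <= (g x)%:E)%E by rewrite lee_fin.
pose p (t : R) := fine (P [set w | (t < X u w)%R]).
have cvg1 : (b t * p (e * t))%:E @[t --> +oo] --> (c * e `^ (- alpha))%:E.
  apply: cvg_EFin; first exact: nearW.
  exact: scaled_tail_cvg.
have cvg2 : (\int[cond_gt (X u) (e * t)]_w (g (scaled_vec X (e * t) w))%:E)%E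
    @[t --> +oo] --> (\int[image_measure (Pa \x distribution P' Th) scale_vec]_x (g x)%:E)%E.
  have := scaled cg bg => H A /H/(pinfty_scale e0) H'.
  apply: filterS H' => t; congr A.
  exact: (ge0_integral_image (cond_gt (X u) (e * t)) (scaled_vec X (e * t)) mgE g0E).
have fin2 : (\int[image_measure (Pa \x distribution P' Th) scale_vec]_x (g x)%:E)%E
    \is a fin_num.
  by rewrite (Rintegral_image (Pa \x distribution P' Th)%E scale_vec mg gK).
apply: cvg_trans (cvgeM _ cvg1 cvg2); last by rewrite mule_def_fin.
apply: near_eq_cvg; near=> t.
have b1 : 0 < b t by near: t.
have Pt : (0 < P [set w | (e * t < X u w)%R])%E.
  by near: t; exact: (pinfty_scale e0 (tail_gt0 c_gt0 tail)).
rewrite /= (gtr0_norm b1).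
have mgs : measurable_fun setT (fun w => (g (scaled_vec X (e * t) w))%:E).
  exact: measurableT_comp mgE (@measurable_funPT _ _ _ _ (scaled_vec X (e * t))).
rewrite [X in (_ * X)%E = _](ge0_integral_cond_gt Pt mgs (fun w => g0E _)).
rewrite -/(p (e * t)) muleA -EFinM mulfK; last first.
  by rewrite gt_eqF// /p fine_gt0// Pt/= -ge0_fin_numE// fin_num_measure//; exact: measurable_gt.
congr (_ * _)%E; rewrite integral_mkcond; apply: eq_integral => w _.
rewrite patchE; case: ifPn => [_|].
  congr (f _)%:E; apply/funext => v; rewrite /scaled_vec.
  by field; rewrite !gt_eqF.
rewrite notin_setE /= => /negP; rewrite -leNgt => Xe.
by rewrite fe// /scaled_vec ler_pdivrMr.
Unshelve. all: by end_near. Qed.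

End spectral_limit.

(** * Gluing the limit measures *)

Section quadrants.
Context (V : finType) (R : realType).

(** Chosen as pi-system because intersections take maxima of corners, and because the indicators are
    increasing limits of continuous functions vanishing off the quadrant, to which the limits along
    test functions apply. *)
Definition quadrant (a : V -> R) : set (rvec V R) := [set x | forall v, a v < x v].

Lemma measurable_quadrant a : measurable (quadrant a).
Proof.
have mB v : measurable (`]a v, +oo[%classic : set R) by [].
have := measurable_cylinder (@measurable_id _ (rvec V R) setT) mB.
congr (measurable _); apply/seteqP; split => x H v; have := H v;
  by rewrite /= in_itv/= andbT.
Qed.

Lemma quadrantI a a' :
  quadrant a `&` quadrant a' = quadrant (fun v => Num.max (a v) (a' v)).
Proof.
apply/seteqP; split => [x [H H'] v|x H]; first by rewrite gt_max H H'.
by split => v; have := H v; rewrite gt_max => /andP[].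
Qed.

Lemma quadrants_cover : \bigcup_n quadrant (fun=> - n%:R) = setT.
Proof.
apply/seteqP; split => // x _; exists (Num.truncn (\sum_v `|x v|)).+1 => // v.
rewrite ltrNl (le_lt_trans _ (truncnS_gt _))// (le_trans (ler_norm _))//.
by rewrite normrN (bigD1 v)//= lerDl sumr_ge0.
Qed.

Lemma quadrants_generate :
  @measurable _ (rvec V R) = <<s range quadrant >>.
Proof.
apply/seteqP; split; last first.
  apply: smallest_sub; first exact: sigma_algebra_measurable.
  by move=> _ [a _ <-]; exact: measurable_quadrant.
pose Tb := g_sigma_algebraType (range quadrant).
have gen a : measurable (quadrant a : set Tb).
  by apply: sub_sigma_algebra; exists a.
have mid : measurable_fun setT (id : Tb -> rvec V R).
  apply: measurable_rvec => v.
  apply: (measurability _ (RGenOInfty.measurableE R)) => _ [_ [r ->] <-].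
  rewrite setTI (_ : _ @^-1` _ =
      \bigcup_n quadrant (fun w => if w == v then r else - n%:R)).
    by apply: bigcupT_measurable => n; exact: gen.
  apply/seteqP; split => x; rewrite /= in_itv/= andbT; last first.
    by move=> [n _ /(_ v)]; rewrite eqxx.
  move=> rx; have : (\bigcup_n quadrant (fun=> - n%:R)) x by rewrite quadrants_cover.
  by move=> [n _ nx]; exists n => // w; case: eqP => // ->.
by move=> A mA; have := mid measurableT A mA; rewrite setTI.
Qed.

Lemma quadrants_unique (m1 m2 : {measure set (rvec V R) -> \bar R}) :
  (forall a, m1 (quadrant a) = m2 (quadrant a)) ->
  (forall a, (m1 (quadrant a) < +oo)%E) ->
  forall A, measurable A -> m1 A = m2 A.
Proof.
move=> m12 fin; apply: (measure_unique (range quadrant) (fun n => quadrant (fun=> - n%:R))).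
- exact: quadrants_generate.
- by move=> _ _ [a _ <-] [a' _ <-]; rewrite quadrantI; exists (fun v => Num.max (a v) (a' v)).
- by move=> n; exists (fun=> - n%:R).
- exact: quadrants_cover.
- by move=> _ [a _ <-]; exact: m12.
- by move=> n; exact: fin.
Qed.

(** The truncated linear ramps start exactly at the corner, so the approximation is from inside. *)
Definition quadrant_approx (a : V -> R) (n : nat) (x : rvec V R) : R :=
  \prod_v Num.min 1 (Num.max 0 (n%:R * (x v - a v))).

Lemma quadrant_approx01 a n x : 0 <= quadrant_approx a n x <= 1.
Proof.
rewrite /quadrant_approx; apply/andP; split.
  by apply: prodr_ge0 => v _; rewrite le_min ler01 le_max lexx.
apply: prodr_ile1 => v _.
by rewrite le_min ler01 le_max lexx/= ge_min lexx.
Qed.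

Lemma quadrant_approx0 a n x v : x v <= a v -> quadrant_approx a n x = 0.
Proof.
move=> xa; rewrite /quadrant_approx (bigD1 v)//= [X in X * _](_ : _ = 0) ?mul0r//.
have le0 : n%:R * (x v - a v) <= 0 by rewrite mulr_ge0_le0 ?subr_le0.
by rewrite max_l// min_r.
Qed.

Lemma quadrant_approx_homo a x m n : (m <= n)%N ->
  quadrant_approx a m x <= quadrant_approx a n x.
Proof.
move=> mn; have [H|/existsNP[v /negP]] := pselect (quadrant a x); last first.
  by rewrite -leNgt => xa; rewrite !(quadrant_approx0 _ xa).
apply: ler_prod => v _; rewrite le_min ler01 le_max lexx/=.
rewrite le_min ge_min lexx/= ge_min; apply/orP; right.
rewrite ge_max le_max lexx/= le_max; apply/orP; right.
by rewrite ler_wpM2r ?ler_nat// subr_ge0 ltW.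
Qed.

Lemma quadrant_approx_cvg a x :
  quadrant_approx a n x @[n --> \oo] --> (\1_(quadrant a) x : R).
Proof.
have [H|N] := pselect (quadrant a x); last first.
  rewrite indicE memNset//; move/existsNP : N => [v /negP]; rewrite -leNgt => xa.
  by under eq_fun do rewrite (quadrant_approx0 _ xa); exact: cvg_cst.
rewrite indicE mem_set//=.
have near1 v : \forall n \near \oo, Num.min 1 (Num.max 0 (n%:R * (x v - a v))) = 1.
  near=> n; rewrite min_l// le_max; apply/orP; right.
  have xa : 0 < x v - a v by rewrite subr_gt0.
  rewrite -ler_pdivrMr// mul1r.
  by near: n; exact: nbhs_infty_ger.
apply: cvg_near_cst; apply: filterS (filter_forall _ near1) => n Hn.
by rewrite /quadrant_approx big1.
Unshelve. all: by end_near. Qed.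

Lemma continuous_prod_rvec (I : Type) (s : seq I) (f : I -> rvec V R -> R) :
  (forall i, continuous (f i)) -> continuous (fun x => \prod_(i <- s) f i x).
Proof.
move=> cf; elim: s => [|i s IH] x.
  by under eq_fun do rewrite big_nil; exact: cst_continuous.
under eq_fun do rewrite big_cons.
exact: (continuousM (@cf i x) (IH x)).
Qed.

Lemma continuous_quadrant_approx a n : continuous (quadrant_approx a n).
Proof.
apply: continuous_prod_rvec => v x.
have cg : continuous (fun r : R => Num.min 1 (Num.max 0 (n%:R * (r - a v)))).
  have c1 : continuous (fun r : R => n%:R * (r - a v)).
    by move=> r; apply: cvgMr; apply: cvgB; [exact: cvg_id|exact: cvg_cst].
  move=> r; have k1 := @cst_continuous R R 1 r; have k0 := @cst_continuous R R 0 r.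
  exact: (continuous_min k1 (continuous_max k0 (c1 r))).
exact: continuous_comp (@continuous_coord V R v x) (cg _).
Qed.

Lemma quadrant_integral_cvg (m : {measure set (rvec V R) -> \bar R}) a :
  (\int[m]_x (quadrant_approx a n x)%:E)%E @[n --> \oo] --> m (quadrant a).
Proof.
have mq n : measurable_fun setT (quadrant_approx a n).
  by apply: continuous_rvec_measurable => x; exact: continuous_quadrant_approx.
rewrite [X in _ --> X](measure_integral_indic _ (measurable_quadrant a)).
have -> : (\int[m]_x (\1_(quadrant a) x)%:E =
    \int[m]_x limn (fun n => (quadrant_approx a n x)%:E))%E.
  apply: eq_integral => x _; apply/esym/cvg_lim => //.
  apply: cvg_EFin; first exact: nearW.
  exact: quadrant_approx_cvg.
apply: cvg_monotone_convergence => //.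
- by move=> n; exact/measurable_EFinP.
- by move=> n x _; rewrite lee_fin; have /andP[] := quadrant_approx01 a n x.
- by move=> x _ m' n mn; rewrite lee_fin; exact: quadrant_approx_homo.
Qed.

End quadrants.

Section glued_measure.
Context (V : finType) (R : realType) (U : {set V}).
Variables (S : R -> (rvec V R -> R) -> \bar R).
Variables (nu : V -> {measure set (rvec V R) -> \bar R}).
Hypothesis nu_limit : forall u (f : rvec V R -> R) (e K : R), u \in U -> 0 < e ->
  continuous f -> (forall x, 0 <= f x <= K) -> (forall x, x u <= e -> f x = 0) ->
  S t f @[t --> +oo] --> (\int[nu u]_x (f x)%:E)%E.
Hypothesis nu_fin : forall u (e : R), u \in U -> 0 < e ->
  (nu u [set x | (e < x u)%R] < +oo)%E.
Hypothesis nu_supp : forall u, u \in U ->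
  nu u (~` (@orthant V R `&` [set x | 0 < x u])) = 0%E.

(** Intersecting a quadrant with the region raises its corner to at least [e] at [u] and [v]. Its
    approximations then qualify as test functions for both [nu u] and [nu v], and both integrals are
    the limit of the same [S t]. *)
Let consistent_gt (u v : V) (e : R) (A : set (rvec V R)) :
  u \in U -> v \in U -> 0 < e -> measurable A ->
  nu u (A `&` [set x : rvec V R | e < x u /\ e < x v]) =
  nu v (A `&` [set x : rvec V R | e < x u /\ e < x v]).
Proof.
move=> uU vU e0; have mD : measurable [set x : rvec V R | e < x u /\ e < x v].
  by apply: measurableI; exact: measurable_coord_gt.
pose q (a : V -> R) w := if (w == u) || (w == v) then Num.max (a w) e else a w.
have qE a : quadrant a `&` [set x : rvec V R | e < x u /\ e < x v] = quadrant (q a).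
  apply/seteqP; split => x.
    move=> [ax [eu ev]] w; rewrite /q.
    by case: ifP => // /orP[/eqP->|/eqP->]; rewrite gt_max ax ?eu ?ev.
  move=> H; have H1 w : a w < x w.
    by have := H w; rewrite /q; case: ifP => // _; rewrite gt_max => /andP[].
  split => //; split.
    by have := H u; rewrite /q eqxx gt_max => /andP[].
  by have := H v; rewrite /q eqxx orbT gt_max => /andP[].
move: A; apply: (@quadrants_unique V R (mrestr (nu u) mD) (mrestr (nu v) mD)) => a.
  rewrite [LHS](congr1 (nu u) (qE a)) [RHS](congr1 (nu v) (qE a)).
  have H w : w \in U -> e <= q a w -> forall n,
      S t (quadrant_approx (q a) n) @[t --> +oo] -->
      (\int[nu w]_x (quadrant_approx (q a) n x)%:E)%E.
    move=> wU eqa n; apply: (@nu_limit w _ e 1) => //.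
    - exact: continuous_quadrant_approx.
    - exact: quadrant_approx01.
    - by move=> x xe; apply: quadrant_approx0 (le_trans xe eqa).
  have eu : e <= q a u by rewrite /q eqxx le_max lexx orbT.
  have ev : e <= q a v by rewrite /q eqxx orbT le_max lexx orbT.
  have E : (fun n => \int[nu u]_x (quadrant_approx (q a) n x)%:E)%E =
           (fun n => \int[nu v]_x (quadrant_approx (q a) n x)%:E)%E.
    apply/funext => n; apply: (cvg_unique _ (H u uU eu n) (H v vU ev n)).
    exact: (@ereal_hausdorff R).
  have := @quadrant_integral_cvg V R (nu u) (q a); rewrite E => H1.
  have H2 := @quadrant_integral_cvg V R (nu v) (q a).
  apply: (cvg_unique _ H1 H2); exact: (@ereal_hausdorff R).
apply: le_lt_trans (nu_fin uU e0).
apply: le_measure; rewrite ?inE//.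
- by apply: measurableI => //; exact: measurable_quadrant.
- exact: measurable_coord_gt.
- by move=> x [_ []].
Qed.

(** Continuity from below along the thresholds 1 / (n + 1). *)
Lemma consistent (u v : V) (A : set (rvec V R)) : u \in U -> v \in U -> measurable A ->
  nu u (A `&` [set x : rvec V R | 0 < x u /\ 0 < x v]) =
  nu v (A `&` [set x : rvec V R | 0 < x u /\ 0 < x v]).
Proof.
move=> uU vU mA.
pose D (n : nat) := A `&` [set x : rvec V R | n.+1%:R^-1 < x u /\ n.+1%:R^-1 < x v].
have mD n : measurable (D n).
  by apply: measurableI => //; apply: measurableI; exact: measurable_coord_gt.
have Dn : nondecreasing_seq D.
  move=> m n mn; apply/subsetPset => x [Ax [xu xv]]; split => //.
  have le : n.+1%:R^-1 <= m.+1%:R^-1 :> R by rewrite lef_pV2 ?posrE// ler_nat.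
  by split; exact: le_lt_trans le _.
have DE : A `&` [set x : rvec V R | 0 < x u /\ 0 < x v] = \bigcup_n D n.
  apply/seteqP; split => x.
    move=> [Ax [xu xv]].
    have m0 : 0 < Num.min (x u) (x v) by rewrite lt_min xu.
    exists (Num.truncn (Num.min (x u) (x v))^-1) => //; split => //.
    have : (Num.truncn (Num.min (x u) (x v))^-1).+1%:R^-1 < Num.min (x u) (x v).
      by rewrite -[ltRHS]invrK ltf_pV2 ?posrE ?invr_gt0//; exact: truncnS_gt.
    by rewrite lt_min => /andP[].
  have p0 n : 0 < n.+1%:R^-1 :> R by rewrite invr_gt0.
  by move=> [n _ [Ax [xu xv]]]; split => //; split; exact: lt_trans (p0 n) _.
have mU : measurable (\bigcup_n D n) by exact: bigcup_measurable.
have H w := @nondecreasing_cvg_mu _ _ _ (nu w) D mD mU Dn.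
rewrite DE; have E : nu u \o D = nu v \o D.
  by apply/funext => n; apply: consistent_gt => //; rewrite invr_gt0.
have := H u; rewrite E => H1.
by apply: (cvg_unique _ H1 (H v)); exact: (@ereal_hausdorff R).
Qed.

Variable u0 : V.
Hypothesis u0U : u0 \in U.

(** The default [u0] keeps every [un k] in [U], also for [k] beyond the size of [U]. *)
Let un (k : nat) := nth u0 (enum U) k.

Let unU k : un k \in U.
Proof.
rewrite /un; have [kU|kU] := ltnP k (size (enum U)); last by rewrite nth_default.
by rewrite -mem_enum mem_nth.
Qed.

(** Points with a positive coordinate in [U] are classified by the first such coordinate; on
    disjoint pieces the measures can be added without counting overlaps twice. *)
Let first_pos (k : nat) : set (rvec V R) :=
  [set x | 0 < x (un k)] `&` \bigcap_(j in [set j | (j < k)%N]) ~` [set x | 0 < x (un j)].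

Let mfirst k : measurable (first_pos k).
Proof.
apply: measurableI; first exact: measurable_coord_gt.
apply: fin_bigcap_measurable; first exact: finite_II.
by move=> j _; apply: measurableC; exact: measurable_coord_gt.
Qed.

Let first_disj : trivIset setT first_pos.
Proof.
apply/trivIsetP => i j _ _; wlog ij : i j / (i < j)%N => [W neq|_].
  case: (ltngtP i j) => ij; first exact: W.
    by rewrite setIC; apply: W => //; rewrite eq_sym.
  by rewrite ij eqxx in neq.
apply/seteqP; split => // x [[xi _] [_ /(_ i ij)]]; exact.
Qed.

Let first_cover u : u \in U ->
  [set x : rvec V R | 0 < x u] `<=` \big[setU/set0]_(k < #|U|) first_pos k.
Proof.
move=> uU x xu; rewrite -bigcup_mkord.
have ex : exists k, (k < #|U|)%N && (0 < x (un k)).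
  exists (index u (enum U)); rewrite /un nth_index ?mem_enum// xu andbT.
  by rewrite cardE index_mem mem_enum.
case: (ex_minnP ex) => k /andP[kU xk] kmin; exists k => //; split => // j jk /=.
move=> xj; have := kmin j; rewrite xj (ltn_trans jk kU) => /(_ isT).
by rewrite leqNgt jk.
Qed.

Definition glued_measure : {measure set (rvec V R) -> \bar R} :=
  msum (fun k => mrestr (nu (un k)) (mfirst k)) #|U|.

(** On [first_pos k] within [0 < x u] both [x u] and [x (un k)] are positive, so [consistent]
    exchanges [nu (un k)] for [nu u] piece by piece. *)
Lemma glued_measureE u (B : set (rvec V R)) : u \in U -> measurable B ->
  glued_measure (B `&` [set x | 0 < x u]) = nu u (B `&` [set x | 0 < x u]).
Proof.
move=> uU mB; pose C := B `&` [set x : rvec V R | 0 < x u].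
have mC : measurable C by apply: measurableI => //; exact: measurable_coord_gt.
have CE : C = \big[setU/set0]_(k < #|U|) (C `&` first_pos k).
  rewrite -big_distrr/=; apply/esym/setIidPl.
  by move=> x [_ xu]; exact: first_cover xu.
rewrite -/C [RHS](congr1 (nu u) CE) measure_semi_additive_ord; last 3 first.
- by move=> k; apply: measurableI.
- apply/trivIsetP => i j _ _ ij; rewrite setIACA.
  by move/trivIsetP : first_disj => /(_ i j I I ij) ->; rewrite setI0.
- by rewrite -CE.
apply: eq_bigr => k _.
have := @consistent u (un k) (C `&` first_pos k) uU (unU k) (measurableI _ _ mC (mfirst k)).
have -> : C `&` first_pos k `&` [set x | 0 < x u /\ 0 < x (un k)] = C `&` first_pos k.
  by apply/setIidPl => x [[_ xu] [xk _]].
by move=> /esym.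
Qed.

Lemma glued_measure_supp : glued_measure (~` orthant0 U) = 0%E.
Proof.
rewrite /glued_measure /= /msum big1// => k _.
apply/eqP; rewrite eq_le measure_ge0 andbT -(nu_supp (unU k)).
have mp : measurable (@orthant V R `&` [set x | 0 < x (un k)]).
  by apply: measurableI; [exact: measurable_orthant|exact: measurable_coord_gt].
have mN : measurable (~` orthant0 U : set (rvec V R)).
  by apply: measurableC; exact: measurable_orthant0.
apply: le_measure; rewrite ?inE.
- by apply: measurableI.
- exact: measurableC.
- move=> x [nx [xk _]] [ox _]; apply: nx; split => //.
  by apply: lt_le_trans xk _; exact: (le_bigmax_cond _ _ (unU k)).
Qed.

Lemma glued_measure_fin (B : set (rvec V R)) (eps : R) : 0 < eps -> measurable B ->
  B `<=` @orthant V R `&` [set x | eps <= max_on U x] -> (glued_measure B < +oo)%E.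
Proof.
(* [nu_fin] concerns strict inequalities, so a maximum of at least [eps] is relaxed to some
   coordinate above [eps / 2]; finitely many such sets cover [B]. *)
move=> e0 mB Be; have e2 : 0 < eps / 2 by rewrite divr_gt0.
pose D k : set (rvec V R) := [set x | eps / 2 < x (un k)].
have mD k : measurable (D k) by exact: measurable_coord_gt.
have BD : B `<=` \big[setU/set0]_(k < #|U|) D k.
  move=> x /Be[_ /= ex]; rewrite -bigcup_mkord; apply: contrapT => nx.
  have : max_on U x <= eps / 2.
    apply/bigmax_leP; split; first exact: ltW.
    move=> u uU; rewrite leNgt; apply/negP => xu; apply: nx.
    exists (index u (enum U)); first by rewrite /= cardE index_mem mem_enum.
    by rewrite /D/= /un nth_index ?mem_enum.
  apply/negP; rewrite -ltNge (lt_le_trans _ ex)//.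
  by rewrite ltr_pdivrMr// ltr_pMr// ltr1n.
have mU : measurable (\big[setU/set0]_(k < #|U|) D k) by exact: bigsetU_measurable.
apply: (@le_lt_trans _ _ (glued_measure (\big[setU/set0]_(k < #|U|) D k))).
  by apply: le_measure => //; rewrite inE.
apply: le_lt_trans (Boole_inequality _ _) _ => //.
apply: lte_sum_pinfty => k _.
have -> : D k = D k `&` [set x | 0 < x (un k)].
  by apply/esym/setIidPl => x; exact: lt_trans.
rewrite [X in (X < _)%E](glued_measureE (unU k) (mD k)).
apply: le_lt_trans (nu_fin (unU k) e2).
apply: le_measure; [rewrite inE|rewrite inE; exact: mD|by move=> x []].
by apply: measurableI; [exact: mD|exact: measurable_coord_gt].
Qed.

End glued_measure.

(** * Convergence on the punctured orthant *)

Section test_functions.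
Context (V : finType) (R : realType) (W : {set V}).

(** Retraction onto the orthant: composing with it extends test functions continuously to the points
    of R^V with positive [max_on], which it preserves. *)
Definition vpos (x : rvec V R) : rvec V R := fun v => pospart (x v).

Lemma le_max_on (x : rvec V R) w : w \in W -> x w <= max_on W x.
Proof. by move=> wW; exact: (le_bigmax_cond _ _ wW). Qed.

Lemma max_on_ge0 (x : rvec V R) : 0 <= max_on W x.
Proof. exact: bigmax_ge_id. Qed.

Lemma max_on_vpos x : max_on W (vpos x) = max_on W x.
Proof.
apply/eqP; rewrite eq_le; apply/andP; split.
  apply/bigmax_leP; split; first exact: max_on_ge0.
  by move=> w wW; rewrite /vpos /pospart ge_max max_on_ge0 le_max_on.
apply/bigmax_leP; split; first exact: max_on_ge0.
by move=> w wW; apply: le_trans (le_max_on (vpos x) wW); rewrite /vpos /pospart le_max lexx.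
Qed.

Lemma orthant_vpos x : orthant (vpos x).
Proof. by move=> v; exact: pospart_ge0. Qed.

Lemma vpos_id x : orthant x -> vpos x = x.
Proof. by move=> x0; apply/funext => v; rewrite /vpos pospart_id. Qed.

Lemma continuous_vpos : continuous vpos.
Proof.
apply: rvec_continuous => v x.
have cp : continuous (@pospart R).
  by apply: (@lipschitz_cts R (@pospart R) 1) => r s; rewrite mul1r; exact: pospart_lip.
exact: continuous_comp (@continuous_coord V R v x) (cp _).
Qed.

Lemma continuous_max_on : continuous (@max_on V R W).
Proof.
rewrite /max_on; elim: (index_enum V) => [|v s IH] x.
  by under eq_fun do rewrite big_nil; exact: cst_continuous.
under eq_fun do rewrite big_cons; case: ifP => _; last exact: IH.
exact: (continuous_max (@continuous_coord V R v x) (IH x)).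
Qed.

Variables (h : rvec V R -> R) (e K : R).
Hypothesis e_gt0 : 0 < e.
Hypothesis K_ge0 : 0 <= K.
Hypothesis h_cont : {within orthant0 W, continuous h}.
Hypothesis hK : forall x, orthant0 W x -> 0 <= h x <= K.
Hypothesis h_small : forall x, orthant0 W x -> max_on W x <= e -> h x = 0.

Let excess w (x : rvec V R) := pospart (x w - e / 2).

Let total x := \sum_(w in W) excess w x.

(** Partition of unity for the sets where [x w > e / 2]. The weights start at [e / 2] while [h]
    vanishes up to [e], so the zeros of [total] are masked by those of [h]. Where [total] is 0 the
    quotient is 0 by convention. *)
Definition test_piece w x := h (vpos x) * (excess w x / total x).

Let e2 : 0 < e / 2. Proof. by rewrite divr_gt0. Qed.

Let excess_ge0 w x : 0 <= excess w x. Proof. exact: pospart_ge0. Qed.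

Let excess0 w x : x w <= e / 2 -> excess w x = 0.
Proof. by move=> xw; rewrite /excess /pospart max_r// subr_le0. Qed.

Let excess_out w x : w \in W -> ~ orthant0 W (vpos x) -> excess w x = 0.
Proof.
move=> wW nx; apply: excess0; apply: le_trans (le_max_on x wW) _.
rewrite leNgt; apply/negP => xe; apply: nx; split; first exact: orthant_vpos.
by rewrite /= max_on_vpos (lt_trans e2).
Qed.

Let le_total w x : w \in W -> excess w x <= total x.
Proof. by move=> wW; rewrite /total (bigD1 w)//= lerDl sumr_ge0. Qed.

Let total_gt0 x : e / 2 < max_on W x -> 0 < total x.
Proof.
move=> xe; rewrite lt_neqAle sumr_ge0// andbT; apply/eqP => tot0.
move: xe; apply/negP; rewrite -leNgt; apply/bigmax_leP; split; first exact: ltW.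
move=> w wW; rewrite leNgt; apply/negP => xw.
have := le_total x wW; rewrite -tot0 /excess /pospart leNgt.
by rewrite lt_max subr_gt0 xw.
Qed.

Let ratio01 w x : w \in W -> 0 <= excess w x / total x <= 1.
Proof.
move=> wW; have [->|t0] := eqVneq (total x) 0; first by rewrite invr0 mulr0 lexx ler01.
have t1 : 0 < total x by rewrite lt0r t0 sumr_ge0.
by rewrite divr_ge0 ?(ltW t1)//= ler_pdivrMr// mul1r le_total.
Qed.

Lemma test_piece_bounds w x : w \in W -> 0 <= test_piece w x <= K.
Proof.
move=> wW; have /andP[r0 r1] := ratio01 x wW; rewrite /test_piece.
have [ox|nx] := pselect (orthant0 W (vpos x)); last first.
  by rewrite excess_out// mul0r mulr0 lexx.
have /andP[h0 hk] := hK ox; rewrite mulr_ge0//=.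
by apply: le_trans hk; rewrite ler_piMr.
Qed.

Lemma test_piece_small w x : x w <= e / 2 -> test_piece w x = 0.
Proof. by move=> xw; rewrite /test_piece excess0// mul0r mulr0. Qed.

Lemma test_piece_sum x : orthant x ->
  \sum_(w in W) test_piece w x = h x * \1_(orthant0 W) x.
Proof.
move=> ox; rewrite /test_piece (vpos_id ox) -mulr_sumr -mulr_suml -/(total x).
rewrite indicE; have [ox0|nx] := pselect (orthant0 W x); last first.
  rewrite memNset// mulr0 (_ : total x = 0) ?mul0r ?mulr0//.
  by rewrite /total big1// => w wW; apply: excess_out; rewrite ?vpos_id.
rewrite mem_set//; have [xe|xe] := leP (max_on W x) e.
  by rewrite h_small// !mul0r.
by rewrite mulfV// gt_eqF// total_gt0// (lt_trans _ xe)// ltr_pdivrMr// ltr_pMr// ltr1n.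
Qed.

(** Where the maximum exceeds [e / 2] the denominator is positive; elsewhere the maximum stays under
    [e] nearby, and the piece is locally 0. *)
Lemma test_piece_continuous w : w \in W -> continuous (test_piece w).
Proof.
move=> wW x.
have cex v : continuous (excess v).
  have cp : continuous (fun r => pospart (r - e / 2)).
    apply: (@lipschitz_cts R _ 1) => r s; rewrite mul1r.
    by apply: le_trans (pospart_lip _ _) _; rewrite opprB addrA subrK.
  by move=> y; exact: continuous_comp (@continuous_coord V R v y) (cp _).
have ctot : continuous total.
  rewrite /total; elim: (index_enum V) => [|v s IH] y.
    by under eq_fun do rewrite big_nil; exact: cst_continuous.
  under eq_fun do rewrite big_cons; case: ifP => _; last exact: IH.
  exact: (continuousD (cex v y) (IH y)).
have cm : max_on W y @[y --> x] --> max_on W x by exact: continuous_max_on.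
have [xe|xe] := ltP (e / 2) (max_on W x); last first.
  have xe' : max_on W x < e.
    by apply: le_lt_trans xe _; rewrite ltr_pdivrMr// ltr_pMr// ltr1n.
  have nearx : \forall y \near x, max_on W y < e.
    exact: (cm [set r | r < e] (lt_nbhsl xe')).
  have piece0 y : max_on W y < e -> test_piece w y = 0.
    move=> ye; rewrite /test_piece.
    have [oy|ny] := pselect (orthant0 W (vpos y)).
      by rewrite h_small ?mul0r// max_on_vpos ltW.
    by rewrite excess_out// mul0r mulr0.
  rewrite /continuous_at (piece0 _ xe'); move=> A /nbhs_singleton A0.
  by apply: filterS nearx => y /piece0 /= ->.
have ox : orthant0 W (vpos x).
  by split; [exact: orthant_vpos|rewrite /= max_on_vpos (lt_trans e2)].
have ch : (h \o vpos) y @[y --> x] --> (h \o vpos) x.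
  move=> A /= /((proj1 (subspace_continuousP _ _)) h_cont _ ox) Ah.
  have near1 : \forall y \near x, 0 < max_on W y.
    exact: (cm [set r | 0 < r] (lt_nbhsr (lt_trans e2 xe))).
  have near2 := continuous_vpos Ah.
  apply: filterS2 near1 near2 => y y0; apply; split; first exact: orthant_vpos.
  by rewrite /= max_on_vpos.
apply: (cvgM ch); apply: (cvgM (cex w x)); apply: cvgV; last exact: ctot.
by rewrite gt_eqF// total_gt0.
Qed.

End test_functions.

(** The topology is pulled back along [M0_eval] from a product topology, so test functions can be
    treated one at a time. *)
Lemma cvg_M0 (V : finType) (R : realType) (W : {set V}) (nu_ : R -> M0 R W)
    (nu : M0 R W) :
  (forall f, M0_test W f ->
    \int[nu_ t]_(x in orthant0 W) f x @[t --> +oo] -->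
    \int[nu]_(x in orthant0 W) f x) ->
  nu_ t @[t --> +oo] --> nu.
Proof.
move=> H A; rewrite nbhsE => -[B [[C oC CB] Bnu] BA].
have Cnu : nbhs (M0_eval nu : {ptws _ -> R}) C.
  by apply: open_nbhs_nbhs; split => //; move: Bnu; rewrite -CB.
have ev : M0_eval (nu_ t) @[t --> +oo] --> (M0_eval nu : {ptws {f | M0_test W f} -> R}).
  apply/cvg_sup => -[f tf] D; rewrite nbhsE => -[_ [[G oG <-] Gx] GD].
  have nG : nbhs (\int[nu]_(x in orthant0 W) f x) G by exact: open_nbhs_nbhs.
  have [t0 [t0r Ht0]] := H f tf G nG; exists t0; split => // t /Ht0 Gt.
  exact: GD.
have [t0 [t0r Ht0]] := ev C Cnu; exists t0; split => // t /Ht0 Ct.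
by apply: BA; rewrite -CB.
Qed.

Lemma ge0_integral_agree d (T : measurableType d) (R : realType)
    (m1 m2 : {measure set T -> \bar R}) (D : set T) (g : T -> \bar R) :
  measurable D -> (forall A, measurable A -> m1 (A `&` D) = m2 (A `&` D)) ->
  measurable_fun setT g -> (forall x, 0 <= g x)%E ->
  (\int[m1]_(x in D) g x = \int[m2]_(x in D) g x)%E.
Proof.
move=> mD E mg g0; rewrite -!(ge0_integral_mrestr _ mD)//.
by apply: eq_measure_integral => A mA _; exact: E.
Qed.

Lemma ge0_integral_sum_in d (T : measurableType d) (R : realType)
    (m : {measure set T -> \bar R}) (D : set T) (I : finType) (W : {set I})
    (f : I -> T -> \bar R) : measurable D ->
  (forall i, i \in W -> measurable_fun setT (f i)) ->
  (forall i x, i \in W -> 0 <= f i x)%E ->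
  (\int[m]_(x in D) \sum_(i in W) f i x = \sum_(i in W) \int[m]_(x in D) f i x)%E.
Proof.
move=> mD mf f0.
pose f' i x := if i \in W then f i x else 0%E.
transitivity (\int[m]_(x in D) \sum_(i : I) f' i x)%E.
  by apply: eq_integral => x _; rewrite big_mkcond.
rewrite ge0_integral_sum//.
- rewrite [RHS]big_mkcond; apply: eq_bigr => i _; rewrite /f'.
  by case: ifP => // _; rewrite integral0.
- move=> i; rewrite /f'; case: (boolP (i \in W)) => // iW.
  exact: measurable_funTS (mf i iW).
- by move=> i x _; rewrite /f'; case: ifP => // iW; exact: f0.
Qed.

Section M0_convergence.
Context (R : realType) d (T : measurableType d) (P : probability T R).
Context (V : finType) (X : V -> {RV P >-> R}) (b : R -> R) (W : {set V}).
Variables (nu : V -> {measure set (rvec V R) -> \bar R}) (nuW : M0 R W).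
Hypothesis X_ge0 : forall v w, 0 <= X v w.
Hypothesis nu_limit : forall u (f : rvec V R -> R) (e K : R), u \in W -> 0 < e ->
  continuous f -> (forall x, 0 <= f x <= K) -> (forall x, x u <= e -> f x = 0) ->
  (`|b t|%:E * \int[P]_w (f (scaled_vec X t w))%:E)%E @[t --> +oo] -->
  (\int[nu u]_x (f x)%:E)%E.
Hypothesis nu_fin : forall u (e : R), u \in W -> 0 < e ->
  (nu u [set x | (e < x u)%R] < +oo)%E.
Hypothesis nuW_nu : forall u (B : set (rvec V R)), u \in W -> measurable B ->
  nuW (B `&` [set x | 0 < x u]) = nu u (B `&` [set x | 0 < x u]).

Section nonnegative_test.
Variables (h : rvec V R -> R) (e K : R).
Hypothesis e_gt0 : 0 < e.
Hypothesis K_ge0 : 0 <= K.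
Hypothesis h_cont : {within orthant0 W, continuous h}.
Hypothesis hK : forall x, orthant0 W x -> 0 <= h x <= K.
Hypothesis h_small : forall x, orthant0 W x -> max_on W x <= e -> h x = 0.

Let g := test_piece W h e.

Let g_cont w : w \in W -> continuous (g w).
Proof. exact: (test_piece_continuous e_gt0 h_cont h_small). Qed.

Let gK w x : w \in W -> 0 <= g w x <= K.
Proof. exact: (test_piece_bounds e_gt0 K_ge0 hK). Qed.

Let g0 w x : w \in W -> (0 <= (g w x)%:E)%E.
Proof. by move=> wW; rewrite lee_fin; have /andP[] := gK x wW. Qed.

Let mg w : w \in W -> measurable_fun setT (fun x => (g w x)%:E).
Proof.
move=> wW; apply/measurable_EFinP; apply: continuous_rvec_measurable => x.
exact: g_cont.
Qed.

Let e2 : 0 < e / 2. Proof. by rewrite divr_gt0. Qed.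

Let mO := @measurable_orthant0 V R W.

Let sum_g x : orthant x ->
  (\sum_(w in W) (g w x)%:E = (h x)%:E * (\1_(orthant0 W) x)%:E)%E.
Proof.
by move=> ox; rewrite sumEFin -EFinM (test_piece_sum e_gt0 h_small ox).
Qed.

Let mpiece w : w \in W ->
  measurable_fun setT ((fun x => (g w x)%:E) \_ (orthant0 W)).
Proof.
move=> wW; apply/(measurable_restrictT _ mO); exact: measurable_funTS (mg wW).
Qed.

(** The piece vanishes unless [x w > e / 2], so it only sees [0 < x w], where the two measures
    agree. *)
Let integral_piece w : w \in W ->
  (\int[nuW]_(x in orthant0 W) (g w x)%:E = \int[nu w]_x (g w x)%:E)%E.
Proof.
move=> wW; have mD := measurable_coord_gt w (0 : R).
have restr (m : {measure set (rvec V R) -> \bar R}) :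
    (\int[m]_(x in [set x : rvec V R | (0 < x w)%R]) (g w x)%:E = \int[m]_x (g w x)%:E)%E.
  rewrite [LHS]integral_mkcond; apply: eq_integral => x _.
  rewrite patchE; case: ifPn => //; rewrite notin_setE /= => /negP.
  rewrite -leNgt => xw; rewrite /g (@test_piece_small _ _ W h e w x)//.
  exact: le_trans xw (ltW e2).
transitivity (\int[nuW]_x (g w x)%:E)%E.
  rewrite [LHS]integral_mkcond; apply: ae_eq_integral => //.
  - exact: mpiece.
  - exact: mg.
  - exists (~` orthant0 W); split; [exact: measurableC|exact: M0_supp|].
    move=> x; apply: contra_not => /= ox _.
    by rewrite patchE mem_set.
rewrite -(restr nuW) -(restr (nu w)); apply: ge0_integral_agree => //.
- by move=> A mA; exact: nuW_nu.
- exact: mg.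
- by move=> x; exact: g0.
Qed.

Lemma test_integral_nu : (\int[nuW]_(x in orthant0 W) (h x)%:E =
  \sum_(w in W) \int[nu w]_x (g w x)%:E)%E.
Proof.
transitivity (\int[nuW]_(x in orthant0 W) \sum_(w in W) (g w x)%:E)%E.
  apply: eq_integral => x; rewrite inE => ox.
  by rewrite sum_g ?indicE ?mem_set ?mule1//; case: ox.
rewrite (ge0_integral_sum_in _ mO mg (fun w x => @g0 w x)).
by apply: eq_bigr => w wW; exact: integral_piece.
Qed.

Lemma test_integral_fin w : w \in W -> (\int[nu w]_x (g w x)%:E)%E \is a fin_num.
Proof.
move=> wW; have mD := measurable_coord_gt w (e / 2).
rewrite ge0_fin_numE; last by apply: integral_ge0 => x _; exact: g0.
have mI : measurable_fun setT (fun x => (\1_[set x : rvec V R | (e / 2 < x w)%R] x : R)%:E).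
  exact/measurable_EFinP/measurable_indic.
apply: (@le_lt_trans _ _
    (\int[nu w]_x (K%:E * (\1_[set x : rvec V R | (e / 2 < x w)%R] x)%:E))%E).
  apply: ge0_le_integral => //.
  - by move=> x _; exact: g0.
  - exact: mg.
  - exact: measurable_funeM.
  - move=> x _; rewrite -EFinM lee_fin indicE.
    case: (boolP (_ \in _)); first by rewrite mulr1 => _; have /andP[] := gK x wW.
    rewrite notin_setE /= => /negP; rewrite -leNgt => xw.
    by rewrite mulr0 /g test_piece_small.
rewrite ge0_integralZl_EFin//.
by rewrite -measure_integral_indic// lte_mul_pinfty// nu_fin.
Qed.

Lemma test_integral_nu_fin :
  (\int[nuW]_(x in orthant0 W) (h x)%:E)%E \is a fin_num.
Proof.
rewrite test_integral_nu; apply/sum_fin_numP => w _ wW.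
exact: test_integral_fin.
Qed.

(** For [t > 0] the vector [X / t] lies in the orthant, so outside [orthant0] all its coordinates in
    [W] are 0 and the pieces vanish. *)
Lemma test_integral_scaled t : 0 < t ->
  (\int[scaled_tail W X b t]_(x in orthant0 W) (h x)%:E =
   \sum_(w in W) `|b t|%:E * \int[P]_z (g w (scaled_vec X t z))%:E)%E.
Proof.
move=> t0.
transitivity (\int[scaled_tail W X b t]_(x in orthant0 W) \sum_(w in W) (g w x)%:E)%E.
  apply: eq_integral => x; rewrite inE => ox.
  by rewrite sum_g ?indicE ?mem_set ?mule1//; case: ox.
rewrite (ge0_integral_sum_in _ mO mg (fun w x => @g0 w x)).
apply: eq_bigr => w wW.
pose p := (fun x => (g w x)%:E) \_ (orthant0 W).
have mp : measurable_fun setT p by exact: mpiece.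
have p0 x : (0 <= p x)%E by rewrite /p patchE; case: ifP => // _; exact: g0.
transitivity (\int[mrestr (scaled_law X b t) mO]_x p x)%E.
  by rewrite [LHS]integral_mkcond.
transitivity (\int[scaled_law X b t]_x p x)%E.
  rewrite ge0_integral_mrestr// [LHS]integral_mkcond; apply: eq_integral => x _.
  by rewrite [LHS]patchE; case: ifPn => // /negbTE nx; rewrite /p patchE nx.
rewrite ge0_integral_mscale//; congr (_ * _)%E.
rewrite (ge0_integral_image P (scaled_vec X t))//; apply: eq_integral => z _.
rewrite /p patchE; case: ifPn => //; rewrite notin_setE => nz.
rewrite /g test_piece_small//; apply: le_trans (ltW e2).
rewrite leNgt; apply/negP => xw; apply: nz; split.
  by move=> v; rewrite /scaled_vec divr_ge0// ltW.
by apply: lt_le_trans xw _; exact: le_max_on.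
Qed.

Lemma test_integral_cvg :
  (\int[scaled_tail W X b t]_(x in orthant0 W) (h x)%:E)%E @[t --> +oo] -->
  (\int[nuW]_(x in orthant0 W) (h x)%:E)%E.
Proof.
rewrite test_integral_nu.
have : (\sum_(w in W) `|b t|%:E * \int[P]_z (g w (scaled_vec X t z))%:E)%E
    @[t --> +oo] --> (\sum_(w in W) \int[nu w]_x (g w x)%:E)%E.
  elim: (index_enum V) => [|v s IH].
    by under eq_fun do rewrite big_nil; rewrite big_nil; exact: cvg_cst.
  under eq_fun do rewrite big_cons; rewrite big_cons; case: ifP => // vW.
  apply: cvgeD => //.
    by rewrite fin_num_adde_defr// test_integral_fin.
  apply: (@nu_limit v (g v) (e / 2) K) => //.
  - exact: g_cont.
  - by move=> x; exact: gK.
  - by move=> x; exact: test_piece_small.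
apply: cvg_trans; apply: near_eq_cvg; near=> t.
by rewrite test_integral_scaled.
Unshelve. all: by end_near. Qed.

End nonnegative_test.
(** Positive and negative parts of a test function have finite limits, which may be subtracted. [W]
    is kept general to cover both [U] and a single node. *)
Lemma scaled_tail_cvg_M0 : scaled_tail W X b t @[t --> +oo] --> nuW.
Proof.
apply: cvg_M0 => f [cf [K fK] [e e0 fe]].
pose fp x := pospart (f x); pose fn x := pospart (- f x).
have cpos : continuous (@pospart R).
  by apply: (@lipschitz_cts R _ 1) => r s; rewrite mul1r; exact: pospart_lip.
have cfp : {within orthant0 W, continuous fp}.
  by move=> x; apply: continuous_comp (cf x) (cpos _).
have cfn : {within orthant0 W, continuous fn}.
  have cneg : continuous (fun r : R => pospart (- r)).
    apply: (@lipschitz_cts R _ 1) => r s; rewrite mul1r.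
    apply: le_trans (pospart_lip _ _) _.
    by rewrite -opprD normrN.
  by move=> x; exact: continuous_comp (cf x) (cneg _).
have K0 : 0 <= Num.max K 0 by rewrite le_max lexx orbT.
have bp x : orthant0 W x -> 0 <= fp x <= Num.max K 0.
  move=> ox; rewrite pospart_ge0 /= /fp /pospart ge_max K0 andbT.
  by rewrite le_max (le_trans (ler_norm _) (fK x ox)).
have bn x : orthant0 W x -> 0 <= fn x <= Num.max K 0.
  move=> ox; rewrite pospart_ge0 /= /fn /pospart ge_max K0 andbT.
  by rewrite le_max (le_trans (ler_norm _))// normrN fK.
have sp x : orthant0 W x -> max_on W x <= e -> fp x = 0.
  by move=> ox xe; rewrite /fp fe// pospart_id.
have sn x : orthant0 W x -> max_on W x <= e -> fn x = 0.
  by move=> ox xe; rewrite /fn fe// oppr0 pospart_id.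
have splitf (m : {measure set (rvec V R) -> \bar R}) :
    (\int[m]_(x in orthant0 W) (f x)%:E = \int[m]_(x in orthant0 W) (fp x)%:E -
     \int[m]_(x in orthant0 W) (fn x)%:E)%E.
  rewrite integralE; congr (_ - _)%E; apply: eq_integral => x _.
    by rewrite funeposE /= EFin_max.
  by rewrite funenegE /= EFin_max.
have Hp := test_integral_cvg e0 K0 cfp bp sp.
have Hn := test_integral_cvg e0 K0 cfn bn sn.
have finp := test_integral_nu_fin e0 K0 cfp bp sp.
have finn := test_integral_nu_fin e0 K0 cfn bn sn.
apply: fine_cvg; rewrite fineK; last by rewrite splitf fin_numB finp.
rewrite splitf; apply: cvg_trans (cvgeB _ Hp Hn); last by rewrite fin_num_adde_defr.
by apply: near_eq_cvg; apply: nearW => t /=; rewrite splitf.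
Qed.

End M0_convergence.

(** * Kernel hypotheses in epsilon-delta form, and assembly of the limit theorem *)

Section kernel_hypotheses.
Context (R : realType) (k : R.-pker R ~> R).

Lemma kernel_Rintegral_cvg (m : probability R R) :
  weak_cvg (fun x => image_measure (k x) (div_by x)) m ->
  forall g : R -> R, continuous g -> (forall x, 0 <= g x <= 1) ->
  \int[pker_at k x]_y g (y / x) @[x --> +oo] --> \int[m]_y g y.
Proof.
move=> H g cg g01.
have mg : measurable_fun setT g by exact: continuous_measurable_fun.
have g1 x : `|g x| <= 1 by have /andP[g0 ?] := g01 x; rewrite ger0_norm.
have bg : bounded_fun g.
  by exists 1; split => // K K1 x _; exact: le_trans (g1 x) (ltW K1).
have ig : m.-integrable setT (EFin \o g) by exact: bounded_integrable mg g1.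
have Hg := H g cg bg; rewrite -(@EFin_Rintegral _ _ _ m) in Hg => //.
have /fine_cvgP[_] := Hg; apply: cvg_trans; apply: near_eq_cvg.
apply: nearW => x /=.
by rewrite [X in fine X](Rintegral_image (pker_at k x) (div_by x) mg g1).
Qed.

(** The limit superior is an infimum over neighbourhoods of infinity: one [delta] close to 0, and
    one neighbourhood for it, give a bound uniform in [s]. *)
Lemma kernel_small (eta : R) : 0 < eta ->
  limf_esup (fun x : R => ereal_sup
    [set k (eps * x) [set y | eta < y / x] | eps in `[0, delta]%classic])
    (pinfty_nbhs R) @[delta --> 0^'+] --> 0%E ->
  forall eps : R, 0 < eps -> exists2 delta : R, 0 < delta &
    exists x0 : R, forall x s : R, x0 <= x -> 0 <= s <= delta ->
    fine (k (s * x) [set y | eta < y / x]) < eps.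
Proof.
move=> eta0 H eps e0.
pose F (delta : R) := limf_esup (fun x : R => ereal_sup
    [set k (s * x) [set y | eta < y / x] | s in `[0, delta]%classic]) (pinfty_nbhs R).
have nF : \forall delta \near 0^'+, (F delta < eps%:E)%E.
  apply: (H [set z | (z < eps%:E)%E]).
  change (nbhs (0 : R) [set r : R | (r%:E < eps%:E)%E]).
  by apply: filterS (lt_nbhsl e0) => r; rewrite /= lte_fin.
have [delta d0 Fd] : exists2 delta : R, 0 < delta & (F delta < eps%:E)%E.
  near (0 : R)^'+ => delta; exists delta; last by near: delta.
  by near: delta; exact: nbhs_right_gt.
exists delta => //.
move: Fd; rewrite /F /limf_esup => /ereal_inf_lt[_ [A [x0 [_ Ax0]] <-] Fd].
(* Neighbourhoods of infinity contain open rays; the shift by 1 accommodates the non-strict bound on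
   [x]. *)
exists (x0 + 1) => x s x0x s01.
have xx0 : x0 < x by rewrite (lt_le_trans _ x0x)// ltrDl.
have kle : (k (s * x)%R [set y | (eta < y / x)%R] < eps%:E)%E.
  apply: le_lt_trans Fd; apply: le_trans (ereal_sup_ubound _); last first.
    by exists x => //; exact: Ax0.
  by apply: ereal_sup_ubound; exists s => //; rewrite /= in_itv.
rewrite -lte_fin fineK// ge0_fin_numE//.
exact: lt_trans kle (ltry _).
Unshelve. all: by end_near. Qed.

End kernel_hypotheses.

Section spectral_formula.
Context (R : realType) (V : finType) (u : V) (alpha c : R).
Context d' (T' : measurableType d') (P' : probability T' R).
Context (Th : {mfun T' >-> rvec V R}).
Hypothesis alpha_gt0 : 0 < alpha.
Hypothesis c_ge0 : 0 <= c.
Hypothesis Th_root : forall w, Th w u = 1.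

Let spec := spectral_measure P' Th alpha_gt0 c_ge0.
Let D : set (rvec V R) := [set y | 0 < y u].

(** [f] is controlled only on [O], so the integrand is extended by 0; its indicator confines the
    integral to [D], where [m] and the spectral measure agree. *)
Lemma ge0_integral_spectral_on (m : {measure set (rvec V R) -> \bar R})
    (O : set (rvec V R)) (f : rvec V R -> \bar R) : measurable O ->
  (forall B, measurable B -> m (B `&` D) = spec (B `&` D)) ->
  (forall (z : R) w, 0 < z -> O (scale_vec (z, Th w))) ->
  measurable_fun O f -> (forall x, O x -> 0 <= f x)%E ->
  (\int[m]_(x in O) (f x * (\1_[set y : rvec V R | (0 < y u)%R] x)%:E) =
   c%:E * \int[P']_w \int[lebesgue_measure]_(z in `]0%R, +oo[%classic)
     (f (scale_vec (z, Th w)) * (alpha * z `^ (- alpha - 1))%R%:E))%E.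
Proof.
move=> mO mspec Oscale mf f0.
have mD : measurable D by exact: measurable_coord_gt.
pose h := (fun x => f x * (\1_D x)%:E)%E \_ O.
have mh : measurable_fun setT h.
  apply/(measurable_restrictT _ mO); apply: emeasurable_funM => //.
  by apply/measurable_funTS/measurable_EFinP; exact: measurable_indic.
have h0 x : (0 <= h x)%E.
  rewrite /h patchE; case: ifPn => // /set_mem Ox.
  by rewrite mule_ge0 ?f0// lee_fin.
have restr (m' : {measure set (rvec V R) -> \bar R}) :
    (\int[m']_x h x = \int[m']_(x in D) h x)%E.
  rewrite [RHS]integral_mkcond; apply: eq_integral => x _.
  rewrite [RHS]patchE; case: ifPn => // xD; rewrite /h patchE; case: ifP => // _.
  by rewrite indicE (negbTE xD) mule0.
transitivity (\int[m]_x h x)%E; first by rewrite [LHS]integral_mkcond.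
rewrite (restr m) (ge0_integral_agree mD mspec mh h0) -(restr spec).
rewrite (ge0_integral_spectral P' Th alpha_gt0 c_ge0 mh h0); congr (_ * _)%E.
apply: eq_integral => w _; apply: eq_integral => z.
rewrite inE /= in_itv/= andbT => z0; congr (_ * _)%E.
rewrite /h patchE mem_set; last exact: Oscale.
by rewrite indicE mem_set ?mule1// /D /= /scale_vec/= Th_root mulr1.
Qed.

End spectral_formula.

Unset Implicit Arguments.
Set Strict Implicit.

Theorem corollary4p1
  (R : realType) (d : measure_display) (T : measurableType d)
  (P : probability T R)
  (V : finType) (E : rel V) (X : V -> {RV P >-> R}) (U : {set V})
  (alpha : R) (b : R -> R) (c : V -> R)
  (kappa : V * V -> R.-pker R ~> R) (mu : V * V -> probability R R)
  (d' : measure_display) (T' : measurableType d') (P' : probability T' R)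
  (M : V * V -> {RV P' >-> R}) (Pa : probability R R)
  (X_ge0 : forall v w, 0 <= X v w)
  (X_markov : markov_tree E X)
  (U_neq0 : U != finset.set0)
  (alpha_gt0 : 0 < alpha)
  (b_rv : regularly_varying b alpha)
  (c_gt0 : forall u, u \in U -> 0 < c u)
  (tail_eq : forall u, u \in U ->
     ((b t)%:E * P [set w | (t < X u w)%R])%E @[t --> +oo] --> (c u)%:E)
  (mu_ge0 : forall e, e \in edges_from_set E U -> mu e `[0, +oo[%classic = 1%E)
  (kappa_version : forall e, e \in edges_from_set E U ->
     cond_distr_version (X e.1) (X e.2) (kappa e))
  (kappa_cvg : forall e, e \in edges_from_set E U ->
     weak_cvg (fun x => image_measure (kappa e x) (div_by x)) (mu e))
  (kappa_small : forall e, e \in edges_from_set E U ->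
     (exists u ebar, [/\ u \in U, e \in edges_from E u,
        ebar \in tree_path E u e.1 & (0 < mu ebar [set 0%R])%E]) ->
     forall eta : R, 0 < eta ->
       limf_esup (fun x : R => ereal_sup
         [set kappa e (eps * x) [set y | eta < y / x] | eps in `[0, delta]%classic])
         (pinfty_nbhs R)
         @[delta --> 0^'+] --> 0%E)
  (M_ge0 : forall e w, e \in edges_from_set E U -> 0 <= M e w)
  (M_indep : mutually_independent (edges_from_set E U) M)
  (M_law : forall e, e \in edges_from_set E U ->
     forall B : set R, measurable B -> distribution P' (M e) B = mu e B)
  (Pa_pareto : is_pareto alpha Pa) :
  let law_Theta u : probability (rvec V R) R := distribution P' (tree_product E M u) in
  let law_Y u : {measure set (rvec V R) -> \bar R} :=
    image_measure (Pa \x law_Theta u)%E scale_vec in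
  [/\
    forall u, u \in U ->
      weak_cvg (fun t => distribution (cond_gt (X u) t) (ratio_vec X u))
        (law_Theta u),
    forall u, u \in U ->
      weak_cvg (fun t => distribution (cond_gt (X u) t) (polar_vec X u t))
        (Pa \x law_Theta u)%E,
    forall u, u \in U ->
      weak_cvg (fun t => distribution (cond_gt (X u) t) (scaled_vec X t))
        (law_Y u) &
    exists nu : M0 R U, [/\
      scaled_tail U X b t @[t --> +oo] --> nu,
      forall u (uU : u \in U),
        scaled_tail [set u]%SET X b t @[t --> +oo] --> M0_restr1 nu uU,
      forall u, u \in U -> forall B : set (rvec V R), measurable B ->
        law_Y u B = ((c u)^-1%:E * nu (B `&` [set x | (1 < x u)%R]))%E &
      forall u, u \in U -> forall f : rvec V R -> \bar R,
        measurable_fun (orthant0 U) f ->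
        (forall x, orthant0 U x -> (0 <= f x)%E) ->
        (\int[nu]_(x in orthant0 U) (f x * (\1_[set y | (0 < y u)%R] x)%:E) =
         (c u)%:E * \int[P']_w \int[lebesgue_measure]_(z in `]0%R, +oo[%classic)
           (f (scale_vec (z, tree_product E M u w)) *
              (alpha * z `^ (- alpha - 1))%R%:E))%E]].
Proof.
move=> law_Theta law_Y.
have [_ treeE markovE] := X_markov.
have [[tb [b0 _]] b_rv'] := b_rv.
have b_gt0 : \forall t \near +oo, 0 < b t.
  by exists tb; split => //; exact: num_real.
have JU u : u \in U -> {subset edges_from E u <= edges_from_set E U}.
  by move=> uU; apply/fintype.subsetP; exact: finset.bigcup_sup.
have Th_root u w : tree_product E M u w u = 1 by exact: tree_product_root.
have Th_ge0 u w v : u \in U -> 0 <= tree_product E M u w v.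
  by move=> uU; apply: tree_product_ge0 => // e /(JU u uU); exact: M_ge0.
have X_pos u (uU : u \in U) := tail_gt0 (c_gt0 u uU) (tail_eq u uU).
have scaled u (uU : u \in U) (f : rvec V R -> R) (L : R) :
    (forall x, 0 <= f x <= 1) -> vlipschitz L f ->
    \int[cond_gt (X u) t]_w f (scaled_vec X t w) @[t --> +oo] -->
    \int[(Pa \x law_Theta u)%E]_p f (scale_vec p).
  apply: (scaled_limit_lipschitz X_ge0 treeE markovE alpha_gt0 Pa_pareto (X_pos u uU)
    (kappa := kappa) (mu := mu)).
  - by move=> l; exact: (cond_gt_tail (c_gt0 u uU) b_gt0 b_rv' (tail_eq u uU)).
  - by move=> e /(JU u uU); exact: kappa_version.
  - by move=> e /(JU u uU) eJ; exact: (kernel_Rintegral_cvg (kappa_cvg e eJ)).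
  - move=> e ebar eu ea eb0 eta eps eta0.
    apply: (kernel_small eta0); apply: kappa_small => //; first exact: (JU u uU).
    by exists u, ebar.
  - by move=> e w /(JU u uU); exact: M_ge0.
  - move=> K KJ; apply: M_indep; apply: fintype.subset_trans KJ _.
    by apply/fintype.subsetP; exact: JU.
  - by move=> e /(JU u uU); exact: M_law.
have lim_ae u : u \in U ->
    {ae (Pa \x law_Theta u)%E, forall p, 1 < p.1 /\ p.2 u = 1}.
  move=> uU; apply: (ae_limit Pa_pareto (Q := [set x : rvec V R | x u = 1])).
    rewrite (_ : mkset _ = (fun x : rvec V R => x u) @^-1` [set 1]) //.
    by rewrite -[X in measurable X]setTI; exact: measurable_coord.
  by apply: aeW => w; exact: Th_root.
have cvg_scaled u (uU : u \in U) := weak_cvg_scaled (scaled u uU).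
split.
- by move=> u uU; exact: (weak_cvg_ratio (X_pos u uU) (scaled u uU) (lim_ae u uU)).
- by move=> u uU; exact: (weak_cvg_polar (X_pos u uU) (scaled u uU) (lim_ae u uU)).
- exact: cvg_scaled.
(* [spectral_measure] needs a nonnegative constant at every node, whereas [c] is known to be
   positive on [U] only; 1 is an arbitrary filler. *)
pose c' u := if u \in U then c u else 1.
have c'E u : u \in U -> c' u = c u by rewrite /c' => ->.
have c'_gt0 u : 0 < c' u by rewrite /c'; case: ifP => // uU; exact: c_gt0.
pose nu u : {measure set (rvec V R) -> \bar R} :=
  spectral_measure P' (tree_product E M u) alpha_gt0 (ltW (c'_gt0 u)).
have nu_limit u (f : rvec V R -> R) (e K : R) : u \in U -> 0 < e ->
    continuous f -> (forall x, 0 <= f x <= K) -> (forall x, x u <= e -> f x = 0) ->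
    (`|b t|%:E * \int[P]_w (f (scaled_vec X t w))%:E)%E @[t --> +oo] -->
    (\int[nu u]_x (f x)%:E)%E.
  move=> uU; apply: (spectral_limit (Th_root u) Pa_pareto b_gt0 b_rv').
    by rewrite c'E//; exact: tail_eq.
  exact: cvg_scaled.
have nu_tail u (B : set (rvec V R)) (e : R) : 0 < e -> measurable B ->
    nu u (B `&` [set x | e < x u]) =
    ((c' u * e `^ (- alpha))%:E * law_Y u [set x | B (fun v => (e * x v)%R)])%E.
  move=> e0 mB; exact: (spectral_measure_tail P' alpha_gt0 _ (Th_root u) Pa_pareto).
have nu_fin u (e : R) : u \in U -> 0 < e -> (nu u [set x | (e < x u)%R] < +oo)%E.
  move=> uU e0; rewrite -[X in nu u X]setTI nu_tail//.
  apply: lte_mul_pinfty => //; first by rewrite lee_fin mulr_ge0 ?powR_ge0 ?ltW.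
  have mA : measurable (scale_vec @^-1` setT : set (R * rvec V R)).
    by rewrite preimage_setT.
  exact: le_lt_trans (probability_le1 (Pa \x law_Theta u)%E mA) (ltry 1).
have nu_null u (N : set (rvec V R)) : u \in U -> measurable N ->
    N `<=` ~` (@orthant V R `&` [set x | 0 < x u]) -> nu u N = 0%E.
  move=> uU mN Nsub; apply: spectral_measure_null => // z w z0 /Nsub; apply; split.
    by move=> v; rewrite /scale_vec /= mulr_ge0 ?Th_ge0// ltW.
  by rewrite /= /scale_vec/= Th_root mulr1.
have nu_supp u : u \in U -> nu u (~` (@orthant V R `&` [set x | 0 < x u])) = 0%E.
  move=> uU; apply: nu_null => //; apply: measurableC; apply: measurableI.
    exact: measurable_orthant.
  exact: measurable_coord_gt.
have /set0Pn[u0 u0U] := U_neq0.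
pose nuU : M0 R U := MkM0 (glued_measure_supp nu_supp u0U)
  (glued_measure_fin nu_limit nu_fin u0U).
have nuU_nu u (B : set (rvec V R)) : u \in U -> measurable B ->
    nuU (B `&` [set x | 0 < x u]) = nu u (B `&` [set x | 0 < x u]).
  exact: (glued_measureE nu_limit nu_fin u0U).
exists nuU; split.
- exact: (scaled_tail_cvg_M0 X_ge0 nu_limit nu_fin nuU_nu).
- move=> u uU.
  have in1 v : v \in [set u]%SET -> v \in U by rewrite finset.inE => /eqP ->.
  apply: (scaled_tail_cvg_M0 (nu := nu) X_ge0).
  + by move=> v f e K /in1; exact: nu_limit.
  + by move=> v e /in1; exact: nu_fin.
  + move=> v B; rewrite finset.inE => /eqP -> {v} mB.
    have mO := @measurable_orthant0 V R [set u]%SET.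
    have mC : measurable (B `&` [set x : rvec V R | 0 < x u]).
      by apply: measurableI => //; exact: measurable_coord_gt.
    (* [orthant0] for a single node is [0 < x u] minus the points outside the orthant, which [nu u]
       does not charge. *)
    rewrite [RHS](measureDI (nu u) mC mO) [X in (X + _)%E]nu_null//; last 2 first.
    * exact: measurableD.
    * move=> x [[_ xu] nx] [ox _]; apply: nx; split => //.
      apply: lt_le_trans xu _; apply: (le_max_on x); exact: finset.set11.
    rewrite add0e; transitivity (nuU (B `&` [set x | 0 < x u] `&` orthant0 [set u]%SET)) => //.
    have := nuU_nu u _ uU (measurableI _ _ mB mO).
    by rewrite (setIAC B).
- move=> u uU B mB.
  have -> : nuU (B `&` [set x | 1 < x u]) = nu u (B `&` [set x | 1 < x u]).
    have B0 : B `&` [set x : rvec V R | 1 < x u] =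
        (B `&` [set x | 1 < x u]) `&` [set x | 0 < x u].
      by apply/esym/setIidPl => x [_ ?]; exact: lt_trans ltr01 _.
    rewrite B0 nuU_nu//; apply: measurableI => //; exact: measurable_coord_gt.
  (* The tail formula at [e = 1], where the power is 1 and [c u] cancels. *)
  rewrite nu_tail// powR1 mulr1 c'E// muleA -EFinM mulVf ?gt_eqF ?c_gt0// mul1e.
  by congr (law_Y u _); apply/seteqP; split => x /=; under eq_fun do rewrite mul1r.
- move=> u uU f mf f0; rewrite -(c'E u uU).
  have scaleO (z : R) w : 0 < z -> orthant0 U (scale_vec (z, tree_product E M u w)).
    move=> z0; split; first by move=> v; rewrite /scale_vec /= mulr_ge0 ?Th_ge0// ltW.
    rewrite /=; apply: lt_le_trans (le_max_on _ uU).
    by rewrite /scale_vec/= Th_root mulr1.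
  exact: (@ge0_integral_spectral_on _ _ _ _ _ _ _ P' _ alpha_gt0 (ltW (c'_gt0 u))
    (Th_root u) nuU _ _ (measurable_orthant0 U) (fun B mB => nuU_nu u B uU mB) scaleO mf f0).
Qed.
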